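(* Let $k>0$ and let $\lambda$ be a real constant with $|\lambda|\le 1$. Let $X:M^n\to\overline{\mathcal B}^{n+1}_k(0)\subset\mathbb{R}^{n+1}$ be an $n$-dimensional complete connected non-compact $\lambda$-hypersurface. Then $$\lim_{r\to\infty}\ \sup_{M\setminus B(r)}|A|\ \ge\ \sqrt{\frac{1-\lambda^2}{3}},$$ where $B(r)$ is the geodesic ball of $M$ with radius $r$ (centered at a fixed point of $M$).
   Context: A $\lambda$-hypersurface is an (isometrically) immersed hypersurface $X:M^n\to\mathbb{R}^{n+1}$ with unit normal field $N$ satisfying $H-\frac{\langle N,X\rangle}{2}=\lambda$, where $\lambda$ is a constant. Conventions: for a local orthonormal tangent frame $e_1,\dots,e_n$, $h_{ij}=\langle\nabla_{e_i}e_j,N\rangle$ are the coefficients of the second fundamental form $A$ ($\nabla$ the Euclidean connection), $|A|^2=\sum_{i,j}h_{ij}^2$, and the mean curvature is $H=\sum_i\langle\nabla_{e_i}N,e_i\rangle=-\sum_i h_{ii}$. $M$ carries the induced metric and complete means complete in this metric. $\overline{\mathcal B}^{n+1}_k(0)$ is the closed Euclidean ball with center $0$ and radius $k$. The supremum (hence the limit) is allowed to be $+\infty$. *)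

(* Defs.v *)
From HB Require Import structures.
From mathcomp Require Import all_boot all_order all_algebra.
From mathcomp Require Import all_classical all_reals all_analysis.
Set Implicit Arguments.
Unset Strict Implicit.
Unset Printing Implicit Defensive.
Import Order.TTheory GRing.Theory Num.Theory.
Import numFieldNormedType.Exports.
Local Open Scope classical_set_scope.
Local Open Scope ring_scope.

(* The library norm `|v| of a row vector is the sup norm (it induces the usual
   topology); metric notions use the following Euclidean structure instead. *)
Definition dotp {R : realType} {m : nat} (u v : 'rV[R]_m) : R :=
  \sum_(i < m) u 0 i * v 0 i.

Definition enorm {R : realType} {m : nat} (u : 'rV[R]_m) : R :=
  Num.sqrt (dotp u u).

(* Intended for U open, so that 'D_v f only depends on f restricted to U. *)
Fixpoint Ck_on {R : realType} {V W : normedModType R} (k : nat)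
    (U : set V) (f : V -> W) : Prop :=
  (forall x, U x -> {for x, continuous f}) /\
  (if k is j.+1 then
     forall v : V, (forall x, U x -> derivable f x v) /\
                   Ck_on j U (fun x => 'D_v f x)
   else True).

Definition smooth_on {R : realType} {V W : normedModType R}
    (U : set V) (f : V -> W) : Prop := forall k, Ck_on k U f.

(* The values of cmap outside cdom, and of cinv outside ccod, are irrelevant. *)
Record chart (R : realType) (n : nat) (M : Type) := Chart {
  cdom : set M;
  cmap : M -> 'rV[R]_n;
  cinv : 'rV[R]_n -> M }.

Definition ccod {R : realType} {n : nat} {M : Type} (c : chart R n M) :
  set 'rV[R]_n := cmap c @` cdom c.

Record is_chart {R : realType} {n : nat} {M : topologicalType}
    (c : chart R n M) : Prop := IsChart {
  chart_open_dom : open (cdom c);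
  chart_open_cod : open (ccod c);
  chart_map_cont : forall p, cdom c p -> {for p, continuous (cmap c)};
  chart_inv_cont : forall x, ccod c x -> {for x, continuous (cinv c)};
  chart_mapK : forall p, cdom c p -> cinv c (cmap c p) = p }.

Record smooth_manifold {R : realType} {n : nat} {M : topologicalType}
    (atlas : set (chart R n M)) : Prop := SmoothManifold {
  manifold_hausdorff : hausdorff_space M;
  manifold_second_countable : @second_countable M;
  manifold_charts : forall c, atlas c -> is_chart c;
  manifold_cover : forall p, exists2 c, atlas c & cdom c p;
  manifold_transition : forall c1 c2, atlas c1 -> atlas c2 ->
    smooth_on (cmap c1 @` (cdom c1 `&` cdom c2)) (cmap c2 \o cinv c1) }.

Section Hypersurface.
Context {R : realType} {n : nat} {M : topologicalType}.
Variable atlas : set (chart R n M).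
Implicit Types (c : chart R n M) (X N : M -> 'rV[R]_n.+1).

Definition smooth_map {m : nat} (f : M -> 'rV[R]_m) : Prop :=
  forall c, atlas c -> smooth_on (ccod c) (f \o cinv c).

(* dtan X c x v is dX applied to the tangent vector at cinv c x whose
   coordinates in the chart c are v. *)
Definition dtan X c (x v : 'rV[R]_n) : 'rV[R]_n.+1 := 'D_v (X \o cinv c) x.

Definition immersion X : Prop :=
  smooth_map X /\
  forall c x v, atlas c -> ccod c x -> dtan X c x v = 0 -> v = 0.

Definition unit_normal X N : Prop :=
  [/\ smooth_map N,
      forall p, dotp (N p) (N p) = 1 &
      forall c x v, atlas c -> ccod c x -> dotp (dtan X c x v) (N (cinv c x)) = 0].

(* E i is a tangent vector field written in the coordinates of c, and
   e_i = dtan X c y (E i y) is the corresponding vector of R^{n+1}. *)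
Definition local_orthonormal_frame X c (x : 'rV[R]_n)
    (E : 'I_n -> 'rV[R]_n -> 'rV[R]_n) : Prop :=
  exists W : set 'rV[R]_n,
    [/\ open W, W x, W `<=` ccod c,
        forall i, smooth_on W (E i) &
        forall y i j, W y ->
          dotp (dtan X c y (E i y)) (dtan X c y (E j y)) = (i == j)%:R].

(* h_ij = < nabla_{e_i} e_j, N > at the point cinv c x. *)
Definition second_ff X N c (x : 'rV[R]_n)
    (E : 'I_n -> 'rV[R]_n -> 'rV[R]_n) (i j : 'I_n) : R :=
  dotp ('D_(E i x) (fun y => dtan X c y (E j y)) x) (N (cinv c x)).

(* H = sum_i < nabla_{e_i} N, e_i > (which equals - sum_i h_ii). *)
Definition mean_curvature X N c (x : 'rV[R]_n)
    (E : 'I_n -> 'rV[R]_n -> 'rV[R]_n) : R :=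
  \sum_(i < n) dotp ('D_(E i x) (N \o cinv c) x) (dtan X c x (E i x)).

Definition lambda_hypersurface X N (lambda : R) : Prop :=
  [/\ immersion X, unit_normal X N &
      forall c p E, atlas c -> cdom c p ->
        local_orthonormal_frame X c (cmap c p) E ->
        mean_curvature X N c (cmap c p) E - dotp (N p) (X p) / 2 = lambda].

(* normA_at X N p a: a is the value of |A| at p. Since |A| does not depend on
   the local orthonormal frame, there is exactly one such a for each p. *)
Definition normA_at X N (p : M) (a : R) : Prop :=
  exists c E, [/\ atlas c, cdom c p, local_orthonormal_frame X c (cmap c p) E &
    a = Num.sqrt (\sum_(i < n) \sum_(j < n)
                    second_ff X N c (cmap c p) E i j ^+ 2)].

(* A C^1 curve [0, 1] -> M, given as the restriction of a map R -> M that is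
   C^1 near [0, 1]. *)
Definition C1_curve (g : R -> M) : Prop :=
  forall t, 0 <= t <= 1 -> {for t, continuous g} /\
    exists c (W : set R), [/\ atlas c, cdom c (g t), open W, W t &
      Ck_on 1 W (cmap c \o g)].

(* In the induced metric the norm of g'(t) is |dX(g'(t))| = |(X \o g)'(t)|. *)
Definition curve_length X (g : R -> M) : R :=
  (\int[@lebesgue_measure R]_(t in `[0%R, 1%R]) enorm (derive1 (X \o g) t))%R.

(* There is a piecewise C^1 curve from p to q, given as a concatenation of
   C^1 curves on [0, 1], of length l. *)
Inductive joined_by X : M -> M -> R -> Prop :=
| joined_nil p : joined_by X p p 0
| joined_cons g q l : C1_curve g -> joined_by X (g 1) q l ->
    joined_by X (g 0) q (curve_length X g + l).

Definition geodist X (p q : M) : \bar R :=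
  ereal_inf [set l%:E | l in [set l | joined_by X p q l]].

Definition geoball X (p : M) (r : R) : set M :=
  [set q | (geodist X p q < r%:E)%E].

Definition complete_metric X : Prop :=
  forall u : nat -> M,
    (forall e : R, 0 < e -> exists m, forall i j, (m <= i)%N -> (m <= j)%N ->
       (geodist X (u i) (u j) < e%:E)%E) ->
    exists p, forall e : R, 0 < e -> exists m, forall i, (m <= i)%N ->
      (geodist X (u i) p < e%:E)%E.

Definition sup_normA_outside X N (p : M) (r : R) : \bar R :=
  ereal_sup [set a%:E | a in
    [set a | exists2 q, ~ geoball X p r q & normA_at X N q a]].

End Hypersurface.

(* Main.v *)
(* Put u = |X|^2 / 2 and s = <X, N>, so that s = 2 (H - lambda) and the Laplacian
   of u is n - s H. If |A| <= a off a geodesic ball, with a^2 < (1 - lambda^2) / 3,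
   then H^2 <= n a^2 makes this Laplacian at least a constant gap > 0 there.
   Because |A| is bounded, N is Lipschitz for the intrinsic distance, so the
   orthogonal projection to T_p M is uniformly expanding on a geodesic ball around
   p of a fixed radius; as geodesic balls are compact (Hopf-Rinow), it has a
   continuous section over a ball of fixed radius c of T_p M. On the image,
   u - eps |X - X(p)|^2 has no interior maximum for a small fixed eps, and
   |X - X(p)| >= c on the boundary; so u exceeds u(p) by a fixed amount at a point
   at distance less than 1 from p. As M has points at arbitrarily large distance,
   iterating this contradicts the boundedness of X. *)

(* The constant comes from one completed square: s H = 2 H^2 - 2 lambda H <= 3 H^2 + lambda^2,
   because (H + lambda)^2 >= 0. With H^2 <= n a^2 and n >= 1, the Laplacian n - s H is at least 3 n
   ((1 - lambda^2) / 3 - a^2), which is the gap. The obstacle is that u need not attain its supremum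
   on M. The penalty |X - X(p)|^2 is smooth, unlike the intrinsic distance, but the immersion may
   bring distant points of M close together in R^{n+1}, so the penalty need not be large on the
   boundary of a geodesic ball. It is large on the boundary of a piece of M that is a graph over a
   ball of T_p M, and the size of that piece must not depend on p if each step is to gain a fixed
   amount; the bound on |A| provides this. The Laplacian itself never appears: at a maximum the
   ambient gradient of the penalised function is normal to M, so second derivatives along straight
   lines of a chart already see the second fundamental form alone. *)
Require Import Defs.
From HB Require Import structures.
From mathcomp Require Import all_boot all_order all_algebra.
From mathcomp Require Import all_classical all_reals all_analysis.
From mathcomp Require Import ring lra.
Import Order.TTheory GRing.Theory Num.Theory.
Import numFieldNormedType.Exports.
Local Open Scope classical_set_scope.
Local Open Scope ring_scope.
Set Implicit Arguments.
Unset Strict Implicit.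
Unset Printing Implicit Defensive.

(** * Euclidean space *)

Section Euclidean.
Context {R : realType} {m : nat}.
Implicit Types u v w : 'rV[R]_m.

Lemma dotpC u v : dotp u v = dotp v u.
Proof. by apply: eq_bigr => i _; rewrite mulrC. Qed.

Lemma dotpDl u v w : dotp (u + v) w = dotp u w + dotp v w.
Proof. by rewrite -big_split; apply: eq_bigr => i _; rewrite mxE mulrDl. Qed.

Lemma dotpZl (a : R) u v : dotp (a *: u) v = a * dotp u v.
Proof. by rewrite mulr_sumr; apply: eq_bigr => i _; rewrite mxE mulrA. Qed.

Lemma dotpNl u v : dotp (- u) v = - dotp u v.
Proof. by rewrite -scaleN1r dotpZl mulN1r. Qed.

Lemma dotpBl u v w : dotp (u - v) w = dotp u w - dotp v w.
Proof. by rewrite dotpDl dotpNl. Qed.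

Lemma dotpDr u v w : dotp u (v + w) = dotp u v + dotp u w.
Proof. by rewrite dotpC dotpDl !(dotpC u). Qed.

Lemma dotpZr (a : R) u v : dotp u (a *: v) = a * dotp u v.
Proof. by rewrite dotpC dotpZl dotpC. Qed.

Lemma dotpBr u v w : dotp u (v - w) = dotp u v - dotp u w.
Proof. by rewrite dotpC dotpBl !(dotpC u). Qed.

Lemma dotp0l u : dotp 0 u = 0.
Proof. by rewrite -(scale0r 0) dotpZl mul0r. Qed.

Lemma dotp_suml (I : Type) (r : seq I) (P : pred I) (F : I -> 'rV[R]_m) u :
  dotp (\sum_(i <- r | P i) F i) u = \sum_(i <- r | P i) dotp (F i) u.
Proof.
by elim/big_rec2: _ => [|i a b _ <-]; [rewrite dotp0l | rewrite dotpDl].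
Qed.

Lemma dotp_ge0 u : 0 <= dotp u u.
Proof. by apply: sumr_ge0 => i _; rewrite -expr2 sqr_ge0. Qed.

Lemma dotp_eq0 u : dotp u u = 0 -> u = 0.
Proof.
move=> /eqP; rewrite psumr_eq0 => [/allP u0|i _]; last by rewrite -expr2 sqr_ge0.
apply/rowP => i; rewrite mxE; apply/eqP.
by have := u0 i (mem_index_enum _); rewrite /= mulf_eq0 orbb.
Qed.

Lemma enorm_ge0 u : 0 <= enorm u.
Proof. exact: sqrtr_ge0. Qed.

Lemma sqr_enorm u : enorm u ^+ 2 = dotp u u.
Proof. exact/sqr_sqrtr/dotp_ge0. Qed.

Lemma dotp_sqr_le u v : dotp u v ^+ 2 <= dotp u u * dotp v v.
Proof.
have [v0|v0] := eqVneq (dotp v v) 0.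
  by rewrite (dotp_eq0 v0) dotpC !dotp0l expr0n mulr0.
have vgt0 : 0 < dotp v v by rewrite lt_def v0 dotp_ge0.
have := dotp_ge0 (dotp v v *: u - dotp u v *: v).
rewrite !(dotpBl, dotpBr, dotpZl, dotpZr) (dotpC v u) => h.
rewrite -subr_ge0 -(pmulr_rge0 _ vgt0); nra.
Qed.

Lemma dotp_le u v : `|dotp u v| <= enorm u * enorm v.
Proof.
rewrite -(@ler_pXn2r _ 2)// ?nnegrE ?mulr_ge0 ?enorm_ge0//.
by rewrite exprMn !sqr_enorm real_normK ?num_real ?dotp_sqr_le.
Qed.

Lemma ler_enormD u v : enorm (u + v) <= enorm u + enorm v.
Proof.
rewrite -(@ler_pXn2r _ 2)// ?nnegrE ?addr_ge0 ?enorm_ge0//.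
rewrite sqrrD !sqr_enorm dotpDl !dotpDr (dotpC v u).
have := le_trans (ler_norm _) (dotp_le u v); lra.
Qed.

Lemma enormZ (a : R) u : enorm (a *: u) = `|a| * enorm u.
Proof. by rewrite /enorm dotpZl dotpZr mulrA -expr2 sqrtrM ?sqr_ge0// sqrtr_sqr. Qed.

Lemma enormN u : enorm (- u) = enorm u.
Proof. by rewrite -scaleN1r enormZ normrN1 mul1r. Qed.

Lemma enorm_sub u v : enorm (u - v) = enorm (v - u).
Proof. by rewrite -enormN opprB. Qed.

Lemma enorm0 : enorm (0 : 'rV[R]_m) = 0.
Proof. by rewrite /enorm dotp0l sqrtr0. Qed.

Lemma enorm_eq0 u : enorm u = 0 -> u = 0.
Proof. by move=> u0; apply: dotp_eq0; rewrite -sqr_enorm u0 expr0n. Qed.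

Lemma norm_coord_le u i : `|u 0 i| <= `|u|.
Proof.
by rewrite [leRHS]/Num.norm/= mx_normrE; exact: (le_bigmax _ _ (0, i)).
Qed.

Lemma norm_row_le u (c : R) : 0 <= c -> (forall i, `|u 0 i| <= c) -> `|u| <= c.
Proof.
move=> c0 uc; rewrite [leLHS]/Num.norm/= mx_normrE bigmax_le//= => -[i j] _ /=.
by rewrite ord1.
Qed.

Lemma norm_le_enorm u : `|u| <= enorm u.
Proof.
apply: norm_row_le (enorm_ge0 u) _ => i.
rewrite -(@ler_pXn2r _ 2)// ?nnegrE ?enorm_ge0// real_normK ?num_real//.
rewrite sqr_enorm /dotp (bigD1 i)//= -expr2 lerDl sumr_ge0// => j _.
by rewrite -expr2 sqr_ge0.
Qed.

Lemma enorm_le_norm u : enorm u <= m%:R * `|u|.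
Proof.
rewrite -(@ler_pXn2r _ 2)// ?nnegrE ?mulr_ge0 ?enorm_ge0// sqr_enorm.
apply: (@le_trans _ _ (\sum_(i < m) `|u| ^+ 2)).
  apply: ler_sum => i _; rewrite -expr2 -[leLHS]real_normK ?num_real//.
  by rewrite ler_pXn2r ?nnegrE ?norm_coord_le.
rewrite sumr_const card_ord exprMn -[leLHS]mulr_natl ler_wpM2r ?sqr_ge0//.
by rewrite expr2 -natrM ler_nat; case: m => // k; rewrite leq_pmulr.
Qed.

End Euclidean.

Lemma enorm_sum_sqr {R : realType} {m : nat} (u : 'rV[R]_m) :
  enorm u ^+ 2 = \sum_(i < m) u 0 i ^+ 2.
Proof. by rewrite sqr_enorm; apply: eq_bigr => i _; rewrite expr2. Qed.

Section OrthonormalBasis.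
Context {R : realType} {n : nat}.
Variables (e : 'I_n -> 'rV[R]_n.+1) (nu : 'rV[R]_n.+1).
Hypothesis e_on : forall i j, dotp (e i) (e j) = (i == j)%:R.
Hypothesis nu_unit : dotp nu nu = 1.
Hypothesis e_nu : forall i, dotp (e i) nu = 0.

(* The matrix with rows nu, e_0, ..., e_(n-1) is orthogonal, hence so is its
   transpose. *)
Lemma parseval w : dotp w w = \sum_(i < n) dotp w (e i) ^+ 2 + dotp w nu ^+ 2.
Proof.
pose b (i : 'I_(1 + n)) := if unlift ord0 i is Some j then e j else nu.
pose Q : 'M[R]_(1 + n) := \matrix_(i, j) b i 0 j.
have QQ : Q *m Q^T = 1%:M.
  apply/matrixP => i j; rewrite !mxE.
  transitivity (dotp (b i) (b j)); first by apply: eq_bigr => k _; rewrite !mxE.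
  rewrite /b; case: unliftP => [i' ->|->]; case: unliftP => [j' ->|->].
  - by rewrite e_on (inj_eq lift_inj).
  - by rewrite e_nu.
  - by rewrite dotpC e_nu.
  - by rewrite nu_unit.
have dotpE (u v : 'rV[R]_n.+1) : dotp u v = (u *m v^T) 0 0.
  by rewrite !mxE; apply: eq_bigr => k _; rewrite !mxE.
have -> : dotp w w = dotp (w *m Q^T) (w *m Q^T).
  by rewrite !dotpE trmx_mul trmxK mulmxA -(mulmxA w) (mulmx1C QQ) mulmx1.
rewrite /dotp big_ord_recl addrC; congr (_ + _).
  apply: eq_bigr => i _; rewrite -expr2 mxE; congr (_ ^+ 2).
  by apply: eq_bigr => k _; rewrite !mxE /b liftK.
rewrite -expr2 mxE; congr (_ ^+ 2).
by apply: eq_bigr => k _; rewrite !mxE /b unlift_none.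
Qed.

(** Parseval for w minus its normal part leaves nothing. At a critical point this turns
    orthogonality to the frame into an explicit multiple of the normal. *)
Lemma orthogonal_frame w : (forall i, dotp w (e i) = 0) -> w = dotp w nu *: nu.
Proof.
move=> we; apply/eqP; rewrite -subr_eq0; apply/eqP/dotp_eq0; rewrite parseval.
rewrite dotpBl dotpZl nu_unit mulr1 subrr expr0n addr0 big1// => i _.
by rewrite dotpBl dotpZl we (dotpC nu) e_nu mulr0 subrr expr0n.
Qed.

End OrthonormalBasis.

Lemma sum_sqr_le {R : realType} (n : nat) (a b : 'I_n -> R) :
  (\sum_i a i * b i) ^+ 2 <= (\sum_i a i ^+ 2) * (\sum_i b i ^+ 2).
Proof.
have := dotp_sqr_le (\row_i a i) (\row_i b i).
rewrite /dotp; under eq_bigr do rewrite !mxE.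
under [X in _ <= X * _]eq_bigr do rewrite !mxE -expr2.
by under [X in _ <= _ * X]eq_bigr do rewrite !mxE -expr2.
Qed.

Lemma parseval_tangent {R : realType} {n : nat} (e : 'I_n -> 'rV[R]_n.+1)
    (nu w : 'rV[R]_n.+1) :
  (forall i j, dotp (e i) (e j) = (i == j)%:R) -> dotp nu nu = 1 ->
  (forall i, dotp (e i) nu = 0) -> dotp w nu = 0 ->
  enorm w ^+ 2 = \sum_i dotp w (e i) ^+ 2.
Proof.
move=> e_on nu1 e_nu wnu.
by rewrite sqr_enorm (parseval e_on nu1 e_nu) wnu expr0n addr0.
Qed.

Section OrthonormalFamily.
Context {R : realType} {n m : nat}.
Variables (e : 'I_n -> 'rV[R]_m) (nu : 'rV[R]_m).

Lemma frame_sum_coord (a : 'I_n -> R) (i : 'I_n) :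
  (forall i j, dotp (e i) (e j) = (i == j)%:R) ->
  dotp (\sum_j a j *: e j) (e i) = a i.
Proof.
move=> e_on; rewrite dotp_suml (bigD1 i)//= dotpZl e_on eqxx mulr1 big1 ?addr0//.
by move=> j ji; rewrite dotpZl e_on (negbTE ji) mulr0.
Qed.

Lemma frame_sum_normal (a : 'I_n -> R) :
  (forall i, dotp (e i) nu = 0) -> dotp (\sum_j a j *: e j) nu = 0.
Proof.
by move=> e_nu; rewrite dotp_suml big1// => j _; rewrite dotpZl e_nu mulr0.
Qed.

End OrthonormalFamily.

(** * Differential calculus *)

Section DirectionalDerivative.
Context {R : realType} {V W : normedModType R}.
Implicit Types (f : V -> W) (x v : V).

Lemma is_derive_line f x v (t : R) (d : W) :
  is_derive (x + t *: v) v f d -> is_derive t 1 (fun s : R => f (x + s *: v)) d.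
Proof.
move=> [df fE].
have E : (fun h : R => h^-1 *: (f (x + (h *: 1 + t) *: v) - f (x + t *: v))) =
         (fun h => h^-1 *: (f (h *: v + (x + t *: v)) - f (x + t *: v))).
  apply/funext => h; congr (_ *: (f _ - _)).
  by rewrite [h *: 1]mulr1 scalerDl addrCA.
by split; rewrite /derivable /derive /= E.
Qed.

Lemma line_is_derive f x v (t : R) (d : W) :
  is_derive t 1 (fun s : R => f (x + s *: v)) d -> is_derive (x + t *: v) v f d.
Proof.
have E : (fun h : R => h^-1 *: (f (x + (h *: 1 + t) *: v) - f (x + t *: v))) =
         (fun h => h^-1 *: (f (h *: v + (x + t *: v)) - f (x + t *: v))).
  apply/funext => h; congr (_ *: (f _ - _)).
  by rewrite [h *: 1]mulr1 scalerDl addrCA.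
by move=> [df fE]; split; move: df fE; rewrite /derivable /derive /= E.
Qed.

(** Only the derivative along one line is available, not differentiability of f. The chain rule is
    therefore applied to f restricted to that line, precomposed with multiplication by c; this
    covers c = 0. *)
Lemma is_derive_scale_dir f x v (c : R) (d : W) :
  is_derive x v f d -> is_derive x (c *: v) f (c *: d).
Proof.
move=> fd.
have fd' : is_derive (x + (c * 0) *: v) v f d by rewrite mulr0 scale0r addr0.
have /is_derive_line gd := fd'.
have [gdiff gE] := gd.
have /derivable1_diffP gdf := gdiff.
have cd : is_diff (0 : R) (fun s : R => c * s) (fun s : R => c * s).
  exact: is_diff_scaler.
rewrite -[x]addr0 -(scale0r (c *: v)); apply: line_is_derive.
have -> : (fun s : R => f (x + s *: (c *: v))) =
          (fun s : R => f (x + s *: v)) \o (fun s : R => c * s).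
  by apply/funext => s /=; rewrite scalerA mulrC.
have gdf' := differentiableP gdf.
have := is_diff_comp cd gdf' => comp.
split; first exact/derivable1_diffP/ex_diff.
rewrite deriveE; last exact: ex_diff.
rewrite diff_val /= mulr1 -gE deriveE//.
by rewrite -linearZ/= [c *: 1]mulr1.
Qed.

Lemma derive_scale_dir f x v (c : R) :
  derivable f x v -> 'D_(c *: v) f x = c *: 'D_v f x.
Proof. by move=> /derivableP/is_derive_scale_dir h; rewrite derive_val. Qed.

End DirectionalDerivative.

Lemma mvt_line {R : realType} {V : normedModType R} (g : V -> R) (x v : V) :
  (forall t : R, 0 <= t <= 1 -> derivable g (x + t *: v) v) ->
  exists2 t : R, 0 <= t <= 1 & g (x + v) - g x = 'D_v g (x + t *: v).
Proof.
move=> dg; pose h (s : R) : R := g (x + s *: v).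
have dh (t : R) : 0 <= t <= 1 -> is_derive t 1 h ('D_v g (x + t *: v)).
  by move=> /dg /derivableP; exact: is_derive_line.
have [||t t01] := @MVT_segment R h (fun t => 'D_v g (x + t *: v)) 0 1 ler01.
- by move=> t /itvP t01; apply: dh; rewrite !t01.
- apply: derivable_within_continuous => t; rewrite in_itv => /dh ht.
  exact: ex_derive.
by rewrite /h scale1r scale0r addr0 subr0 mulr1 => ->; exists t.
Qed.

Lemma derivable_coord {R : realType} {V : normedModType R} {m : nat}
    (f : V -> 'rV[R]_m) x v i :
  derivable f x v -> derivable (fun y => f y 0 i) x v.
Proof. by move/derivable_mxP; exact. Qed.

Lemma derive_coord {R : realType} {V : normedModType R} {m : nat}
    (f : V -> 'rV[R]_m) x v i :
  derivable f x v -> 'D_v (fun y => f y 0 i) x = 'D_v f x 0 i.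
Proof. by move=> fx; rewrite (derive_mx fx) mxE. Qed.

Lemma continuous_near_dist {R : realType} {T : topologicalType}
    {V : normedModType R} (f : T -> V) (x : T) (e : R) :
  {for x, continuous f} -> 0 < e -> \forall z \near x, `|f z - f x| <= e.
Proof.
move=> /cvgrPdist_le cf e0; apply: filterS (cf e e0) => z.
by rewrite distrC.
Qed.

(** * Strict differentiability of C^1 maps *)

Section StrictDerivative.
Context {R : realType} {n m : nat}.
Implicit Types (f : 'rV[R]_n -> 'rV[R]_m) (U : set 'rV[R]_n).

(** A staircase from x (k = 0) to y (k = n): consecutive points differ in one coordinate, so only
    partial derivatives are met along it. *)
Let mix (x y : 'rV[R]_n) (k : nat) : 'rV[R]_n :=
  \row_i (if (i < k)%N then y 0 i else x 0 i).

(** Induction along the staircase; each step is the mean value theorem for the fixed component i of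
    f on a segment parallel to an axis, and costs one error e |y - x|. *)
Let partial_sum f U (x0 x y : 'rV[R]_n) (e r : R) :
  (forall z, `|z - x0| < r -> U z) ->
  (forall z, U z -> forall j : 'I_n, derivable f z (delta_mx 0 j)) ->
  (forall z, `|z - x0| < r -> forall j : 'I_n,
    `|'D_(delta_mx 0 j) f z - 'D_(delta_mx 0 j) f x0| <= e) ->
  `|x - x0| < r -> `|y - x0| < r -> forall i k, (k <= n)%N ->
  `|f (mix x y k) 0 i - f x 0 i -
     \sum_(j < n | (j < k)%N) (y - x) 0 j * 'D_(delta_mx 0 j) f x0 0 i|
  <= k%:R * (e * `|y - x|).
Proof.
move=> rU dU De xr yr i; elim=> [_|k IH kn].
  rewrite big_pred0 // subr0 mul0r.
  suff -> : mix x y 0 = x by rewrite subrr normr0.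
  by apply/rowP => j; rewrite mxE.
have {}IH := IH (ltnW kn); pose K := Ordinal kn.
pose h := (y - x) 0 K; pose v : 'rV[R]_n := h *: delta_mx 0 K.
have mixS : mix x y k.+1 = mix x y k + v.
  apply/rowP => j; rewrite !mxE /= ltnS leq_eqVlt -val_eqE /=.
  case: (eqVneq (j : nat) k) => [jk|jk]; last by rewrite mulr0 addr0.
  by rewrite jk ltnn mulr1 /h !mxE (_ : j = K) ?subrKC//; exact/val_inj.
(* Balls of the sup norm are boxes: each coordinate of a staircase point is a convex combination of
   those of x and y, so the staircase stays in the ball. *)
have near_mix (t : R) : 0 <= t <= 1 -> `|mix x y k + t *: v - x0| < r.
  move=> /andP[t0 t1].
  apply: (@le_lt_trans _ _ (Num.max `|x - x0| `|y - x0|)); last first.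
    by rewrite gt_max xr yr.
  apply: norm_row_le; first by rewrite le_max normr_ge0.
  move=> j; have := norm_coord_le (x - x0) j; have := norm_coord_le (y - x0) j.
  rewrite !mxE /= le_max => yj xj; apply/orP; rewrite -val_eqE /=.
  case: (ltnP j k) => jk.
    by right; rewrite (ltn_eqF jk) mulr0 mulr0 addr0.
  case: eqP => jk'; last by left; rewrite mulr0 mulr0 addr0.
  have -> : j = K by exact: val_inj.
  have {xj} : `|x 0 K - x0 0 K| <= `|x - x0| by rewrite -(_ : j = K)//; exact: val_inj.
  have {yj} : `|y 0 K - x0 0 K| <= `|y - x0| by rewrite -(_ : j = K)//; exact: val_inj.
  rewrite /h !mxE mulr1 => yj xj.
  have -> : x 0 K + t * (y 0 K - x 0 K) - x0 0 K =
    (1 - t) * (x 0 K - x0 0 K) + t * (y 0 K - x0 0 K) by ring.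
  apply/orP; rewrite -le_max (le_trans (ler_normD _ _))// !normrM.
  rewrite (ger0_norm t0) (ger0_norm (_ : 0 <= 1 - t)) ?subr_ge0//.
  set B := Num.max _ _.
  have xB : `|x 0 K - x0 0 K| <= B by rewrite le_max xj.
  have yB : `|y 0 K - x0 0 K| <= B by rewrite le_max yj orbT.
  have t1' : 0 <= 1 - t by rewrite subr_ge0.
  have := ler_wpM2l t0 yB; have := ler_wpM2l t1' xB; lra.
have [|t t01] := @mvt_line R _ (fun z => f z 0 i) (mix x y k) v.
  move=> t t01; apply: derivable_coord.
  have /rU/dU/(_ K)/derivableP/(is_derive_scale_dir h)[] := near_mix t t01; exact.
have zr := near_mix t t01.
have dz := dU _ (rU _ zr) K.
rewrite derive_coord; last by have /derivableP/(is_derive_scale_dir h)[] := dz.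
rewrite derive_scale_dir // -mixS !mxE => E.
have sumE (F : 'I_n -> R) : \sum_(j < n | (j < k.+1)%N) F j =
    F K + \sum_(j < n | (j < k)%N) F j.
  rewrite (bigD1 K)//=; congr (_ + _); apply: eq_bigl => j.
  by rewrite ltnS leq_eqVlt -val_eqE /=; case: (ltngtP j k).
rewrite sumE.
set S := \sum_(j < n | _) _ in IH *.
have -> : f (mix x y k.+1) 0 i - f x 0 i - ((y - x) 0 K * 'D_(delta_mx 0 K) f x0 0 i + S)
  = (f (mix x y k) 0 i - f x 0 i - S) +
    h * ('D_(delta_mx 0 K) f (mix x y k + t *: v) - 'D_(delta_mx 0 K) f x0) 0 i.
  rewrite [in X in _ = _ + h * X]mxE [in X in _ = _ + h * (_ + X)]mxE mulrBr -E.
  by rewrite /h; ring.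
rewrite (le_trans (ler_normD _ _))// -natr1 mulrDl lerD// mul1r normrM mulrC.
rewrite ler_pM ?normr_ge0//; last exact: norm_coord_le.
by rewrite (le_trans (norm_coord_le _ _))// De.
Qed.

(** [Ck_on] speaks of one direction at a time. The estimate here is joint in x and y with the
    derivative frozen at x0; differentiability, local expansion and local surjectivity are all read
    off from it. *)
Lemma C1_strict f U (x0 : 'rV[R]_n) : open U -> Ck_on 1 U f -> U x0 ->
  forall e, 0 < e -> \forall r \near 0^'+, forall x y,
    `|x - x0| < r -> `|y - x0| < r ->
    `|f y - f x - \sum_(j < n) (y - x) 0 j *: 'D_(delta_mx 0 j) f x0|
    <= e * `|y - x|.
Proof.
(* The n steps of the staircase add up n errors; the denominator n + 1 also covers n = 0. *)
move=> oU [_ fU] Ux0 e e0; pose e' := e / n.+1%:R.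
have e'0 : 0 < e' by rewrite divr_gt0 ?ltr0Sn.
have cD (j : 'I_n) : \forall z \near x0,
    `|'D_(delta_mx 0 j) f z - 'D_(delta_mx 0 j) f x0| <= e'.
  have [_ [cj _]] := fU (delta_mx 0 j).
  exact: (continuous_near_dist (cj x0 Ux0) e'0).
have : \forall z \near x0, U z /\ forall j : 'I_n,
    `|'D_(delta_mx 0 j) f z - 'D_(delta_mx 0 j) f x0| <= e'.
  near=> z; split; first by near: z; exact: open_nbhs_nbhs.
  by near: z; exact: filter_forall.
move=> /nbhs_ballP[r /= r0 rP]; near=> s.
have {}rP z : `|z - x0| < s -> U z /\ forall j : 'I_n,
    `|'D_(delta_mx 0 j) f z - 'D_(delta_mx 0 j) f x0| <= e'.
  move=> zs; apply: rP; rewrite -ball_normE /ball_/= distrC (lt_le_trans zs)//.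
  by near: s; exact: nbhs_right_le.
move=> x y xs ys; apply: norm_row_le; first by rewrite mulr_ge0// ltW.
move=> i.
have := @partial_sum f U x0 x y e' s (fun z h => (rP z h).1) _
  (fun z h => (rP z h).2) xs ys i n (leqnn n).
have -> : mix x y n = y by apply/rowP => j; rewrite mxE ltn_ord.
move=> /(_ (fun z Uz j => (fU (delta_mx 0 j)).1 z Uz)) h.
rewrite !mxE summxE; apply: (le_trans _ (le_trans h _)).
  rewrite le_eqVlt; apply/orP; left; apply/eqP; congr `|_ - _|.
  by apply: eq_big => [j|j _]; rewrite ?ltn_ord// !mxE.
rewrite mulrA ler_wpM2r// /e' mulrCA ler_piMr ?(ltW e0)//.
by rewrite ler_pdivrMr ?ltr0Sn// mul1r ler_nat.
Unshelve. all: by end_near. Qed.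

End StrictDerivative.

Lemma bounded_linear_continuous_of {R : realType} {V W : normedModType R}
    (f : {linear V -> W}) (B : R) :
  (forall v, `|f v| <= B * `|v|) -> continuous f.
Proof.
move=> fB v; apply/cvgrPdist_le => e e0.
have B0 : 0 < `|B| + 1 by rewrite ltr_wpDl.
have : \forall w \near v, `|v - w| <= e / (`|B| + 1).
  by apply: cvgr_dist_le; [exact: cvg_id|exact: divr_gt0].
apply: filterS => w; rewrite ler_pdivlMr// mulrC -linearB; apply: le_trans.
by rewrite (le_trans (fB _))// ler_wpM2r// (le_trans (ler_norm _))// lerDl.
Qed.

Lemma is_diff_near {R : realType} {V W : normedModType R} (f : V -> W)
    (df : {linear V -> W}) (x : V) : continuous df ->
  (forall e, 0 < e -> \forall v \near 0, `|f (v + x) - f x - df v| <= e * `|v|) ->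
  is_diff x f df.
Proof.
move=> cdf fe.
have fE : f \o shift x = cst (f x) + df +o_ 0 id.
  apply/eqaddoP => e e0; have := fe e e0; apply: filterS => v.
  by rewrite /= -addrA -opprD.
have dE := diff_unique cdf fE.
by split => //; apply/diff_locallyP; rewrite dE.
Qed.

Section C1Consequences.
Context {R : realType} {n m : nat}.
Variables (f : 'rV[R]_n -> 'rV[R]_m) (U : set 'rV[R]_n).
Hypotheses (oU : open U) (fU : Ck_on 1 U f).

Lemma C1_differentiable x : U x -> differentiable f x.
Proof.
move=> Ux; pose J := \matrix_(j < n) 'D_(delta_mx 0 j) f x.
have JE v : v *m J = \sum_(j < n) v 0 j *: 'D_(delta_mx 0 j) f x.
  by rewrite mulmx_sum_row; under eq_bigr do rewrite rowK.
have cJ : continuous (mulmxr J : 'rV[R]_n -> 'rV[R]_m).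
  apply: (@bounded_linear_continuous_of _ _ _ _
    (\sum_(j < n) `|'D_(delta_mx 0 j) f x|)) => v.
  rewrite /= JE (le_trans (ler_norm_sum _ _ _))// mulr_suml ler_sum// => j _.
  by rewrite normrZ mulrC ler_wpM2l// norm_coord_le.
suff : is_diff x f (mulmxr J) by [].
apply: is_diff_near => // e e0; have := C1_strict oU fU Ux e0.
case=> r /= r0 /(_ (r / 2)) h.
have r20 : 0 < r / 2 by rewrite divr_gt0.
have nv : \forall v \near (0 : 'rV[R]_n), `|v| < r / 2 by exact: nbhs0_lt.
apply: filterS nv => v vr.
have := h _ _ x (v + x); rewrite addrK -JE; apply.
- rewrite /ball_/= sub0r normrN gtr0_norm// ltr_pdivrMr// mulr_natr mulr2n.
  by rewrite ltrDl.
- by rewrite divr_gt0.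
- by rewrite subrr normr0 divr_gt0.
- by [].
Qed.

Lemma C1_deriveE x v : U x ->
  'D_v f x = \sum_(j < n) v 0 j *: 'D_(delta_mx 0 j) f x.
Proof.
move=> Ux; have df := C1_differentiable Ux.
rewrite deriveE// {1}(row_sum_delta v) linear_sum; apply: eq_bigr => j _.
by rewrite linearZ/= -deriveE.
Qed.

Lemma C1_deriveD x u v : U x -> 'D_(u + v) f x = 'D_u f x + 'D_v f x.
Proof.
by move=> Ux; have df := C1_differentiable Ux; rewrite !deriveE// linearD.
Qed.

Lemma C1_deriveZ x (c : R) v : U x -> 'D_(c *: v) f x = c *: 'D_v f x.
Proof.
by move=> Ux; have df := C1_differentiable Ux; rewrite !deriveE// linearZ.
Qed.

Lemma C1_derive_sum x (I : Type) (r : seq I) (F : I -> 'rV[R]_n) : U x ->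
  'D_(\sum_(i <- r) F i) f x = \sum_(i <- r) 'D_(F i) f x.
Proof.
move=> Ux; have df := C1_differentiable Ux; rewrite deriveE// linear_sum.
by apply: eq_bigr => i _; rewrite deriveE.
Qed.

Lemma C1_strict_derive x : U x ->
  forall e, 0 < e -> \forall r \near 0^'+, forall y z,
    `|y - x| < r -> `|z - x| < r -> `|f z - f y - 'D_(z - y) f x| <= e * `|z - y|.
Proof.
move=> Ux e e0; have := C1_strict oU fU Ux e0; apply: filterS => r h y z yr zr.
by rewrite C1_deriveE//; exact: h.
Qed.

Lemma C1_near_derive x : U x ->
  forall e, 0 < e -> \forall r \near 0^'+, forall y v,
    `|y - x| < r -> `|'D_v f y - 'D_v f x| <= e * `|v|.
Proof.
move=> Ux e e0; pose e' := e / n.+1%:R.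
have e'0 : 0 < e' by rewrite divr_gt0 ?ltr0Sn.
have cD (j : 'I_n) : \forall z \near x,
    `|'D_(delta_mx 0 j) f z - 'D_(delta_mx 0 j) f x| <= e'.
  have [_ /(_ (delta_mx 0 j))[_ [cj _]]] := fU.
  exact: (continuous_near_dist (cj x Ux) e'0).
have : \forall z \near x, U z /\ forall j : 'I_n,
    `|'D_(delta_mx 0 j) f z - 'D_(delta_mx 0 j) f x| <= e'.
  near=> z; split; first by near: z; exact: open_nbhs_nbhs.
  by near: z; exact: filter_forall.
move=> /nbhs_ballP[r /= r0 rP]; near=> s => y v ys.
have [|Uy yD] := rP y.
  rewrite -ball_normE /ball_/= distrC (lt_le_trans ys)//.
  by near: s; exact: nbhs_right_le.
rewrite !C1_deriveE// -sumrB (le_trans (ler_norm_sum _ _ _))//.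
apply: (@le_trans _ _ (\sum_(j < n) (`|v| * e'))).
  by apply: ler_sum => j _; rewrite -scalerBr normrZ ler_pM ?norm_coord_le.
rewrite sumr_const card_ord -[leLHS]mulr_natr mulrC (mulrC e) mulrCA ler_wpM2l//.
by rewrite /e' mulrCA ler_piMr ?(ltW e0)// ler_pdivrMr ?ltr0Sn// mul1r ler_nat.
Unshelve. all: by end_near. Qed.

End C1Consequences.

Lemma continuous_rowP {R : realType} {T : topologicalType} {m : nat}
    (f : T -> 'rV[R]_m) x :
  (forall i, {for x, continuous (fun y => f y 0 i)}) -> {for x, continuous f}.
Proof.
move=> fc; apply/cvgrPdist_le => e e0.
have : \forall y \near x, forall i, `|f x 0 i - f y 0 i| <= e.
  by apply: filter_forall => i; have /cvgrPdist_le/(_ _ e0) := fc i.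
apply: filterS => y fy; apply: norm_row_le (ltW e0) _ => i.
by rewrite !mxE.
Qed.

Lemma continuous_coord {R : realType} {T : topologicalType} {m : nat}
    (f : T -> 'rV[R]_m) x i :
  {for x, continuous f} -> {for x, continuous (fun y => f y 0 i)}.
Proof.
move=> fc; apply/cvgrPdist_le => e e0.
have /cvgrPdist_le/(_ _ e0) := fc; apply: filterS => y; apply: le_trans.
by have := norm_coord_le (f x - f y) i; rewrite !mxE.
Qed.

(** * Closure properties of C^k maps *)

Section CkCalculus.
Context {R : realType} {V : normedModType R}.
Variable U : set V.
Hypothesis oU : open U.

Lemma Ck_le {W : normedModType R} (f : V -> W) k : Ck_on k.+1 U f -> Ck_on k U f.
Proof.
elim: k f => [|k IH] f [cf df]; split => // v; split; first exact: (df v).1.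
exact/IH/(df v).2.
Qed.

Lemma Ck_ext {W : normedModType R} (f g : V -> W) k :
  (forall x, U x -> f x = g x) -> Ck_on k U f -> Ck_on k U g.
Proof.
have fg_near (h1 h2 : V -> W) x : U x -> (forall x, U x -> h1 x = h2 x) ->
    {near x, h1 =1 h2}.
  by move=> Ux h; apply: filterS h _; exact: open_nbhs_nbhs.
elim: k f g => [|k IH] f g fg [cf df].
  split=> // x Ux; rewrite /prop_for /continuous_at -fg//.
  apply: cvg_trans (cf x Ux); apply: near_eq_cvg.
  by apply: filterS (fg_near _ _ _ Ux fg) => y ->.
split=> [x Ux|v].
  rewrite /prop_for /continuous_at -fg//.
  apply: cvg_trans (cf x Ux); apply: near_eq_cvg.
  by apply: filterS (fg_near _ _ _ Ux fg) => y ->.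
split=> [x Ux|].
  by apply: near_eq_derivable ((df v).1 x Ux); exact: fg_near.
apply: IH (df v).2 => x Ux; apply: near_eq_derive; exact: fg_near.
Qed.

Lemma Ck_cst {W : normedModType R} (a : W) k : Ck_on k U (fun=> a).
Proof.
elim: k a => [|k IH] a; first by split=> // x _; exact: cvg_cst.
split=> [x _|v]; first exact: cvg_cst.
split=> [x _|]; first exact: derivable_cst.
by apply: Ck_ext (IH 0) => x _; rewrite derive_cst.
Qed.

Lemma Ck_add {W : normedModType R} (f g : V -> W) k :
  Ck_on k U f -> Ck_on k U g -> Ck_on k U (fun x => f x + g x).
Proof.
elim: k f g => [|k IH] f g [cf df] [cg dg].
  by split=> // x Ux; apply: cvgD; [exact: cf|exact: cg].
split=> [x Ux|v].
- by apply: cvgD; [exact: cf|exact: cg].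
- have [[df1 df2] [dg1 dg2]] := (df v, dg v).
  split=> [x Ux|]; first by apply: derivableD; [exact: df1|exact: dg1].
  apply: Ck_ext (IH _ _ df2 dg2) => x Ux.
  by rewrite -deriveD//; [exact: df1|exact: dg1].
Qed.

Lemma Ck_mul (f g : V -> R) k :
  Ck_on k U f -> Ck_on k U g -> Ck_on k U (fun x => f x * g x).
Proof.
elim: k f g => [|k IH] f g Cf Cg.
  have [[cf df] [cg dg]] := (Cf, Cg); split => // x Ux.
  by apply: cvgM; [exact: cf|exact: cg].
have [[cf df] [cg dg]] := (Cf, Cg); split => [x Ux|v].
  by apply: cvgM; [exact: cf|exact: cg].
have [[df1 df2] [dg1 dg2]] := (df v, dg v).
split=> [x Ux|]; first by apply: derivableM; [exact: df1|exact: dg1].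
apply: Ck_ext (Ck_add (IH _ _ (Ck_le Cf) dg2) (IH _ _ (Ck_le Cg) df2)) => x Ux.
by rewrite [RHS](deriveM (df1 _ Ux) (dg1 _ Ux)).
Qed.

Lemma Ck_sum {W : normedModType R} (I : Type) (r : seq I) (P : pred I)
    (F : I -> V -> W) k :
  (forall i, P i -> Ck_on k U (F i)) ->
  Ck_on k U (fun x => \sum_(i <- r | P i) F i x).
Proof.
move=> CF; elim: r => [|i r IH].
  by apply: Ck_ext (Ck_cst 0 k) => x _; rewrite big_nil.
case/boolP: (P i) => Pi.
  by apply: Ck_ext (Ck_add (CF i Pi) IH) => x _; rewrite big_cons Pi.
by apply: Ck_ext IH => x _; rewrite big_cons (negbTE Pi).
Qed.

Lemma Ck_coord {m : nat} (f : V -> 'rV[R]_m) k i :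
  Ck_on k U f -> Ck_on k U (fun x => f x 0 i).
Proof.
elim: k f => [|k IH] f [cf df].
  by split=> // x Ux; exact: continuous_coord (cf x Ux).
split=> [x Ux|v].
- exact: continuous_coord (cf x Ux).
- split=> [x Ux|]; first exact: derivable_coord ((df v).1 x Ux).
  apply: Ck_ext (IH _ (df v).2) => x Ux.
  by rewrite derive_coord//; exact: (df v).1.
Qed.

Lemma Ck_row {m : nat} (f : V -> 'rV[R]_m) k :
  (forall i, Ck_on k U (fun x => f x 0 i)) -> Ck_on k U f.
Proof.
elim: k f => [|k IH] f Cf.
  by split=> // x Ux; apply: continuous_rowP => i; have [cf _] := Cf i; exact: cf.
split=> [x Ux|v].
- by apply: continuous_rowP => i; have [cf _] := Cf i; exact: cf.
- have df x : U x -> derivable f x v.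
    move=> Ux; apply/derivable_mxP => i j; rewrite ord1.
    by have [_ /(_ v)[dfj _]] := Cf j; exact: dfj.
  split; first exact: df.
  apply: IH => i; have [_ /(_ v)[_ Ci]] := Cf i.
  by apply: Ck_ext Ci => x Ux; rewrite derive_coord//; exact: df.
Qed.

Lemma Ck_scale {m : nat} (a : V -> R) (f : V -> 'rV[R]_m) k :
  Ck_on k U a -> Ck_on k U f -> Ck_on k U (fun x => a x *: f x).
Proof.
move=> Ca Cf; apply: Ck_row => i.
by apply: Ck_ext (Ck_mul Ca (Ck_coord i Cf)) => x _; rewrite !mxE.
Qed.

Lemma Ck_dotp {m : nat} (f g : V -> 'rV[R]_m) k :
  Ck_on k U f -> Ck_on k U g -> Ck_on k U (fun x => dotp (f x) (g x)).
Proof. by move=> Cf Cg; apply: Ck_sum => i _; apply: Ck_mul; exact: Ck_coord. Qed.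

End CkCalculus.

Lemma Ck_subset {R : realType} {V W : normedModType R} (U U' : set V)
    (f : V -> W) k : U' `<=` U -> Ck_on k U f -> Ck_on k U' f.
Proof.
move=> sU; elim: k f => [|k IH] f [cf df]; first by split=> // x /sU; exact: cf.
split=> [x /sU|v].
- exact: cf.
- split=> [x /sU|]; first exact: (df v).1.
  exact: IH (df v).2.
Qed.

Lemma is_derive_comp_real {R : realType} {V : normedModType R} (phi : R -> R)
    (f : V -> R) (x v : V) (a b : R) :
  is_derive (f x) 1 phi a -> is_derive x v f b ->
  is_derive x v (phi \o f) (a * b).
Proof.
move=> dphi df.
have dl : is_derive (0 : R) 1 (fun s : R => f (x + s *: v)) b.
  by apply: is_derive_line; rewrite scale0r addr0.
have dphi' : is_derive (f (x + (0 : R) *: v)) 1 phi a by rewrite scale0r addr0.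
have := is_derive1_comp dphi' dl.
by move/(@line_is_derive _ _ _ (phi \o f)); rewrite scale0r addr0.
Qed.

Lemma is_derive_rsqrt {R : realType} (t : R) : 0 < t ->
  is_derive t 1 (fun s => (Num.sqrt s)^-1) (- 2^-1 * (Num.sqrt t)^-1 ^+ 3).
Proof.
move=> t0; have s0 : Num.sqrt t != 0 by rewrite gt_eqF ?sqrtr_gt0.
have ds := is_derive1_sqrt t0; have [sd sE] := ds.
apply: DeriveDef; first exact: derivableV.
by rewrite deriveV//= sE -[LHS]/(_ * _); field.
Qed.

(** The derivative of h = f^(-1/2) is -1/2 h^3 times that of f, a product involving h itself, so the
    induction on k closes. *)
Lemma Ck_rsqrt {R : realType} {V : normedModType R} (U : set V) (f : V -> R) k :
  open U -> (forall x, U x -> 0 < f x) -> Ck_on k U f ->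
  Ck_on k U (fun x => (Num.sqrt (f x))^-1).
Proof.
move=> oU f0; pose h x := (Num.sqrt (f x))^-1.
have ch x : U x -> {for x, continuous f} -> {for x, continuous h}.
  move=> Ux cf; apply: cvgV; first by rewrite gt_eqF ?sqrtr_gt0 ?f0.
  by apply: continuous_comp => //; exact: sqrt_continuous.
elim: k => [|k IH] Cf; first by split=> // x Ux; apply: ch => //; exact: Cf.1.
have [cf df] := Cf; split=> [x Ux|v]; first by apply: ch => //; exact: cf.
have dh x : U x -> is_derive x v h (- 2^-1 * h x ^+ 3 * 'D_v f x).
  move=> Ux; have dfx := derivableP ((df v).1 x Ux).
  exact: (is_derive_comp_real (is_derive_rsqrt (f0 x Ux)) dfx).
split=> [x Ux|]; first by have [] := dh x Ux.
have Ch := IH (Ck_le Cf).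
have Ch3 := Ck_mul oU Ch (Ck_mul oU Ch Ch).
have := Ck_mul oU (Ck_mul oU (Ck_cst oU (- 2^-1 : R) k) Ch3) (df v).2.
apply: Ck_ext => // x Ux; have [_ ->] := dh x Ux.
by rewrite !exprS expr0 mulr1.
Qed.

Lemma is_derive_dotp {R : realType} {V : normedModType R} {m : nat}
    (f g : V -> 'rV[R]_m) (x v : V) (df dg : 'rV[R]_m) :
  is_derive x v f df -> is_derive x v g dg ->
  is_derive x v (fun y => dotp (f y) (g y)) (dotp df (g x) + dotp (f x) dg).
Proof.
move=> [fd <-] [gd <-].
have -> : (fun y => dotp (f y) (g y)) =
    \sum_(i < m) ((fun y => f y 0 i) * (fun y => g y 0 i)).
  by apply/funext => y; rewrite fct_sumE.
have -> : dotp ('D_v f x) (g x) + dotp (f x) ('D_v g x) =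
    \sum_(i < m) (f x 0 i *: ('D_v g x 0 i : R^o) + g x 0 i *: ('D_v f x 0 i : R^o)).
  rewrite -big_split; apply: eq_bigr => i _ /=.
  by rewrite addrC ['D_v f x 0 i * _]mulrC.
apply: is_derive_sum => i; apply: is_deriveM.
  by apply: DeriveDef; [exact: derivable_coord|exact: derive_coord].
by apply: DeriveDef; [exact: derivable_coord|exact: derive_coord].
Qed.

Lemma derive_dotp {R : realType} {V : normedModType R} {m : nat}
    (f g : V -> 'rV[R]_m) (x v : V) :
  derivable f x v -> derivable g x v ->
  'D_v (fun y => dotp (f y) (g y)) x = dotp ('D_v f x) (g x) + dotp (f x) ('D_v g x).
Proof.
by move=> /derivableP df /derivableP dg; have [_] := is_derive_dotp df dg.
Qed.

Lemma is_derive_curve {R : realType} {V W : normedModType R} (f : V -> W)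
    (g : R -> V) (t : R) (w : V) :
  differentiable f (g t) -> is_derive t 1 g w ->
  is_derive t 1 (f \o g) ('D_w f (g t)).
Proof.
move=> df [/derivable1_diffP dg gE]; have dfg := differentiable_comp dg df.
apply: DeriveDef; first exact/derivable1_diffP.
by rewrite !deriveE// diff_comp//= -gE deriveE.
Qed.

(** If d2 were positive, dh would be positive just to the right of 0, and the mean value theorem
    would give h t > h 0 there. Only derivability of dh at 0 is required for this. *)
Lemma local_max_derive {R : realType} (h dh : R -> R) (d2 : R) :
  (\forall t \near (0 : R), h t <= h 0) ->
  (\forall t \near (0 : R), is_derive (t : R) 1 h (dh t)) ->
  is_derive (0 : R) 1 dh d2 -> dh 0 = 0 /\ d2 <= 0.
Proof.
move=> hmax hd d2P.
have [r /= r0 hr] : nbhs (0 : R) (fun t : R => h t <= h 0 /\ is_derive t 1 h (dh t)).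
  by near=> t; split; near: t.
have ball0 (t : R) : `|t| < r -> h t <= h 0 /\ is_derive t 1 h (dh t).
  by move=> tr; apply: hr; rewrite /ball_/= sub0r normrN.
have dh0 : dh 0 = 0.
  have [||||_ h0] := @derive1_at_max R h (- r) r 0.
  - lra.
  - move=> t /itvP tr; have [|_] := ball0 t; last by case.
    by rewrite ltr_norml !tr.
  - by rewrite in_itv/=; apply/andP; split; lra.
  - by move=> t /itvP tr; have [|] := ball0 t; rewrite ?ltr_norml ?tr.
  - by have [|_ [_ <-]] := ball0 0; rewrite ?normr0.
split=> //; rewrite leNgt; apply/negP => d2gt.
have [/cvg_ex[l d2l] d2E] := d2P.
have {}d2l : h^-1 *: (dh (h *: 1 + 0) - dh 0) @[h --> 0^'] --> d2.
  by rewrite -d2E /derive; move/(cvgP l) : d2l.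
have /cvgrPdist_lt/(_ _ d2gt)[s /= s0 hs] := d2l.
pose t := Num.min r s / 2.
have t0 : 0 < t by rewrite divr_gt0// lt_min r0.
have mr : Num.min r s <= r by rewrite ge_min lexx.
have ms : Num.min r s <= s by rewrite ge_min lexx orbT.
have tmin : t < Num.min r s by rewrite /t ltr_pdivrMr// mulr_natr mulr2n ltrDl lt_min r0.
have [c c0t hE] : exists2 c, c \in `]0, t[ & h t - h 0 = dh c * (t - 0).
  apply: MVT => // [c /itvP c0t|].
    have [|//] := ball0 c; rewrite gtr0_norm ?c0t//.
    by rewrite (lt_trans _ (lt_le_trans tmin mr))// c0t.
  apply: derivable_within_continuous => c; rewrite in_itv => /andP[c0 ct].
  have [|_ [//]] := ball0 c.
  by rewrite ger0_norm// (le_lt_trans ct)// (lt_le_trans tmin).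
have cgt : 0 < c by rewrite (itvP c0t).
have clt : c < t by rewrite (itvP c0t).
have := hs c; rewrite /ball_/= sub0r normrN gtr0_norm//.
move=> /(_ (lt_trans clt (lt_le_trans tmin ms)) (lt0r_neq0 cgt)).
rewrite dh0 subr0 addr0 [c *: 1]mulr1 => /(le_lt_trans (ler_norm _)).
rewrite ltrBlDl -ltrBlDr subrr [X in 0 < X]mulrC pmulr_lgt0 ?invr_gt0// => dc.
have [|ht _] := ball0 t; first by rewrite gtr0_norm// (lt_le_trans tmin).
move: hE; rewrite subr0 => hE.
have : 0 < dh c * t by rewrite mulr_gt0.
by rewrite -hE subr_gt0 ltNge ht.
Unshelve. all: by end_near. Qed.

Lemma local_max_second {R : realType} {V : normedModType R} (g : V -> R) (x v : V) :
  (\forall y \near x, g y <= g x) -> (\forall y \near x, derivable g y v) ->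
  derivable ('D_v g) x v -> 'D_v g x = 0 /\ 'D_v ('D_v g) x <= 0.
Proof.
move=> gmax gd d2.
have line (P : V -> Prop) : (\forall y \near x, P y) ->
    \forall t \near (0 : R), P (x + t *: v).
  move=> Px; have cl : (fun t : R => x + t *: v) t @[t --> (0 : R)] --> x.
    rewrite -[X in _ --> X]addr0 -(scale0r v); apply: cvgD; first exact: cvg_cst.
    by apply: cvgZr_tmp; exact: cvg_id.
  exact: cl.
have [] := @local_max_derive R (fun t => g (x + t *: v))
  (fun t => 'D_v g (x + t *: v)) ('D_v ('D_v g) x).
- by rewrite scale0r addr0; exact: (line (fun y => g y <= g x)).
- apply: filterS (line _ gd) => t /derivableP; exact: is_derive_line.
- by apply: (@is_derive_line _ _ _ ('D_v g)); rewrite scale0r addr0; exact: derivableP.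
- by rewrite scale0r addr0.
Qed.

(** * Curves and arc length *)

Lemma enorm_lipschitz {R : realType} {m : nat} (u v : 'rV[R]_m) :
  `|enorm u - enorm v| <= m%:R * `|u - v|.
Proof.
apply: le_trans (enorm_le_norm _).
rewrite ler_norml; apply/andP; split.
  by rewrite lerNl opprB lerBlDr enorm_sub; have := ler_enormD (v - u) u; rewrite subrK.
by rewrite lerBlDr; have := ler_enormD (u - v) v; rewrite subrK.
Qed.

Lemma continuous_enorm {R : realType} {m : nat} {T : topologicalType}
    (f : T -> 'rV[R]_m) x :
  {for x, continuous f} -> {for x, continuous (fun y => enorm (f y))}.
Proof.
move=> fc; apply/cvgrPdist_le => e e0.
have e'0 : 0 < e / m.+1%:R by rewrite divr_gt0 ?ltr0Sn.
have /cvgrPdist_le/(_ _ e'0) := fc; apply: filterS => y.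
rewrite ler_pdivlMr ?ltr0Sn// mulrC; apply: le_trans.
by rewrite (le_trans (enorm_lipschitz _ _))// ler_wpM2r// ler_nat.
Qed.

Lemma antiderivative {R : realType} (f : R -> R) : continuous f ->
  exists F : R -> R, forall t : R, 0 <= t <= 1 -> is_derive t 1 F (f t).
Proof.
move=> cf; exists (fun x => (\int[@lebesgue_measure R]_(t in `[-1, x]) f t)%R).
move=> t /andP[t0 t1].
have [||||dF dFE] := @continuous_FTC1_closed R f (-1) t 2.
- by rewrite (le_lt_trans t1)// ltr1n.
- apply: continuous_compact_integrable; first exact: segment_compact.
  exact: continuous_subspaceT.
- by rewrite (lt_le_trans _ t0)// ltrN10.
- exact: cf.
- by apply: DeriveDef; [exact: dF|rewrite -dFE derive1E].
Qed.

Lemma Rintegral_derive {R : realType} (F f : R -> R) :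
  (forall t : R, 0 <= t <= 1 -> is_derive t 1 F (f t)) ->
  (forall t : R, 0 <= t <= 1 -> {for t, continuous f}) ->
  (\int[@lebesgue_measure R]_(t in `[0%R, 1%R]) f t)%R = F 1 - F 0.
Proof.
move=> dF cf.
have cF (t : R) : 0 <= t <= 1 -> {for t, continuous F}.
  move=> /dF [/derivable1_diffP dFt _].
  exact: differentiable_continuous.
rewrite /Rintegral (@continuous_FTC2 _ f F 0 1)//.
- apply: continuous_in_subspaceT => t; rewrite inE/= in_itv/=; exact: cf.
- split.
  + by move=> t; rewrite in_itv => /= /andP[t0 t1]; have [] := dF t; rewrite ?ltW.
  + by apply: cvg_at_right_filter; apply: cF; rewrite lexx ler01.
  + by apply: cvg_at_left_filter; apply: cF; rewrite lexx ler01.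
- move=> t; rewrite in_itv => /= /andP[t0 t1]; rewrite derive1E.
  by have [] := dF t; rewrite ?ltW.
Qed.

(** One reparametrisation both cuts a piece out of a curve and, when b < a, reverses it. *)
Definition affine_path {R : realType} (a b s : R) : R := a + (b - a) * s.

Lemma affine_path_itv {R : realType} (a b s : R) :
  0 <= a <= 1 -> 0 <= b <= 1 -> 0 <= s <= 1 -> 0 <= affine_path a b s <= 1.
Proof.
rewrite /affine_path => /andP[? ?] /andP[? ?] /andP[? ?].
by apply/andP; split; nra.
Qed.

Lemma is_diff_affine_path {R : realType} (a b s : R) :
  is_diff s (affine_path a b) (fun v : R => (b - a) * v).
Proof.
have h : is_diff s ((cst a : R -> R) + ( *%R (b - a) : R -> R))
    (0 + ( *%R (b - a) : R -> R)).
  apply: is_diffD; exact: is_diff_scaler.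
have -> : (fun v : R => (b - a) * v) = 0 + ( *%R (b - a) : R -> R).
  by apply/funext => v /=; rewrite [RHS]add0r.
exact: h.
Qed.

Lemma is_derive_affine_path {R : realType} {V : normedModType R} (f : R -> V)
    (a b s v : R) : derivable f (affine_path a b s) 1 ->
  is_derive s v (f \o affine_path a b) ('D_((b - a) * v) f (affine_path a b s)).
Proof.
move=> /derivable1_diffP df; have da := is_diff_affine_path a b s.
have [da1 da2] := da.
have dfa : differentiable (f \o affine_path a b) s by exact: differentiable_comp.
apply: DeriveDef; first exact: diff_derivable.
by rewrite (deriveE _ dfa) (diff_comp da1 df) /= da2 (deriveE _ df).
Qed.

Lemma continuous_affine_path {R : realType} (a b : R) :
  continuous (affine_path a b : R -> R).
Proof.
by move=> s; have [d _] := is_diff_affine_path a b s; exact: differentiable_continuous.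
Qed.

Lemma near_nbhs_open {T : topologicalType} (U : set T) (x : T) :
  open U -> U x -> \forall y \near x, U y.
Proof. by move=> oU Ux; exact: open_nbhs_nbhs. Qed.

Lemma continuous_near_eq {T : topologicalType} {V : topologicalType}
    (f g : T -> V) (x : T) :
  (\forall y \near x, f y = g y) -> {for x, continuous f} -> {for x, continuous g}.
Proof.
move=> fg cf; rewrite /prop_for /continuous_at -(nbhs_singleton fg).
apply: cvg_trans cf; apply: near_eq_cvg.
by apply: filterS fg => y ->.
Qed.

Lemma continuous_sum_at {R : realType} {T : topologicalType} {V : normedModType R}
    (I : Type) (r : seq I) (F : I -> T -> V) (x : T) :
  (forall i, {for x, continuous (F i)}) ->
  {for x, continuous (fun y => \sum_(i <- r) F i y)}.
Proof.
move=> cF; elim: r => [|i r IH].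
  have -> : (fun y => \sum_(i <- [::]) F i y) = cst 0.
    by apply/funext => y; rewrite big_nil.
  exact: cvg_cst.
have -> : (fun y => \sum_(j <- i :: r) F j y) =
    (fun y => F i y + \sum_(j <- r) F j y).
  by apply/funext => y; rewrite big_cons.
by apply: cvgD; [exact: cF|exact: IH].
Qed.

Lemma continuous_scale_at {R : realType} {T : topologicalType} {V : normedModType R}
    (a : T -> R) (f : T -> V) (x : T) :
  {for x, continuous a} -> {for x, continuous f} ->
  {for x, continuous (fun y => a y *: f y)}.
Proof. by move=> ca cf; apply: cvgZ. Qed.

Section Curves.
Context {R : realType} {n : nat} {M : topologicalType}.
Variables (atlas : set (chart R n M)) (X : M -> 'rV[R]_n.+1).
Hypotheses (Mm : smooth_manifold atlas) (Xs : smooth_map atlas X).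

(** Near t the curve X o g factors through a chart; its derivative is a sum of coordinate speeds
    times partial derivatives of X, each continuous at t. *)
Lemma C1_curve_derive (g : R -> M) (t : R) : C1_curve atlas g -> 0 <= t <= 1 ->
  (\forall s \near t, derivable (X \o g) (s : R) 1) /\
  {for t, continuous (fun s : R => 'D_1 (X \o g) s)}.
Proof.
move=> Cg /Cg[cg [c [W [Ac gtc oW Wt CW]]]].
have ic := manifold_charts Mm Ac.
pose f := X \o cinv c; pose h := cmap c \o g.
have Cf : Ck_on 1 (ccod c) f by exact: Xs Ac 1%N.
have oC := chart_open_cod ic.
have cod s : cdom c (g s) -> ccod c (h s) by move=> gs; exists (g s).
have nD : \forall s \near t, cdom c (g s).
  have : \forall p \near g t, cdom c p by apply: near_nbhs_open (chart_open_dom ic) _.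
  exact: cg.
have nW : \forall s \near t, W s by exact: near_nbhs_open.
have nE : \forall s \near t, X (g s) = f (h s).
  by apply: filterS nD => s gs; rewrite /f /h /= (chart_mapK ic).
have dh s : W s -> is_derive s 1 h ('D_1 h s).
  by move=> Ws; apply: derivableP; have [_ /(_ 1)[dW _]] := CW; exact: dW.
have dXg : \forall s \near t, is_derive (s : R) 1 (X \o g) ('D_('D_1 h s) f (h s)).
  have := near_join nE; move=> nE'; near=> s.
  have Ws : W s by near: s.
  have Ds : cdom c (g s) by near: s.
  have Es : \forall s' \near s, X (g s') = f (h s') by near: s.
  have dfs : differentiable f (h s) by apply: (C1_differentiable oC Cf); exact: cod.
  have := is_derive_curve dfs (dh s Ws).
  apply: near_eq_is_derive; apply: filterS Es => s' /= ->; reflexivity.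
split; first by apply: filterS dXg => s [].
apply: (@continuous_near_eq _ _
  (fun s => \sum_(j < n) ('D_1 h s) 0 j *: 'D_(delta_mx 0 j) f (h s))).
  near=> s.
  have Ds : cdom c (g s) by near: s.
  have [_ ->] : is_derive s 1 (X \o g) ('D_('D_1 h s) f (h s)) by near: s.
  by rewrite (C1_deriveE oC Cf)//; exact: cod.
have ch : {for t, continuous h} by have [ch _] := CW; exact: ch.
apply: (@continuous_sum_at _ _ _ _ _ (fun (j : 'I_n) (s : R) =>
  ('D_1 h s) 0 j *: 'D_(delta_mx 0 j) f (h s))) => j.
apply: continuous_scale_at.
  have [_ /(_ 1)[_ [cdh _]]] := CW; exact: continuous_coord (cdh t Wt).
have [_ /(_ (delta_mx 0 j))[_ [cdf _]]] := Cf.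
apply: (@continuous_comp _ _ _ h ('D_(delta_mx 0 j) f)) => //.
by apply: cdf; exact: cod.
Unshelve. all: by end_near. Qed.

Lemma C1_curve_affine (g : R -> M) (a b : R) : C1_curve atlas g ->
  0 <= a <= 1 -> 0 <= b <= 1 -> C1_curve atlas (g \o affine_path a b).
Proof.
move=> Cg a01 b01 s s01; have [cg [c [W [Ac gtc oW Ws CW]]]] :=
  Cg _ (affine_path_itv a01 b01 s01).
split; first by apply: continuous_comp => //; exact: continuous_affine_path.
exists c, (affine_path a b @^-1` W); split; [exact: Ac|exact: gtc| |exact: Ws|].
  by apply: open_comp => // x _; exact: continuous_affine_path.
have [cW dW] := CW; split=> [x Wx|v].
  apply: (@continuous_comp _ _ _ (affine_path a b) (cmap c \o g)).
    exact: continuous_affine_path.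
  exact: cW.
have D x : W (affine_path a b x) -> is_derive x v ((cmap c \o g) \o affine_path a b)
    ('D_((b - a) * v) (cmap c \o g) (affine_path a b x)).
  by move=> Wx; apply: is_derive_affine_path; have [+ _] := dW 1; apply.
split=> [x Wx|]; first by have [] := D x Wx.
split=> // x Wx.
apply: (@continuous_near_eq _ _
  (fun x => 'D_((b - a) * v) (cmap c \o g) (affine_path a b x))).
  have : \forall y \near x, W (affine_path a b y).
    apply: near_nbhs_open => //.
    by apply: open_comp => // y _; exact: continuous_affine_path.
  by apply: filterS => y Wy; have [_ ->] := D y Wy.
apply: (@continuous_comp _ _ _ (affine_path a b) ('D_((b - a) * v) (cmap c \o g))).
  exact: continuous_affine_path.
by have [_ [+ _]] := dW ((b - a) * v); apply.
Qed.

End Curves.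

(** This expression is the projection of t to [0, 1]; the closed form makes continuity immediate. *)
Lemma clamp_continuous {R : realType} :
  continuous (fun t : R => (`|t| - `|t - 1| + 1) / 2).
Proof.
move=> t; apply: cvgM; last exact: cvg_cst.
apply: cvgD; last exact: cvg_cst.
apply: cvgB; apply: cvg_norm; first exact: cvg_id.
by apply: cvgB; [exact: cvg_id|exact: cvg_cst].
Qed.

Lemma clamp_itv {R : realType} (t : R) : 0 <= (`|t| - `|t - 1| + 1) / 2 <= 1.
Proof. by case: (ler0P t); case: (ler0P (t - 1)); move=> *; apply/andP; split; lra. Qed.

Lemma clamp_id {R : realType} (t : R) : 0 <= t <= 1 -> (`|t| - `|t - 1| + 1) / 2 = t.
Proof.
move=> /andP[t0 t1]; rewrite (ger0_norm t0) ler0_norm ?subr_le0//; lra.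
Qed.

Section ArcLength.
Context {R : realType} {n : nat} {M : topologicalType}.
Variables (atlas : set (chart R n M)) (X : M -> 'rV[R]_n.+1).
Hypotheses (Mm : smooth_manifold atlas) (Xs : smooth_map atlas X).

(** Phi is a primitive of the speed, fixed only up to a constant, so lengths and chords are compared
    with its differences. The absolute value in [arclength_length] accounts for pieces run
    backwards. *)
Record is_arclength (g : R -> M) (Phi : R -> R) : Prop := IsArclength {
  arclength_continuous : forall t : R, 0 <= t <= 1 -> {for t, continuous Phi};
  arclength_length : forall a b : R, 0 <= a <= 1 -> 0 <= b <= 1 ->
    curve_length X (g \o affine_path a b) = `|Phi b - Phi a|;
  arclength_enorm : forall a b : R, 0 <= a -> a <= b -> b <= 1 ->
    enorm (X (g b) - X (g a)) <= Phi b - Phi a;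
  arclength_derive : forall t : R, 0 <= t <= 1 ->
    is_derive t 1 Phi (enorm ('D_1 (X \o g) t)) }.

Lemma arclength_exists (g : R -> M) : C1_curve atlas g ->
  exists Phi, is_arclength g Phi.
Proof.
move=> Cg; pose sp (s : R) := enorm ('D_1 (X \o g) s).
(* The primitive is built for a function continuous on the whole line, whereas g is controlled on
   [0, 1] only; clamping extends the speed by its end values. *)
pose spc (s : R) := sp ((`|s| - `|s - 1| + 1) / 2).
have spcE (s : R) : 0 <= s <= 1 -> spc s = sp s by move=> s01; rewrite /spc clamp_id.
have dX (s : R) : 0 <= s <= 1 -> derivable (X \o g) s 1.
  by move=> s01; have [d _] := C1_curve_derive Mm Xs Cg s01; exact: nbhs_singleton d.
have csp : continuous spc.
  move=> s; apply: (@continuous_comp _ _ _ (fun t : R => (`|t| - `|t - 1| + 1) / 2) sp).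
    exact: clamp_continuous.
  have [_ c] := C1_curve_derive Mm Xs Cg (clamp_itv s).
  exact: continuous_enorm c.
have [Phi dPhi] := antiderivative csp.
have Phi_le (a b : R) : 0 <= a -> a <= b -> b <= 1 -> Phi a <= Phi b.
  move=> a0 ab b1; apply: (@ger0_derive1_ndecr _ Phi 0 1) => //.
  - by move=> t /itvP t01; have [|] := dPhi t; rewrite ?t01.
  - move=> t /itvP t01; have t01' : 0 <= t <= 1 by rewrite !t01.
    by rewrite derive1E; have [_ ->] := dPhi t t01'; exact: enorm_ge0.
  - apply: derivable_within_continuous => t; rewrite in_itv => t01.
    by have [] := dPhi t t01.
have mono (a b : R) : 0 <= a -> a <= b -> b <= 1 ->
    enorm (X (g b) - X (g a)) <= Phi b - Phi a.
  move=> a0 ab b1; set w := X (g b) - X (g a).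
  (* The chord is at most the arc: the component of X o g along the fixed chord w grows no faster
     than |w| times the speed, so psi decreases. *)
  pose psi (t : R) : R := dotp (X (g t)) w - enorm w * Phi t.
  have dpsi (t : R) : 0 <= t <= 1 ->
      is_derive t 1 psi (dotp ('D_1 (X \o g) t) w - enorm w * spc t).
    move=> t01; have dXt := derivableP (dX t t01).
    have := is_derive_dotp dXt (is_derive_cst w t 1).
    rewrite [dotp _ 0]dotpC dotp0l addr0 => d1.
    have d2 := @is_deriveZ _ _ _ Phi (enorm w) _ _ _ (dPhi t t01).
    exact: is_deriveB d1 d2.
  have : psi b <= psi a.
    apply: (@ler0_derive1_nincr _ psi 0 1) => //.
    - by move=> t /itvP t01; have [|] := dpsi t; rewrite ?t01.
    - move=> t /itvP t01; have t01' : 0 <= t <= 1 by rewrite !t01.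
      rewrite derive1E; have [_ ->] := dpsi t t01'.
      rewrite spcE// subr_le0 mulrC; exact: le_trans (ler_norm _) (dotp_le _ _).
    - apply: derivable_within_continuous => t; rewrite in_itv => t01.
      by have [] := dpsi t t01.
  rewrite /psi => h.
  have {}h : enorm w * enorm w <= enorm w * (Phi b - Phi a).
    rewrite -expr2 sqr_enorm {1}/w dotpBl; lra.
  have [w0|w0] := eqVneq (enorm w) 0; first by rewrite w0 subr_ge0 Phi_le.
  by move: h; rewrite ler_pM2l// lt_def w0 enorm_ge0.
exists Phi; split.
- by move=> t /dPhi[/derivable1_diffP d _]; exact: differentiable_continuous.
(* The sign sg treats both orientations at once: sg times Phi along the path is a primitive of its
   nonnegative speed. *)
- move=> a b a01 b01; pose sg : R := if a <= b then 1 else -1.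
  have sgE : `|b - a| = sg * (b - a).
    rewrite /sg; case: ifPn => [ab|]; first by rewrite ger0_norm ?subr_ge0// mul1r.
    by rewrite -ltNge => ba; rewrite ltr0_norm ?subr_lt0// mulN1r.
  pose F (s : R) : R := sg * Phi (affine_path a b s).
  have aff01 := affine_path_itv a01 b01.
  have dF (s : R) : 0 <= s <= 1 ->
      is_derive s 1 F (`|b - a| * spc (affine_path a b s)).
    move=> s01; have [d dE] := dPhi _ (aff01 s s01).
    have := is_derive_affine_path 1 d; rewrite mulr1.
    have -> : 'D_(b - a) Phi (affine_path a b s) = (b - a) * spc (affine_path a b s).
      rewrite -[b - a in LHS]mulr1 -[_ * 1]/((b - a) *: (1 : R^o)).
      by rewrite derive_scale_dir// dE.
    move=> /(@is_deriveZ _ _ _ (Phi \o affine_path a b) sg); rewrite sgE -mulrA; exact.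
  rewrite /curve_length.
  transitivity (\int[@lebesgue_measure R]_(s in `[0%R, 1%R])
      (`|b - a| * spc (affine_path a b s)))%R.
    apply: eq_Rintegral => s; rewrite inE/= in_itv/= => s01.
    have [_] := is_derive_affine_path 1 (dX _ (aff01 s s01)).
    rewrite derive1E => ->.
    by rewrite spcE ?aff01// /sp -enormZ -derive_scale_dir//; exact/dX/aff01.
  rewrite (Rintegral_derive dF).
    rewrite /F /affine_path !(mulr1, mulr0) addr0 subrKC -mulrBr /sg.
    have [/andP[a0 a1] /andP[b0 b1]] := (a01, b01).
    case: ifPn => [ab|]; first by rewrite mul1r ger0_norm// subr_ge0 Phi_le.
    by rewrite -ltNge => ba; rewrite mulN1r ler0_norm// subr_le0 Phi_le// ltW.
  move=> s s01; apply: cvgM; first exact: cvg_cst.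
  by apply: continuous_comp; [exact: continuous_affine_path|exact: csp].
- exact: mono.
- by move=> t t01; have := dPhi t t01; rewrite spcE.
Qed.
End ArcLength.

(** * Cutting, reversing and estimating along piecewise C^1 curves *)

Section Joined.
Context {R : realType} {n : nat} {M : topologicalType}.
Variables (atlas : set (chart R n M)) (X : M -> 'rV[R]_n.+1).
Hypotheses (Mm : smooth_manifold atlas) (Xs : smooth_map atlas X).

Lemma itv01_0 : 0 <= (0 : R) <= 1.
Proof. by rewrite lexx ler01. Qed.

Lemma itv01_1 : 0 <= (1 : R) <= 1.
Proof. by rewrite lexx ler01. Qed.

Lemma affine_path0 (a b : R) : affine_path a b 0 = a.
Proof. by rewrite /affine_path mulr0 addr0. Qed.

Lemma affine_path1 (a b : R) : affine_path a b 1 = b.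
Proof. by rewrite /affine_path mulr1 subrKC. Qed.

Lemma affine_path01 (g : R -> M) : g \o affine_path 0 1 = g.
Proof. by apply/funext => s /=; rewrite /affine_path subr0 mul1r add0r. Qed.

Lemma joined_piece g Phi (a b : R) : C1_curve atlas g -> is_arclength X g Phi ->
  0 <= a <= 1 -> 0 <= b <= 1 -> joined_by atlas X (g a) (g b) `|Phi b - Phi a|.
Proof.
move=> Cg gP a01 b01.
have := joined_cons (C1_curve_affine Cg a01 b01) (joined_nil atlas X _).
by rewrite /= affine_path0 affine_path1 addr0 (arclength_length gP).
Qed.

Lemma arclength_total g Phi : is_arclength X g Phi ->
  curve_length X g = Phi 1 - Phi 0.
Proof.
move=> gP; rewrite -[g in LHS]affine_path01 (arclength_length gP) ?lexx ?ler01//.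
rewrite ger0_norm//; apply: le_trans (arclength_enorm gP _ _ _) => //.
exact: enorm_ge0.
Qed.

Lemma arclength_le g Phi (a b : R) : is_arclength X g Phi ->
  0 <= a -> a <= b -> b <= 1 -> Phi a <= Phi b.
Proof.
move=> gP a0 ab b1; rewrite -subr_ge0.
by apply: le_trans (arclength_enorm gP a0 ab b1); exact: enorm_ge0.
Qed.

Lemma joined_trans p q r (l l' : R) :
  joined_by atlas X p q l -> joined_by atlas X q r l' ->
  joined_by atlas X p r (l + l').
Proof.
elim=> [q' J|g q' l1 Cg _ IH J]; first by rewrite add0r.
by rewrite -addrA; apply: joined_cons => //; exact: IH.
Qed.

Lemma joined_sym p q (l : R) : joined_by atlas X p q l -> joined_by atlas X q p l.
Proof.
elim=> [q'|g q' l1 Cg _ IH]; first exact: joined_nil.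
have [Phi gP] := arclength_exists Mm Xs Cg.
have := joined_piece Cg gP itv01_1 itv01_0.
rewrite distrC ger0_norm ?subr_ge0; last first.
  by apply: (arclength_le gP).
by rewrite -(arclength_total gP) addrC; exact: joined_trans.
Qed.

Lemma joined_enorm p q (l : R) : joined_by atlas X p q l -> enorm (X q - X p) <= l.
Proof.
elim=> [q'|g q' l1 Cg _ IH]; first by rewrite subrr enorm0.
have [Phi gP] := arclength_exists Mm Xs Cg.
rewrite (arclength_total gP) -(subrKA (X (g 1))) addrC.
by rewrite (le_trans (ler_enormD _ _))// lerD// (arclength_enorm gP).
Qed.

Lemma joined_ge0 p q (l : R) : joined_by atlas X p q l -> 0 <= l.
Proof. by move/joined_enorm; apply: le_trans; exact: enorm_ge0. Qed.

(** Whole pieces are skipped while they fit in the length s; inside the next piece the arc length is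
    continuous, so the intermediate value theorem gives the exact cutting point. *)
Lemma joined_split p q (l s : R) : joined_by atlas X p q l -> 0 <= s -> s <= l ->
  exists2 z, joined_by atlas X p z s & joined_by atlas X z q (l - s).
Proof.
move=> J; elim: J s => [q' s s0 sl|g q' l1 Cg J IH s s0 sl].
  have -> : s = 0 by apply/eqP; rewrite eq_le s0 sl.
  by exists q'; rewrite ?subr0; exact: joined_nil.
have [Phi gP] := arclength_exists Mm Xs Cg.
have gL := arclength_total gP; have J01 := joined_piece Cg gP.
have [sg|sg] := leP s (curve_length X g); last first.
  have [||z Jz1 Jz2] := IH (s - curve_length X g); try lra.
  exists z; last by rewrite (_ : _ - s = l1 - (s - curve_length X g))//; lra.
  rewrite -(subrKC (curve_length X g) s); apply: joined_trans Jz1.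
  have := J01 0 1 itv01_0 itv01_1.
  by rewrite ger0_norm ?gL// subr_ge0; apply: (arclength_le gP).
have [t t01 Phit] : exists2 t : R, t \in `[0, 1] & Phi t = Phi 0 + s.
  apply: IVT => //.
    apply: continuous_in_subspaceT => t; rewrite inE/= in_itv/=.
    exact: (arclength_continuous gP).
  have P01 : Phi 0 <= Phi 1 by apply: (arclength_le gP).
  by rewrite min_l// max_r//; apply/andP; split; lra.
have t01' : 0 <= t <= 1 by move: t01; rewrite in_itv.
exists (g t).
  have := J01 0 t; rewrite lexx ler01 => /(_ isT t01').
  by rewrite Phit addrC addKr ger0_norm.
have := J01 t 1 t01' itv01_1.
rewrite Phit ger0_norm; last by lra.
move=> /joined_trans/(_ J); rewrite (_ : _ + l1 = curve_length X g + l1 - s)//; lra.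
Qed.

(** S is the trace of the curve, together with a bound on the length spent to reach each of its
    points. It serves to trap short curves inside a chart. *)
Lemma joined_connected p q (l : R) : joined_by atlas X p q l ->
  exists S : set M, [/\ connected S, S p, S q &
    forall x, S x -> exists2 l', l' <= l & joined_by atlas X p x l'].
Proof.
elim=> [q'|g q' l1 Cg J [S [cS S1 Sq SJ]]].
  exists [set q']; split => // [|x ->]; first exact: connected1.
  by exists 0 => //; exact: joined_nil.
have [Phi gP] := arclength_exists Mm Xs Cg.
have gL := arclength_total gP; have J01 := joined_piece Cg gP.
have cg : connected (g @` `[(0 : R), 1]%classic).
  apply: connected_continuous_connected; first exact: segment_connected.
  apply: continuous_in_subspaceT => t; rewrite inE/= in_itv/= => t01.
  by have [] := Cg t t01.
have g0 : (g @` `[(0 : R), 1]%classic) (g 0) by exists 0; rewrite //= in_itv/= lexx ler01.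
have g1 : (g @` `[(0 : R), 1]%classic) (g 1) by exists 1; rewrite //= in_itv/= lexx ler01.
exists (g @` `[(0 : R), 1]%classic `|` S); split; [|by left|by right|].
  by apply: connectedU => //; exists (g 1).
move=> x [[t /=]|Sx].
  rewrite in_itv/= => t01 <-; have Jt := J01 0 t itv01_0 t01.
  exists `|Phi t - Phi 0| => //; have /andP[t0 t1] := t01.
  have Pt : Phi 0 <= Phi t by apply: (arclength_le gP).
  have Pt1 : Phi t <= Phi 1 by apply: (arclength_le gP).
  have l10 := joined_ge0 J.
  by rewrite ger0_norm ?gL; lra.
have [l' l'l Jx] := SJ x Sx; exists (curve_length X g + l'); first by rewrite lerD2l.
by apply: joined_cons.
Qed.

(** Local Lipschitz bounds add up along a curve: on each piece, the supremum of the parameters up to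
    which the estimate holds is reached by the local bound used backwards and passed by the local
    bound used forwards. *)
Lemma joined_lipschitz {m : nat} (h : M -> 'rV[R]_m) (K : R) (U : set M) p q (l : R) :
  0 <= K ->
  (forall x, U x -> \forall y \near x, forall d, joined_by atlas X x y d ->
     enorm (h y - h x) <= K * d) ->
  joined_by atlas X p q l ->
  (forall x l', l' <= l -> joined_by atlas X p x l' -> U x) ->
  enorm (h q - h p) <= K * l.
Proof.
move=> K0 hK J.
(* U is only known to contain points within a given length of the starting point; the induction
   therefore keeps a fixed origin p0 and the length d already spent. *)
suff H : forall p0 d, joined_by atlas X p0 p d ->
    (forall x l', l' <= d + l -> joined_by atlas X p0 x l' -> U x) ->
    enorm (h q - h p) <= K * l.
  by move=> UP; apply: (H p 0) => [|x l']; [exact: joined_nil|rewrite add0r; exact: UP].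
elim: J => [q' p0 d _ _|g q' l1 Cg J IH p0 d Jd UP]; first by rewrite subrr enorm0 mulr0.
have [Phi gP] := arclength_exists Mm Xs Cg.
have gL := arclength_total gP; have J01 := joined_piece Cg gP.
have Phi_le (a b : R) : 0 <= a -> a <= b -> b <= 1 -> Phi a <= Phi b.
  by move=> *; apply: (arclength_le gP).
have l10 := joined_ge0 J.
rewrite -(subrKA (h (g 1))) mulrDr addrC (le_trans (ler_enormD _ _))//.
rewrite lerD//; last first.
  apply: (IH p0 (d + curve_length X g)); last by rewrite -addrA.
  apply: joined_trans Jd _; have := J01 0 1 itv01_0 itv01_1.
  by rewrite ger0_norm ?gL// subr_ge0 Phi_le.
pose A := [set t : R | 0 <= t <= 1 /\
  forall s, 0 <= s <= t -> enorm (h (g s) - h (g 0)) <= K * (Phi s - Phi 0)].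
have A0 : A 0.
  split=> [|s]; first by rewrite lexx ler01.
  by rewrite -eq_le => /eqP <-; rewrite !subrr enorm0 mulr0.
have supA : has_sup A by split; [exists 0|exists 1 => t [/andP[]]].
pose T := sup A.
have T0 : 0 <= T by exact: sup_upper_bound.
have T1 : T <= 1 by apply: ge_sup => [|t [/andP[]]//]; exists 0.
have T01 : 0 <= T <= 1 by rewrite T0 T1.
have UT : U (g T).
  have JT := J01 0 T itv01_0 T01.
  apply: UP (joined_trans Jd JT).
  have ? := Phi_le 0 T; have ? := Phi_le T 1.
  rewrite ger0_norm ?subr_ge0 ?Phi_le// gL; have := Phi_le T 1 T0 T1 (lexx _); lra.
have [cgT _] := Cg T T01.
have [e /= e0 eP] : nbhs T (fun t : R => forall d, joined_by atlas X (g T) (g t) d ->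
    enorm (h (g t) - h (g T)) <= K * d) by exact: (cgT _ (hK _ UT)).
have near_T t : `|t - T| < e -> 0 <= t <= 1 ->
    enorm (h (g t) - h (g T)) <= K * `|Phi t - Phi T|.
  by move=> te t01; apply: eP; [rewrite /ball_/= distrC|exact: J01].
have hT : enorm (h (g T) - h (g 0)) <= K * (Phi T - Phi 0).
  have [t At] := sup_adherent e0 supA; rewrite -/T => tT.
  have [/andP[t0 t1] /(_ t)] := At; rewrite t0 lexx => /(_ isT) ht.
  have tT' : t <= T by exact: sup_upper_bound.
  have te : `|t - T| < e by rewrite distrC ger0_norm ?subr_ge0//; lra.
  have t01 : 0 <= t <= 1 by rewrite t0.
  have := near_T t te t01; rewrite enorm_sub distrC ger0_norm ?subr_ge0 ?Phi_le// => ht'.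
  rewrite -(subrKA (h (g t))) (le_trans (ler_enormD _ _))//.
  by rewrite (le_trans (lerD ht' ht))// -mulrDr ler_wpM2l//; lra.
have hA t : 0 <= t <= 1 -> t < T + e -> enorm (h (g t) - h (g 0)) <= K * (Phi t - Phi 0).
  move=> /andP[t0 t1] te; have [tT|Tt] := ltP t T.
    have tT0 : 0 < T - t by rewrite subr_gt0.
    have [t' [_ At']] := sup_adherent tT0 supA.
    rewrite -/T opprB addrCA subrr addr0 => tt'.
    by apply: At'; rewrite t0 ltW.
  have te' : `|t - T| < e by rewrite ger0_norm ?subr_ge0//; lra.
  have t01 : 0 <= t <= 1 by rewrite t0.
  have := near_T t te' t01; rewrite ger0_norm ?subr_ge0 ?Phi_le// => ht'.
  rewrite -(subrKA (h (g T))) (le_trans (ler_enormD _ _))//.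
  by rewrite (le_trans (lerD ht' hT))// -mulrDr ler_wpM2l//; lra.
suff T1' : T = 1 by rewrite gL; apply: hA; rewrite ?lexx ?ler01// T1' ltrDl.
apply/eqP; rewrite eq_le T1 leNgt; apply/negP => Tlt1.
pose t := Num.min 1 (T + e / 2).
have tT : T < t by rewrite lt_min Tlt1 ltrDl divr_gt0.
have t1 : t <= 1 by rewrite ge_min lexx.
have te : t < T + e.
  rewrite gt_min ltrD2l [X in _ || X](_ : _ = true) ?orbT//.
  by rewrite ltr_pdivrMr// mulr_natr mulr2n ltrDl.
suff : A t by move/(sup_upper_bound supA); rewrite leNgt tT.
split=> [|s /andP[s0 st]]; first by rewrite t1 (le_trans T0 (ltW tT)).
by apply: hA; [rewrite s0 (le_trans st)|exact: le_lt_trans te].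
Qed.

End Joined.

(** * The intrinsic distance and the Hopf-Rinow theorem *)

Lemma norm_mulmx_le {R : realType} {n m : nat} (u : 'rV[R]_n) (A : 'M[R]_(n, m)) :
  `|u *m A| <= (\sum_i \sum_j `|A i j|) * `|u|.
Proof.
apply: norm_row_le => [|j].
  by rewrite mulr_ge0// sumr_ge0// => i _; rewrite sumr_ge0.
rewrite mxE (le_trans (ler_norm_sum _ _ _))// mulr_suml ler_sum// => i _.
rewrite normrM mulrC ler_pM ?norm_coord_le//.
by rewrite (bigD1 j)//= lerDl sumr_ge0.
Qed.

Section LinearBounds.
Context {R : realType} {n m : nat}.

(** Injectivity gives a right inverse of A, and the sum of the absolute values of its entries bounds
    |u| by |u A|. *)
Lemma row_free_lower_bound (A : 'M[R]_(n, m)) :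
  (forall u : 'rV[R]_n, u *m A = 0 -> u = 0) ->
  exists2 c, 0 < c & forall u : 'rV[R]_n, c * `|u| <= `|u *m A|.
Proof.
move=> Ainj; have Afree : row_free A.
  rewrite -kermx_eq0; apply/eqP/row_matrixP => i; rewrite row0.
  by apply: Ainj; apply/sub_kermxP; exact: row_sub.
pose K := \sum_i \sum_j `|(pinvmx A) i j| + 1.
have K0 : 0 < K by rewrite ltr_wpDl// sumr_ge0// => i _; rewrite sumr_ge0.
exists K^-1 => [|u]; first by rewrite invr_gt0.
rewrite ler_pdivrMl//.
have uE : u = (u *m A) *m pinvmx A by rewrite -mulmxA mulmxVp// mulmx1.
by rewrite [in leLHS]uE (le_trans (norm_mulmx_le _ _))// ler_wpM2r// lerDl.
Qed.

Lemma C1_derive_mulmx (f : 'rV[R]_n -> 'rV[R]_m) U x v :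
  open U -> Ck_on 1 U f -> U x -> 'D_v f x = v *m jacobian f x.
Proof. by move=> oU fU Ux; apply/deriveEjacobian/(C1_differentiable oU fU). Qed.

Lemma C1_lower_bound (f : 'rV[R]_n -> 'rV[R]_m) U x :
  open U -> Ck_on 1 U f -> U x -> (forall v, 'D_v f x = 0 -> v = 0) ->
  exists2 c, 0 < c & forall v : 'rV[R]_n, c * `|v| <= `|'D_v f x|.
Proof.
move=> oU fU Ux finj; have [|c c0 cP] := @row_free_lower_bound (jacobian f x).
  by move=> u; rewrite -(C1_derive_mulmx _ oU fU Ux); exact: finj.
by exists c => // v; rewrite (C1_derive_mulmx _ oU fU Ux).
Qed.

End LinearBounds.

Lemma near0_right_ball {R : realType} {V : normedModType R} (x : V) (P : V -> Prop) :
  (\forall y \near x, P y) -> \forall r \near (0 : R)^'+, forall y, `|y - x| < r -> P y.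
Proof.
move=> /nbhs_ballP[r /= r0 rP]; near=> s => y ys; apply: rP.
rewrite -ball_normE /ball_/= distrC (lt_le_trans ys)//.
by near: s; exact: nbhs_right_le.
Unshelve. all: by end_near. Qed.

Lemma Ck_line {R : realType} {m : nat} (x v : 'rV[R]_m) (U : set R) :
  open U -> Ck_on 1 U (fun t : R => x + t *: v).
Proof.
move=> oU; have Cid : Ck_on 1 U (id : R -> R).
  split=> [t _|w]; first exact: cvg_id.
  split=> [t _|]; first exact: derivable_id.
  by apply: Ck_ext (Ck_cst oU (w : R) 0) => // t _; rewrite derive_id.
by apply: Ck_add (Ck_cst oU x 1) (Ck_scale oU Cid (Ck_cst oU v 1)).
Qed.

(** * Lengths of coordinate segments *)

Section MetricTopology.
Context {R : realType} {n : nat} {M : topologicalType}.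
Variables (atlas : set (chart R n M)) (X : M -> 'rV[R]_n.+1).
Hypotheses (Mm : smooth_manifold atlas) (Xi : immersion atlas X).

Let Xs : smooth_map atlas X := Xi.1.

Lemma chart_cod (c : chart R n M) p : cdom c p -> ccod c (cmap c p).
Proof. by move=> cp; exists p. Qed.

Lemma chart_invK (c : chart R n M) x : atlas c -> ccod c x ->
  cdom c (cinv c x) /\ cmap c (cinv c x) = x.
Proof.
move=> Ac [p cp <-]; have ic := manifold_charts Mm Ac.
by rewrite (chart_mapK ic).
Qed.

Lemma chart_near (c : chart R n M) p (P : M -> Prop) : atlas c -> cdom c p ->
  (\forall x \near cmap c p, P (cinv c x)) -> \forall q \near p, P q.
Proof.
move=> Ac cp Px; have ic := manifold_charts Mm Ac.
have Pq : \forall q \near p, P (cinv c (cmap c q)) := chart_map_cont ic cp Px.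
have oD : \forall q \near p, cdom c q by exact: near_nbhs_open (chart_open_dom ic) _.
by apply: filterS2 _ Pq oD => q /= + cq; rewrite (chart_mapK ic cq).
Qed.

Lemma chart_segment (c : chart R n M) (x y : 'rV[R]_n) (L : R) : atlas c ->
  (forall t : R, 0 <= t <= 1 -> ccod c (x + t *: (y - x))) ->
  (forall t : R, 0 <= t <= 1 ->
     enorm ('D_(y - x) (X \o cinv c) (x + t *: (y - x))) <= L) ->
  exists2 l, l <= L & joined_by atlas X (cinv c x) (cinv c y) l.
Proof.
move=> Ac cxy L_bound; have ic := manifold_charts Mm Ac.
have oC := chart_open_cod ic.
have Cf : Ck_on 1 (ccod c) (X \o cinv c) by exact: Xs.
pose z (t : R) := x + t *: (y - x); pose g := cinv c \o z.
have cz : continuous z.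
  move=> t; have [+ _] := Ck_line x (y - x) (@openT R); exact.
have oW : open (z @^-1` ccod c) by apply: open_comp => // t _; exact: cz.
have Cg : C1_curve atlas g.
  move=> t t01; split.
    by apply: continuous_comp; [exact: cz|apply: (chart_inv_cont ic); exact: cxy].
  have [cg gK] := chart_invK Ac (cxy t t01).
  exists c, (z @^-1` ccod c); split; [exact: Ac|exact: cg|exact: oW|exact: cxy|].
  apply: Ck_ext (Ck_line x (y - x) oW) => // s Ws.
  by rewrite /= (chart_invK Ac Ws).2.
have [Phi gP] := arclength_exists Mm Xs Cg.
have dX (t : R) : 0 <= t <= 1 -> 'D_1 (X \o g) t = 'D_(y - x) (X \o cinv c) (z t).
  move=> t01; have df := C1_differentiable oC Cf (cxy t t01).
  by have [_ ->] := is_derive_line (derivableP (diff_derivable (v := y - x) df)).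
exists (Phi 1 - Phi 0).
  have [|||t] := @MVT_segment R Phi (fun t => enorm ('D_1 (X \o g) t)) 0 1.
  - exact: ler01.
  - by move=> t /itvP t01; apply: (arclength_derive gP); rewrite !t01.
  - apply: continuous_in_subspaceT => t; rewrite inE/= in_itv/=.
    exact: (arclength_continuous gP).
  rewrite in_itv => t01 ->; rewrite subr0 mulr1 dX//; exact: L_bound.
have := joined_piece Cg gP (itv01_0 (R := R)) (itv01_1 (R := R)).
rewrite /g /= /z scale0r addr0 scale1r subrKC ger0_norm// subr_ge0.
by apply: (arclength_le gP).
Qed.

(** The joining curve is the straight segment in the chart; near x0 its speed differs little from
    the differential of X frozen at x0. *)
Lemma chart_joined (c : chart R n M) x0 (e : R) : atlas c -> ccod c x0 -> 0 < e ->
  \forall r \near (0 : R)^'+, forall x y, `|x - x0| < r -> `|y - x0| < r ->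
    [/\ ccod c x, ccod c y & exists2 l,
      l <= enorm ('D_(y - x) (X \o cinv c) x0) + e * `|y - x| &
      joined_by atlas X (cinv c x) (cinv c y) l].
Proof.
move=> Ac cx0 e0; have ic := manifold_charts Mm Ac.
have oC := chart_open_cod ic.
have Cf : Ck_on 1 (ccod c) (X \o cinv c) by exact: Xs.
(* The factor n + 1 is lost when the sup norm in R^{n+1} is turned into the Euclidean one. *)
have e'0 : 0 < e / n.+1%:R by rewrite divr_gt0 ?ltr0Sn.
have nC : \forall r \near (0 : R)^'+, forall y, `|y - x0| < r -> ccod c y.
  by apply: near0_right_ball; exact: near_nbhs_open.
near=> r.
have rC : forall y, `|y - x0| < r -> ccod c y by near: r.
have rD : forall y v, `|y - x0| < r ->
    `|'D_v (X \o cinv c) y - 'D_v (X \o cinv c) x0| <= e / n.+1%:R * `|v|.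
  by near: r; exact: (C1_near_derive oC Cf cx0 e'0).
move=> x y xr yr.
have seg (t : R) : 0 <= t <= 1 -> `|x + t *: (y - x) - x0| < r.
  move=> /andP[t0 t1].
  have -> : x + t *: (y - x) - x0 = (1 - t) *: (x - x0) + t *: (y - x0).
    by apply/rowP => i; rewrite !mxE; ring.
  rewrite (le_lt_trans (ler_normD _ _))// !normrZ (ger0_norm t0).
  rewrite (ger0_norm (_ : 0 <= 1 - t)) ?subr_ge0//.
  have [->|t0'] := eqVneq t 0; first by rewrite subr0 mul1r mul0r addr0.
  have tp : 0 < t by rewrite lt_def t0'.
  have t1' : 0 <= 1 - t by rewrite subr_ge0.
  have := ler_wpM2l t1' (ltW xr).
  by have : t * `|y - x0| < t * r; [rewrite ltr_pM2l|lra].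
split; [exact: rC|exact: rC|].
apply: chart_segment => // [t t01|t t01]; first exact/rC/seg.
have := rD _ (y - x) (seg t t01); set u := 'D_ _ _ _; set w := 'D_ _ _ _ => h.
rewrite -(subrK w u) addrC (le_trans (ler_enormD _ _))// lerD2l.
rewrite (le_trans (enorm_le_norm _))//.
rewrite (le_trans (ler_wpM2l _ h))// mulrA ler_wpM2r//.
by rewrite mulrC divfK ?pnatr_eq0.
Unshelve. all: by end_near. Qed.

End MetricTopology.

Lemma near_dist_lt {R : realType} {V : normedModType R} (x : V) (c : R) : 0 < c ->
  \forall y \near x, `|y - x| < c.
Proof.
move=> c0; apply/nbhs_ballP; exists c => //= y.
by rewrite -ball_normE /ball_/= distrC.
Qed.

Lemma half_in_ball {R : realType} (r : R) : 0 < r -> ball_ Num.norm 0 r (r / 2).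
Proof.
move=> r0; rewrite /ball_/= sub0r normrN gtr0_norm ?divr_gt0//.
by rewrite ltr_pdivrMr// mulr_natr mulr2n ltrDl.
Qed.

Lemma closed_dist_le {R : realType} {V : normedModType R} (x : V) (r : R) :
  closed [set y | `|y - x| <= r].
Proof.
have -> : [set y | `|y - x| <= r] = (fun y => `|y - x|) @^-1` [set t | t <= r] by [].
apply: closed_comp; last exact: closed_le.
by move=> y _; apply: cvg_norm; apply: cvgB; [exact: cvg_id|exact: cvg_cst].
Qed.

Lemma closed_ball_rV_compact {R : realType} {m : nat} (x : 'rV[R]_m) (r : R) :
  compact [set y | `|y - x| <= r].
Proof.
apply: bounded_closed_compact.
  exists (`|x| + r); split; first exact: num_real.
  move=> B rB y /= yr; rewrite -(subrK x y) (le_trans (ler_normD _ _))//.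
  by rewrite (le_trans _ (ltW rB))// addrC lerD2l.
exact: closed_dist_le.
Qed.

(** The inequality geodist < e unfolded into a single curve, which removes infima and extended reals
    from the metric arguments; [dltP] is the link. *)
Definition dlt {R : realType} {n : nat} {M : topologicalType}
    (atlas : set (chart R n M)) (X : M -> 'rV[R]_n.+1) (p q : M) (e : R) : Prop :=
  exists2 l, joined_by atlas X p q l & l < e.

Section Distance.
Context {R : realType} {n : nat} {M : topologicalType}.
Variables (atlas : set (chart R n M)) (X : M -> 'rV[R]_n.+1).
Hypotheses (Mm : smooth_manifold atlas) (Xi : immersion atlas X).

Let Xs : smooth_map atlas X := Xi.1.
Local Notation d := (dlt atlas X).

Lemma dltP p q (e : R) : (geodist atlas X p q < e%:E)%E <-> d p q e.
Proof.
split=> [/ereal_inf_lt[_ [l J <-]]|[l J le]]; first by rewrite lte_fin; exists l.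
apply: (@le_lt_trans _ _ l%:E); last by rewrite lte_fin.
by apply: ereal_inf_lbound; exists l.
Qed.

Lemma dlt_refl p (e : R) : 0 < e -> d p p e.
Proof. by exists 0 => //; exact: joined_nil. Qed.

Lemma dlt_sym p q (e : R) : d p q e -> d q p e.
Proof. by case=> l J le; exists l => //; exact: (joined_sym Mm Xs). Qed.

Lemma dlt_trans q p r (e e' : R) : d p q e -> d q r e' -> d p r (e + e').
Proof.
by move=> [l J le] [l' J' le']; exists (l + l'); [exact: joined_trans J J'|exact: ltrD].
Qed.

Lemma dlt_le p q (e e' : R) : e <= e' -> d p q e -> d p q e'.
Proof. by move=> ee' [l J le]; exists l => //; exact: lt_le_trans ee'. Qed.

Lemma dlt_enorm p q (e : R) : d p q e -> enorm (X q - X p) < e.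
Proof. by move=> [l J]; apply: le_lt_trans; exact: (joined_enorm Mm Xs). Qed.

Lemma dlt_split p q (e e' : R) : 0 < e -> 0 < e' -> d p q (e + e') ->
  exists2 z, d p z e & d z q e'.
Proof.
move=> e0 e'0 [l J le]; have {}le : l < e + e' := le; have l0 := joined_ge0 Mm Xs J.
have [l_e'|l_e'] := ltP l e'.
  by exists p; [exact: dlt_refl|exists l].
(* The cut t must satisfy l - e' < t < e and t <= l; it is taken midway between l - e' and the
   minimum of l and e. *)
pose u := Num.min l e; pose t := (l - e' + u) / 2.
have ul : u <= l by rewrite ge_min lexx.
have ue : u <= e by rewrite ge_min lexx orbT.
have lu : l - e' < u by rewrite lt_min; apply/andP; split; lra.
have t0 : 0 <= t by rewrite /t; lra.
have te : t < e by rewrite /t; lra.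
have tl : t <= l by rewrite /t; lra.
have t' : l - t < e' by rewrite /t; lra.
have [z Jz Jz'] := joined_split Mm Xs J t0 tl.
by exists z; [exists t|exists (l - t)].
Qed.

Lemma near_dlt p (e : R) : 0 < e -> \forall q \near p, d p q e.
Proof.
move=> e0; have [c Ac cp] := manifold_cover Mm p.
have ic := manifold_charts Mm Ac; set x0 := cmap c p.
have cx0 : ccod c x0 := chart_cod cp.
have oC := chart_open_cod ic.
have Cf : Ck_on 1 (ccod c) (X \o cinv c) by exact: Xs.
apply: (chart_near Mm Ac cp).
pose K := \sum_i \sum_j `|jacobian (X \o cinv c) x0 i j|.
have K0 : 0 <= K by apply: sumr_ge0 => i _; exact: sumr_ge0.
pose B := n.+1%:R * K + 1.
have B0 : 0 < B by rewrite ltr_wpDl// mulr_ge0.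
have [r /= r0 /(_ (r / 2))rP] := chart_joined Mm Xi Ac cx0 ltr01.
have r2 : 0 < r / 2 by rewrite divr_gt0.
have {}rP := rP _ r2; have {}rP := rP (half_in_ball r0).
have s0 : 0 < Num.min (r / 2) (e / B) by rewrite lt_min r2 divr_gt0.
apply: filterS (near_dist_lt x0 s0) => x; rewrite lt_min => /andP[xr xe].
have [||_ _ [l lL J]] := rP x0 x => //; first by rewrite subrr normr0.
exists l; first by rewrite -(chart_mapK ic cp).
apply: le_lt_trans lL _; rewrite (C1_derive_mulmx _ oC Cf cx0).
apply: (@le_lt_trans _ _ (B * `|x - x0|)); last by rewrite mulrC -ltr_pdivlMr.
rewrite mulrDl lerD// -mulrA (le_trans (enorm_le_norm _))//.
by rewrite ler_wpM2l// norm_mulmx_le.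
Qed.

(** The injective differential is bounded below, and strict differentiability passes half of this
    bound on to differences of X. *)
Lemma chart_expand (c : chart R n M) x0 : atlas c -> ccod c x0 ->
  exists2 m, 0 < m & \forall r \near (0 : R)^'+, forall x y,
    `|x - x0| < r -> `|y - x0| < r ->
    m * `|y - x| <= enorm (X (cinv c y) - X (cinv c x)).
Proof.
move=> Ac cx0; have ic := manifold_charts Mm Ac.
have oC := chart_open_cod ic.
have Cf : Ck_on 1 (ccod c) (X \o cinv c) by exact: Xs.
have [m m0 mP] := C1_lower_bound oC Cf cx0 (fun v => Xi.2 c x0 v Ac cx0).
have m2 : 0 < m / 2 by rewrite divr_gt0.
exists (m / 2) => //; apply: filterS (C1_strict_derive oC Cf cx0 m2) => r rP x y xr yr.
have := rP x y xr yr; have := mP (y - x); set D := 'D_ _ _ _ => h1 h2.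
rewrite (le_trans _ (norm_le_enorm _))//.
have h3 : `|D| <= `|X (cinv c y) - X (cinv c x)| + `|X (cinv c y) - X (cinv c x) - D|.
  set w := X _ - _; have -> : `|w - D| = `|D - w| by rewrite distrC.
  by rewrite addrC; have := ler_normD (D - w) w; rewrite subrK.
move: h2; rewrite /= => h2; lra.
Qed.

(** A short curve cannot leave a coordinate ball: by [chart_expand], the points of its trace in the
    open ball A already lie in the closed ball B of half the radius, so this part of the trace is
    open and closed in it, hence all of it. *)
Lemma dlt_nbhs p (U : set M) : nbhs p U -> exists2 e, 0 < e & forall q, d p q e -> U q.
Proof.
move=> pU; have [c Ac cp] := manifold_cover Mm p.
have ic := manifold_charts Mm Ac; set x0 := cmap c p.
have cx0 : ccod c x0 := chart_cod cp.
have pE : cinv c x0 = p by rewrite /x0 (chart_mapK ic).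
have oC := chart_open_cod ic.
have [m m0 nm] := chart_expand Ac cx0.
have nC : \forall r \near (0 : R)^'+, forall y, `|y - x0| < r -> ccod c y.
  by apply: near0_right_ball; exact: near_nbhs_open.
have nU : \forall r \near (0 : R)^'+, forall y, `|y - x0| < r -> U (cinv c y).
  apply: near0_right_ball; have ci := chart_inv_cont ic cx0.
  by apply: ci; rewrite pE.
near (0 : R)^'+ => r.
have r0 : 0 < r by [].
have rC : forall y, `|y - x0| < r -> ccod c y by near: r.
have rU : forall y, `|y - x0| < r -> U (cinv c y) by near: r.
have rm : forall x y, `|x - x0| < r -> `|y - x0| < r ->
    m * `|y - x| <= enorm (X (cinv c y) - X (cinv c x)) by near: r.
have x0r : `|x0 - x0| < r by rewrite subrr normr0.
pose A := [set q | cdom c q /\ `|cmap c q - x0| < r].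
have oA : open A.
  rewrite openE => q [cq qr].
  have [c1 c2] := (near_nbhs_open (chart_open_dom ic) cq, chart_map_cont ic cq).
  have c3 : \forall y \near cmap c q, `|y - x0| < r.
    have r' : 0 < r - `|cmap c q - x0| by rewrite subr_gt0.
    apply: filterS (near_dist_lt (cmap c q) r') => y yq.
    by rewrite -(subrKA (cmap c q)) (le_lt_trans (ler_normD _ _))// -ltrBrDr.
  by apply: filterS2 _ c1 (c2 _ c3) => q' ? ?; split.
pose B := cinv c @` [set y | `|y - x0| <= r / 2].
have r2 : r / 2 < r by rewrite ltr_pdivrMr// mulr_natr mulr2n ltrDl.
have cB : closed B.
  apply: compact_closed; first exact: manifold_hausdorff Mm.
  apply: continuous_compact.
    apply: continuous_in_subspaceT => y; rewrite inE /= => yr.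
    by apply: (chart_inv_cont ic); apply: rC; exact: le_lt_trans r2.
  apply: closed_ball_rV_compact.
pose e := m * (r / 2).
have e0 : 0 < e by rewrite mulr_gt0// divr_gt0.
exists e => // q [l J le].
have [S [cS Sp Sq SJ]] := joined_connected Mm Xs J.
suff : A q by move=> [cq qr]; rewrite -(chart_mapK ic cq); exact: rU.
suff AS : S `&` A = S by move: Sq; rewrite -AS => -[].
apply: cS.
- by exists p; split=> //; split.
- by exists A.
- exists B => //; apply/seteqP; split=> x [Sx Ax]; split=> //.
    have [cx xr] := Ax; exists (cmap c x); last exact: chart_mapK.
    have [l' l'l Jx] := SJ x Sx.
    have := rm _ _ x0r xr; rewrite pE (chart_mapK ic cx) => h.
    have := joined_enorm Mm Xs Jx => h'.
    rewrite /= -(ler_pM2l m0); apply: le_trans h _.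
    by apply: le_trans h' _; apply: le_trans l'l (ltW le).
  have [y /= yr <-] := Ax; have yr' := le_lt_trans yr r2.
  by have [] := chart_invK Mm Ac (rC y yr'); split=> //; rewrite b.
Unshelve. all: by end_near. Qed.

End Distance.

(** * Compactness of closed geodesic balls *)

Section HopfRinow.
Context {R : realType} {n : nat} {M : topologicalType}.
Variables (atlas : set (chart R n M)) (X : M -> 'rV[R]_n.+1).
Hypotheses (Mm : smooth_manifold atlas) (Xi : immersion atlas X).
Hypothesis Mc : complete_metric atlas X.

Local Notation d := (dlt atlas X).

(** This is geodist <= r, written with strict inequalities because a shortest curve need not be at
    hand. *)
Definition closed_geoball (p : M) (r : R) : set M :=
  [set q | forall e, r < e -> d p q e].

Lemma closed_geoball_closed p r : closed (closed_geoball p r).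
Proof.
move=> x Kx e re; have e2 : 0 < (e - r) / 2 by rewrite divr_gt0// subr_gt0.
have [y [Ky dxy]] := Kx _ (near_dlt Mm Xi x e2).
have r' : r < (e + r) / 2 by lra.
have := dlt_trans (Ky _ r') (dlt_sym Mm Xi dxy); apply: dlt_le; lra.
Qed.

Lemma closed_geoball_le p r s : r <= s -> closed_geoball p r `<=` closed_geoball p s.
Proof. by move=> rs q Kq e se; apply: Kq; exact: le_lt_trans se. Qed.

Lemma dlt_closed_geoball p q r : d p q r -> closed_geoball p r q.
Proof. by move=> dr e re; apply: dlt_le dr; exact: ltW. Qed.

(* Ultrafilters replace finite nets in the proof of Hopf-Rinow. *)
Lemma ultra_center (K A : set M) (F : set_system M) (a b : R) :
  compact K -> @UltraFilter M F -> F A ->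
  (forall y, A y -> exists2 z, K z & d z y a) -> 0 < b ->
  exists2 z, K z & F [set y | d z y (a + b)].
Proof.
move=> cK UF FA AK b0.
have /choice[zeta zP] : forall y, exists z, A y -> K z /\ d z y a.
  move=> y; have [/AK[z Kz dz]|nA] := pselect (A y); first by exists z.
  by exists y.
have PG : ProperFilter (zeta @ F) :=
  @fmap_proper_filter _ _ zeta F (@ultra_proper _ F UF).
have GK : F (zeta @^-1` K) by apply: filterS _ FA => y /zP[].
have [z [Kz cz]] := cK (zeta @ F) PG GK; exists z => //.
have nz := near_dlt Mm Xi z b0.
suff Fz : F [set y | d z (zeta y) b].
  apply: filterS2 _ Fz FA => y dz /zP[_ dy].
  by rewrite addrC; exact: dlt_trans dz dy.
have [//|Fn] := in_ultra_setVsetC [set y | d z (zeta y) b] UF.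
have [w [nw dw]] := cz [set w | ~ d z w b] _ Fn nz.
by case: nw.
Qed.

Lemma dlt_split_closed p y r a : 0 <= r -> 0 < a -> d p y (r + a) ->
  exists2 z, closed_geoball p r z & d z y a.
Proof.
rewrite le_eqVlt => /predU1P[<- a0|r0 a0 dy].
  by rewrite add0r => dy; exists p => // e e0; exact: dlt_refl.
by have [z dz dzy] := dlt_split Mm Xi r0 a0 dy; exists z => //; exact: dlt_closed_geoball.
Qed.

(** Completeness enters here: smaller compact balls show that an ultrafilter on the ball contains
    balls of every radius, so their centres form a Cauchy sequence, and its limit is a limit of the
    ultrafilter. *)
Lemma closed_geoball_compact_lim p r : 0 < r ->
  (forall s, 0 <= s -> s < r -> compact (closed_geoball p s)) ->
  compact (closed_geoball p r).
Proof.
move=> r0 cs; rewrite compact_ultra => F UF FK.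
have center (e : R) : 0 < e -> exists z, F [set y | d z y e].
  (* A point of the ball of radius r is then within e / 2 of the ball of radius s < r, and
     [ultra_center] costs another e / 2. *)
  move=> e0; pose s := Num.max 0 (r - e / 4).
  have s0 : 0 <= s by rewrite le_max lexx.
  have sr : s < r by rewrite gt_max r0 /=; lra.
  have [||z _ Fz] := @ultra_center _ _ F (e / 2) (e / 2) (cs s s0 sr) UF FK.
  - move=> y Ky; apply: dlt_split_closed => //; first by rewrite divr_gt0.
    apply: Ky; have : r - e / 4 <= s by rewrite le_max lexx orbT.
    lra.
  - by rewrite divr_gt0.
  - by exists z; rewrite (splitr e).
have /choice[u uP] : forall i : nat, exists z, F [set y | d z y (i.+1%:R^-1)].
  by move=> i; apply: center.
have inv_lt (e : R) : 0 < e -> exists m, forall i, (m <= i)%N -> i.+1%:R^-1 < e.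
  move=> e0; have [m _ me] := near_infty_natSinv_lt (PosNum e0).
  by exists m => i mi; exact: me.
have [x ux] : exists x, forall e : R, 0 < e ->
    exists m, forall i, (m <= i)%N -> d (u i) x e.
  have [|x xP] := Mc (u := u).
    move=> e e0; have e2 : 0 < e / 2 by rewrite divr_gt0.
    have [m mP] := inv_lt _ e2; exists m => i j mi mj; apply/dltP.
    have [y [dy dy']] := filter_ex (filterI (uP i) (uP j)).
    have := dlt_trans dy (dlt_sym Mm Xi dy'); apply: dlt_le.
    by rewrite (splitr e) lerD// ltW// mP.
  by exists x => e /xP[m mP]; exists m => i /mP /dltP.
have Fx : F --> x.
  move=> U /(dlt_nbhs Mm Xi)[e e0 eU]; have e2 : 0 < e / 2 by rewrite divr_gt0.
  have [[m mP] [m' mP']] := (inv_lt _ e2, ux _ e2); pose i := maxn m m'.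
  apply: filterS (uP i) => y dy; apply: eU.
  have := dlt_trans (dlt_sym Mm Xi (mP' i (leq_maxr _ _))) dy; apply: dlt_le.
  by rewrite [leRHS](splitr e) lerD2l ltW// mP// leq_maxl.
exists x; split => //; apply: closed_geoball_closed => U Ux.
exact: filter_ex (filterI FK (Fx _ Ux)).
Qed.

Lemma compact_nbhs (p : M) : exists2 C, compact C & nbhs p C.
Proof.
have [c Ac cp] := manifold_cover Mm p; have ic := manifold_charts Mm Ac.
have nC : \forall r \near (0 : R)^'+, forall y, `|y - cmap c p| < r -> ccod c y.
  by apply: near0_right_ball; apply: near_nbhs_open (chart_cod cp); exact: chart_open_cod.
case: nC => r /= r0 /(_ (r / 2) (half_in_ball r0)).
have r2 : 0 < r / 2 by rewrite divr_gt0.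
have r4 : 0 < r / 2 / 2 by rewrite divr_gt0.
move=> /(_ r2) rC.
exists (cinv c @` [set y | `|y - cmap c p| <= r / 2 / 2]).
  apply: continuous_compact; last exact: closed_ball_rV_compact.
  apply: continuous_in_subspaceT => y; rewrite inE /= => yr.
  by apply: (chart_inv_cont ic); apply: rC; apply: le_lt_trans yr _; lra.
apply: (chart_near Mm Ac cp).
by apply: filterS (near_dist_lt (cmap c p) r4) => y yr; exists y => //=; exact: ltW.
Qed.

(** Local compactness is uniform on a compact ball: one radius works for all its points, and the
    ball can be enlarged by a fraction of it. *)
Lemma closed_geoball_compact_step p r : 0 <= r -> compact (closed_geoball p r) ->
  exists2 a, 0 < a & compact (closed_geoball p (r + a)).
Proof.
move=> r0 cK.
have : \forall a \near (0 : R)^'+, closed_geoball p r `<=`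
    [set x | exists2 C, compact C & forall y, d x y (3 * a) -> C y].
  apply: ((compact_near_coveringP _).1 cK _ _
    (fun a x => exists2 C, compact C & forall y, d x y (3 * a) -> C y)) => x _.
  have [C cC nC] := compact_nbhs x; have [e e0 eC] := dlt_nbhs Mm Xi nC.
  have e2 : 0 < e / 2 by rewrite divr_gt0.
  have n1 := near_dlt Mm Xi x e2.
  near=> y a; exists C => // z dz; apply: eC.
  have dxy : d x y (e / 2) by near: y.
  apply: dlt_le (dlt_trans dxy dz).
  have ae : (a : R) <= e / 6 by near: a; apply: nbhs_right_le; rewrite divr_gt0.
  by rewrite /=; lra.
case=> e /= e0 /(_ (e / 2) (half_in_ball e0)).
have e2 : 0 < e / 2 by rewrite divr_gt0.
move=> /(_ e2); set b := e / 2 in e2 *; move=> bP.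
exists b => //; rewrite compact_ultra => F UF FK.
(* A point of the ball of radius r + b is within 2 b of the smaller ball, since r + 2 b is strictly
   larger than r + b; [ultra_center] adds b, whence the 3 above. *)
have [y Ky||z Kz Fz] := @ultra_center _ _ F (2 * b) b cK UF FK => //.
- apply: dlt_split_closed => //; first by rewrite mulr_gt0.
  by apply: Ky; lra.
- have [C cC CP] := bP z Kz.
  have FC : F C.
    by apply: filterS Fz => y; rewrite (_ : 2 * b + b = 3 * b); [exact: CP|ring].
  move: cC; rewrite compact_ultra => /(_ F UF FC)[x [Cx Fx]].
  exists x; split => //; apply: closed_geoball_closed => U Ux.
  exact: filter_ex (filterI FK (Fx _ Ux)).
Unshelve. all: by end_near. Qed.

(** Continuous induction on the radius: the supremum of the good radii is good by the limit lemma
    and could then be exceeded by the step lemma. *)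
Lemma closed_geoball_compact p r : compact (closed_geoball p r).
Proof.
have sub s t : s <= t -> compact (closed_geoball p t) -> compact (closed_geoball p s).
  move=> st ct; apply: subclosed_compact ct _; first exact: closed_geoball_closed.
  exact: closed_geoball_le.
apply: contrapT => nr.
have K0 : compact (closed_geoball p 0).
  rewrite compact_ultra => F UF FK; exists p; split; first by move=> e; exact: dlt_refl.
  move=> U /(dlt_nbhs Mm Xi)[e e0 eU]; apply: filterS FK => y Ky.
  by apply: eU; exact: Ky.
pose T := [set s : R | 0 <= s /\ compact (closed_geoball p s)].
have T0 : T 0 by [].
have Tr s : T s -> s <= r.
  by move=> [s0 cs]; rewrite leNgt; apply/negP => rs; apply: nr; exact: sub (ltW rs) cs.
have supT : has_sup T by split; [exists 0|exists r].
have s0 : 0 <= sup T by exact: sup_upper_bound.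
have cS : compact (closed_geoball p (sup T)).
  move: s0; rewrite le_eqVlt => /predU1P[<-//|s0].
  apply: closed_geoball_compact_lim => // s s0' sT.
  have e0 : 0 < sup T - s by rewrite subr_gt0.
  have [t [t0 ct]] := sup_adherent e0 supT.
  by rewrite opprB addrCA subrr addr0 => st; exact: sub (ltW st) ct.
have [a a0 ca] := closed_geoball_compact_step s0 cS.
have : T (sup T + a) by split => //; rewrite addr_ge0// ltW.
by move/(sup_upper_bound supT); rewrite gerDl leNgt a0.
Qed.

Lemma far_points p r : ~ compact [set: M] -> exists q, ~ d p q r.
Proof.
move=> ncM; apply: contrapT => h; apply: ncM.
suff -> : [set: M] = closed_geoball p r by exact: closed_geoball_compact.
apply/esym/seteqP; split => // q _; apply: dlt_closed_geoball.
by apply: contrapT => nd; apply: h; exists q.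
Qed.

End HopfRinow.

(** * Orthonormal frames and the shape operator *)

Section Frames.
Context {R : realType} {n : nat} {M : topologicalType}.
Variables (atlas : set (chart R n M)) (X : M -> 'rV[R]_n.+1).
Hypotheses (Mm : smooth_manifold atlas) (Xi : immersion atlas X).
Variable c : chart R n M.
Hypothesis Ac : atlas c.

Local Notation f := (X \o cinv c).

Lemma chart_Ck k : Ck_on k (ccod c) f.
Proof. exact: Xi.1. Qed.

Lemma ccod_open : open (ccod c).
Proof. exact: chart_open_cod (manifold_charts Mm Ac). Qed.

Lemma dtanE x v : ccod c x ->
  dtan X c x v = \sum_(j < n) v 0 j *: 'D_(delta_mx 0 j) f x.
Proof. by move=> cx; rewrite /dtan (C1_deriveE ccod_open (chart_Ck 1) _ cx). Qed.

Lemma dtanZ x (a : R) v : ccod c x -> dtan X c x (a *: v) = a *: dtan X c x v.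
Proof. by move=> cx; rewrite /dtan (C1_deriveZ ccod_open (chart_Ck 1) _ _ cx). Qed.

Lemma dtanD x u v : ccod c x -> dtan X c x (u + v) = dtan X c x u + dtan X c x v.
Proof. by move=> cx; rewrite /dtan (C1_deriveD ccod_open (chart_Ck 1) _ _ cx). Qed.

Lemma dtanB x u v : ccod c x -> dtan X c x (u - v) = dtan X c x u - dtan X c x v.
Proof. by move=> cx; rewrite dtanD// -scaleN1r dtanZ// scaleN1r. Qed.

Lemma dtan_sum x (I : Type) (r : seq I) (P : pred I) (F : I -> 'rV[R]_n) : ccod c x ->
  dtan X c x (\sum_(i <- r | P i) F i) = \sum_(i <- r | P i) dtan X c x (F i).
Proof.
move=> cx; elim/big_rec2: _ => [|i u v _ <-]; last exact: dtanD.
by rewrite -(scale0r 0) dtanZ// scale0r.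
Qed.

Lemma dtan_Ck (W : set 'rV[R]_n) (E : 'rV[R]_n -> 'rV[R]_n) k :
  open W -> W `<=` ccod c -> Ck_on k W E -> Ck_on k W (fun y => dtan X c y (E y)).
Proof.
move=> oW Wc CE.
apply: (@Ck_ext _ _ _ oW _ (fun y => \sum_(j < n) E y 0 j *: 'D_(delta_mx 0 j) f y)).
  by move=> y Wy; rewrite dtanE//; exact: Wc.
apply: Ck_sum => // j _; apply: Ck_scale => //; first exact: Ck_coord.
apply: Ck_subset Wc _; have [_ /(_ (delta_mx 0 j))[]] := chart_Ck k.+1; by [].
Qed.

(** The fields are indexed by [nat], so that adding one to the family does not change its type. *)
Let orthonormal_upto x0 j := exists (E : nat -> 'rV[R]_n -> 'rV[R]_n) (W : set 'rV[R]_n),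
  [/\ open W, W x0, W `<=` ccod c, forall i, (i < j)%N -> smooth_on W (E i) &
   forall y i i', W y -> (i < j)%N -> (i' < j)%N ->
     dotp (dtan X c y (E i y)) (dtan X c y (E i' y)) = (i == i')%:R].

Lemma open_positive {V : normedModType R} (W : set V) (g : V -> R) : open W ->
  (forall x, W x -> {for x, continuous g}) -> open (W `&` [set x | 0 < g x]).
Proof.
move=> oW cg; rewrite openE => x [Wx gx].
have n1 := near_nbhs_open oW Wx.
have n2 : \forall y \near x, 0 < g y := cg x Wx _ (lt_nbhsr gx).
by apply: filterS2 _ n1 n2 => y ? ?; split.
Qed.

(* Gram-Schmidt, started from a constant vector independent of the vectors
   already built. *)
Let orthonormal_step x0 j : ccod c x0 -> (j < n)%N ->
  orthonormal_upto x0 j -> orthonormal_upto x0 j.+1.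
Proof.
move=> cx0 jn [E [W [oW Wx0 Wc sE oE]]].
pose proj w y := \sum_(i < j) dotp (dtan X c y w) (dtan X c y (E i y)) *: E i y.
have [w wP] : exists w, w <> proj w x0.
  (* Otherwise every vector would be a combination of the j rows of B, and the identity would have
     rank at most j < n. *)
  apply/existsNP => h; pose B := \matrix_(i < j) E i x0.
  have : (1%:M <= B)%MS.
    apply/row_subP => i; rewrite [row i _](h _).
    rewrite /proj (_ : \sum_(_ < _) _ =
      (\row_(k < j) dotp (dtan X c x0 (row i 1%:M)) (dtan X c x0 (E k x0))) *m B).
      exact: submxMl.
    by rewrite mulmx_sum_row; apply: eq_bigr => k _; rewrite rowK mxE.
  move/mxrankS; rewrite mxrank1 => /leq_trans/(_ (rank_leq_row _)).
  by rewrite leqNgt jn.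
pose Y y := w - proj w y; pose G y := dotp (dtan X c y (Y y)) (dtan X c y (Y y)).
have CY k : Ck_on k W Y.
  have Cw := Ck_cst oW w k.
  apply: (@Ck_ext _ _ _ oW _ (fun y => w + (-1) *: proj w y)).
    by move=> y _; rewrite scaleN1r.
  apply: Ck_add => //; apply: Ck_scale => //; first exact: Ck_cst.
  apply: Ck_sum => // i _; apply: Ck_scale => //; last exact: sE.
  by apply: Ck_dotp => //; apply: dtan_Ck => //; exact: sE.
have CG k : Ck_on k W G by apply: Ck_dotp => //; exact: dtan_Ck.
have G0 : 0 < G x0.
  rewrite lt_def dotp_ge0 andbT; apply/eqP => /dotp_eq0 /(Xi.2 _ _ _ Ac cx0).
  by move/eqP; rewrite subr_eq0 => /eqP.
pose W' := W `&` [set y | 0 < G y].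
have oW' : open W' by apply: open_positive => //; have [] := CG 0%N.
have W'W : W' `<=` W by move=> y [].
pose Ej y := (Num.sqrt (G y))^-1 *: Y y.
have Yorth y i : W y -> (i < j)%N -> dotp (dtan X c y (Y y)) (dtan X c y (E i y)) = 0.
  move=> Wy ij; have cy := Wc _ Wy; rewrite /Y dtanB// dotpBl dtan_sum// dotp_suml.
  rewrite (bigD1 (Ordinal ij))//= dtanZ// dotpZl oE// eqxx mulr1 big1 ?addr0 ?subrr//.
  move=> i' i'i; rewrite dtanZ// dotpZl oE//.
  by rewrite (negbTE (_ : val i' != i)) ?mulr0//; move: i'i; rewrite -val_eqE.
exists (fun i => if i == j then Ej else E i), W'; split => //.
- by move=> y /W'W /Wc.
- move=> i; rewrite ltnS leq_eqVlt => /predU1P[->|ij] k.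
    rewrite eqxx; apply: Ck_scale => //; last exact: Ck_subset W'W (CY k).
    by apply: (Ck_rsqrt oW'); [move=> y []|exact: Ck_subset W'W (CG k)].
  by rewrite (ltn_eqF ij); exact: Ck_subset W'W (sE i ij k).
have ejj y : W' y -> dotp (dtan X c y (Ej y)) (dtan X c y (Ej y)) = 1.
  move=> [Wy Gy]; have cy := Wc _ Wy; rewrite dtanZ// dotpZl dotpZr -/(G y).
  rewrite -{3}(sqr_sqrtr (ltW Gy)) mulrA -expr2 -exprMn mulVf ?expr1n//.
  by rewrite gt_eqF ?sqrtr_gt0.
have eji y i : W' y -> (i < j)%N -> dotp (dtan X c y (Ej y)) (dtan X c y (E i y)) = 0.
  by move=> [Wy Gy] ij; have cy := Wc _ Wy; rewrite dtanZ// dotpZl Yorth// mulr0.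
move=> y i i' Wy; rewrite !ltnS => ij i'j.
have [ijE|ijN] := eqVneq i j; have [ijE'|ijN'] := eqVneq i' j.
- by rewrite ijE ijE' eqxx ejj.
- by rewrite eji// ?ijE ?[j == _]eq_sym ?(negbTE ijN')// ltn_neqAle ijN' i'j.
- by rewrite dotpC eji// ?ijE' ?(negbTE ijN)// ltn_neqAle ijN ij.
- by apply: oE; [exact: W'W|rewrite ltn_neqAle ijN|rewrite ltn_neqAle ijN'].
Qed.

Lemma frame_exists x0 : ccod c x0 -> exists E, local_orthonormal_frame X c x0 E.
Proof.
move=> cx0; have H j : (j <= n)%N -> orthonormal_upto x0 j.
  elim: j => [_|j IH jn]; last exact/orthonormal_step/IH/ltnW.
  by exists (fun _ _ => 0), (ccod c); split=> //; exact: ccod_open.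
have [E [W [oW Wx0 Wc sE oE]]] := H n (leqnn n).
exists (fun i => E i), W; split => // [i|y i j Wy]; first exact: sE.
by rewrite oE.
Qed.

End Frames.

Lemma eq_ler {R : realType} (a b c : R) : a = b -> b <= c -> a <= c.
Proof. by move->. Qed.

(** One frame direction of [max_mean_curvature]: z is the normal component of the gradient, k is 1 -
    2 eps, S is h_ii and B is |e_i|^2. *)
Lemma frame_term_le {R : realType} (z k A B S : R) :
  z * - A + k * B <= 0 -> S = - A -> B = 1 -> 1 * k + z * S <= 0.
Proof. by move=> h -> B1; move: h; rewrite B1 mulr1 mul1r addrC. Qed.

Lemma mulr_of_opp {R : realType} (a d s : R) : d = - s -> a * d = - (s * a).
Proof. by move=> ->; rewrite mulrN mulrC. Qed.

Lemma ler_sqrtM {R : realType} (a b S : R) : 0 <= a -> 0 <= b -> 0 <= S ->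
  a ^+ 2 <= S * b ^+ 2 -> a <= Num.sqrt S * b.
Proof.
move=> a0 b0 S0 h; rewrite -(@ler_pXn2r _ 2)// ?nnegrE ?mulr_ge0 ?sqrtr_ge0//.
by rewrite exprMn sqr_sqrtr.
Qed.

(** * The second fundamental form and the derivative of the normal *)

Section ShapeOperator.
Context {R : realType} {n : nat} {M : topologicalType}.
Variables (atlas : set (chart R n M)) (X N : M -> 'rV[R]_n.+1).
Hypotheses (Mm : smooth_manifold atlas) (Xi : immersion atlas X).
Hypothesis Nn : unit_normal atlas X N.
Variables (c : chart R n M) (x : 'rV[R]_n) (E : 'I_n -> 'rV[R]_n -> 'rV[R]_n).
Hypotheses (Ac : atlas c) (cx : ccod c x) (fE : local_orthonormal_frame X c x E).

Local Notation f := (X \o cinv c).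
Local Notation nu := (N \o cinv c).
Let oC : open (ccod c) := ccod_open Mm Ac.
Let Cf k : Ck_on k (ccod c) f := chart_Ck Xi Ac k.

Lemma normal_Ck k : Ck_on k (ccod c) nu.
Proof. by have [sN _ _] := Nn; exact: sN. Qed.

Let e i := dtan X c x (E i x).

Lemma frame_on i j : dotp (e i) (e j) = (i == j)%:R.
Proof. by have [W [_ Wx _ _ oE]] := fE; exact: oE. Qed.

Lemma frame_unit i : dotp (e i) (e i) = 1.
Proof. by have := frame_on i i; rewrite eqxx. Qed.

Lemma frame_normal v : dotp (dtan X c x v) (nu x) = 0.
Proof. by have [_ _ nE] := Nn; exact: nE. Qed.

Lemma normal_unit y : dotp (nu y) (nu y) = 1.
Proof. by have [_ uN _] := Nn; exact: uN. Qed.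

Lemma dtan_frame_sum (a : 'I_n -> R) :
  dtan X c x (\sum_i a i *: E i x) = \sum_i a i *: e i.
Proof.
by rewrite (dtan_sum Mm Xi Ac)//; apply: eq_bigr => i _; exact: (dtanZ Mm Xi Ac).
Qed.

(** The difference of the two sides has an image under dX that is tangent and orthogonal to the
    frame, hence zero, and dX is injective. *)
Lemma frame_decomp v : v = \sum_i dotp (dtan X c x v) (e i) *: E i x.
Proof.
apply/eqP; rewrite -subr_eq0; apply/eqP/(Xi.2 _ _ _ Ac cx).
rewrite (dtanB Mm Xi Ac)// dtan_frame_sum; set w := dtan X c x v.
have w_e i : dotp (w - \sum_j dotp w (e j) *: e j) (e i) = 0.
  by rewrite dotpBl (frame_sum_coord _ _ frame_on) subrr.
rewrite (orthogonal_frame frame_on (normal_unit x) (fun i => frame_normal _) w_e).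
rewrite dotpBl frame_normal (frame_sum_normal _ (fun i => frame_normal (E i x))).
by rewrite subrr scale0r.
Qed.

Lemma frame_sqr_sum v : enorm (dtan X c x v) ^+ 2 = \sum_i dotp (dtan X c x v) (e i) ^+ 2.
Proof.
exact: (parseval_tangent frame_on (normal_unit x) (fun i => frame_normal _)
  (frame_normal v)).
Qed.

Lemma derivable_normal v : derivable nu x v.
Proof. by have [_ /(_ v)[+ _]] := normal_Ck 1; exact. Qed.

(** Differentiate <e_j, N> = 0 in the direction e_i; the derivative of the frame field is thereby
    traded for that of N. *)
Lemma second_ffE i j :
  second_ff X N c x E i j = - dotp (e j) ('D_(E i x) nu x).
Proof.
have [W [oW Wx Wc sE _]] := fE.
have [_ /(_ (E i x))[de _]] := dtan_Ck Mm Xi Ac oW Wc (sE j 1%N).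
have := derive_dotp (de x Wx) (@derivable_normal (E i x)).
rewrite (@near_eq_derive _ _ _ _ (cst 0)) ?derive_cst.
  by move/esym/eqP; rewrite addr_eq0 => /eqP <-.
apply: filterS (near_nbhs_open oW Wx) => y /Wc cy.
by have [_ _ nE] := Nn; exact: nE.
Qed.

Lemma derive_normal_frame i j :
  dotp ('D_(E i x) nu x) (e j) = - second_ff X N c x E i j.
Proof. by rewrite dotpC; apply: oppr_inj; rewrite opprK second_ffE. Qed.

Lemma second_derive_normal w :
  dotp ('D_w ('D_w f) x) (nu x) = - dotp (dtan X c x w) ('D_w nu x).
Proof.
have [_ /(_ w)[_ [_ /(_ w)[dd _]]]] := Cf 2.
have := derive_dotp (dd x cx) (@derivable_normal w).
rewrite (@near_eq_derive _ _ _ _ (cst 0)) ?derive_cst.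
  by move/esym/eqP; rewrite addr_eq0 => /eqP <-.
apply: filterS (near_nbhs_open oC cx) => y cy.
by have [_ _ nE] := Nn; exact: nE.
Qed.

Lemma mean_curvatureE :
  mean_curvature X N c x E = - \sum_i second_ff X N c x E i i.
Proof.
rewrite -sumrN; apply: eq_bigr => i _.
by rewrite second_ffE opprK dotpC.
Qed.

Definition sqr_normA : R := \sum_i \sum_j second_ff X N c x E i j ^+ 2.

Lemma mean_curvature_sqr_le : mean_curvature X N c x E ^+ 2 <= n%:R * sqr_normA.
Proof.
rewrite mean_curvatureE sqrrN.
have := sum_sqr_le (fun i : 'I_n => second_ff X N c x E i i) (fun=> 1).
under eq_bigr do rewrite mulr1.
under [X in _ * X]eq_bigr do rewrite expr1n.
rewrite sumr_const card_ord mulrC => h; apply: le_trans h _.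
rewrite ler_wpM2l// ler_sum// => i _; rewrite (bigD1 i)//= lerDl.
by apply: sumr_ge0 => j _; exact: sqr_ge0.
Qed.

(** The derivative of N is tangent because |N| = 1, and its frame components are combinations of the
    h_ij; Cauchy-Schwarz for each j gives |A|. *)
Lemma normal_derive_le v :
  enorm ('D_v nu x) <= Num.sqrt sqr_normA * enorm (dtan X c x v).
Proof.
have S0 : 0 <= sqr_normA.
  by apply: sumr_ge0 => i _; apply: sumr_ge0 => j _; exact: sqr_ge0.
apply: ler_sqrtM => //; [exact: enorm_ge0|exact: enorm_ge0|].
have Dnu : dotp ('D_v nu x) (nu x) = 0.
  have := derive_dotp (@derivable_normal v) (@derivable_normal v).
  rewrite (_ : (fun y => _) = cst 1) ?derive_cst; last first.
    by apply/funext => y; exact: normal_unit.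
  rewrite (dotpC (nu x)) -mulr2n => /esym/eqP.
  by rewrite mulrn_eq0 => /eqP.
have Dnu_sqr := parseval_tangent frame_on (normal_unit x) (fun i => frame_normal _) Dnu.
apply: (eq_ler Dnu_sqr).
rewrite frame_sqr_sum /sqr_normA exchange_big mulr_suml.
apply: ler_sum => j _.
have -> : dotp ('D_v nu x) (e j) =
    - \sum_i second_ff X N c x E i j * dotp (dtan X c x v) (e i).
  rewrite {1}(frame_decomp v) (C1_derive_sum oC (normal_Ck 1) _ _ cx) dotp_suml -sumrN.
  apply: eq_bigr => i _; rewrite (C1_deriveZ oC (normal_Ck 1) _ _ cx) dotpZl.
  exact: (mulr_of_opp _ (derive_normal_frame i j)).
by rewrite sqrrN sum_sqr_le.
Qed.

(** First derivatives at the maximum make the ambient gradient Z normal. In the second derivative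
    along a chart line only the normal part of the acceleration is then paired with Z, so chart
    lines do the work of geodesics; summing over the frame yields H. *)
Lemma max_mean_curvature (P : 'rV[R]_n.+1) (eps : R) :
  (\forall y \near x, dotp (f y) (f y) / 2 - eps * dotp (f y - P) (f y - P)
     <= dotp (f x) (f x) / 2 - eps * dotp (f x - P) (f x - P)) ->
  (1 - 2 * eps) * n%:R <=
  dotp (f x - (2 * eps) *: (f x - P)) (nu x) * mean_curvature X N c x E.
Proof.
move=> fmax; pose g y : R := dotp (f y) (f y) / 2 - eps * dotp (f y - P) (f y - P).
have gmax : \forall y \near x, g y <= g x := fmax.
pose Z y := f y - (2 * eps) *: (f y - P).
have df w y : ccod c y -> is_derive y w f ('D_w f y).
  by move=> cy; apply: derivableP; have [_ /(_ w)[+ _]] := Cf 1; exact.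
have dfP w y : ccod c y -> is_derive y w (fun y => f y - P) ('D_w f y).
  move=> cy; rewrite -[X in is_derive _ _ _ X]subr0.
  exact: is_deriveB (df w y cy) (is_derive_cst P y w).
have dg w y : ccod c y -> is_derive y w g (dotp ('D_w f y) (Z y)).
  move=> cy.
  have d1 := is_derive_dotp (df w y cy) (df w y cy).
  have d2 := is_derive_dotp (dfP w y cy) (dfP w y cy).
  have d3 := @is_deriveZ _ _ _ _ (2^-1 : R) _ _ _ d1.
  have d4 := @is_deriveZ _ _ _ _ eps _ _ _ d2.
  have := is_deriveB d3 d4.
  have -> : (2^-1 : R) *: (dotp ('D_w f y) (f y) + dotp (f y) ('D_w f y)) -
     eps *: (dotp ('D_w f y) (f y - P) + dotp (f y - P) ('D_w f y)) =
     dotp ('D_w f y) (Z y).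
    rewrite /Z [RHS]dotpBr dotpZr (dotpC (f y)) (dotpC (f y - P)).
    by move: (dotp _ _) (dotp _ _) => A B; rewrite -[LHS]/(_ * _ - _ * _); field.
  rewrite (_ : (2^-1 : R) *: _ - _ = g)//; apply/funext => z.
  by rewrite /g -[LHS]/(_ * _ - _ * _) [X in X - _]mulrC.
have dZ w : is_derive x w Z ('D_w f x - (2 * eps) *: 'D_w f x).
  have := @is_deriveZ _ _ _ _ (2 * eps) _ _ _ (dfP w x cx).
  exact: is_deriveB (df w x cx).
have nC := near_nbhs_open oC cx.
have key w : dotp ('D_w f x) (Z x) = 0 /\
    dotp ('D_w ('D_w f) x) (Z x) + (1 - 2 * eps) * dotp ('D_w f x) ('D_w f x) <= 0.
  have [_ /(_ w)[_ [_ /(_ w)[dd _]]]] := Cf 2.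
  have := is_derive_dotp (derivableP (dd x cx)) (dZ w).
  rewrite [X in _ + X](_ : _ = (1 - 2 * eps) * dotp ('D_w f x) ('D_w f x)); last first.
    by rewrite dotpBr dotpZr mulrBl mul1r.
  have nE : \near x, dotp ('D_w f x) (Z x) = 'D_w g x.
    by apply: filterS nC => y cy; have [_ ->] := dg w y cy.
  move=> /(near_eq_is_derive nE)[ddg ddgE].
  have [|D0 D2] := @local_max_second _ _ g x w gmax _ ddg.
    by apply: filterS nC => y cy; have [] := dg w y cy.
  by rewrite -ddgE (nbhs_singleton nE).
have Ze i : dotp (Z x) (e i) = 0 by rewrite dotpC; exact: (key (E i x)).1.
have ZE := orthogonal_frame frame_on (normal_unit x) (fun i => frame_normal _) Ze.
rewrite -/(Z x) mean_curvatureE; set zeta := dotp (Z x) (nu x) in ZE *.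
rewrite mulrN -subr_le0 opprK mulr_sumr mulrC -[n in n%:R]card_ord -sumr_const.
rewrite mulr_suml -big_split/=; apply: sumr_le0 => i _.
have := (key (E i x)).2; rewrite ZE dotpZr second_derive_normal => h.
exact: (frame_term_le h (second_ffE i i) (frame_unit i)).
Qed.

End ShapeOperator.

(** * Local graphs over a tangent space *)

Lemma lipschitz_continuous_at {R : realType} {V W : normedModType R} (f : V -> W)
    (x : V) (K : R) :
  (\forall y \near x, `|f y - f x| <= K * `|y - x|) -> {for x, continuous f}.
Proof.
move=> fK; apply/cvgrPdist_le => e e0.
have K0 : 0 < `|K| + 1 by rewrite ltr_wpDl.
have n2 := near_dist_lt x (divr_gt0 e0 K0).
apply: filterS2 _ fK n2 => y h yx; rewrite distrC (le_trans h)//.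
rewrite ltr_pdivlMr// in yx; apply: le_trans (ltW yx).
rewrite mulrC ler_wpM2l// (le_trans (ler_norm _))//; lra.
Qed.

(* Minimise |phi w - y| over a closed ball: at an interior minimum a Newton
   step would decrease it. *)
Lemma strict_surjective {R : realType} {n : nat} (phi : 'rV[R]_n -> 'rV[R]_n)
    (J : 'M[R]_n) (x0 z y : 'rV[R]_n) (r m : R) :
  0 < m -> (forall u : 'rV[R]_n, m * `|u| <= `|u *m J|) ->
  (forall v w, `|v - x0| < r -> `|w - x0| < r ->
     `|phi w - phi v - (w - v) *m J| <= m / 2 * `|w - v|) ->
  `|z - x0| < r / 2 -> `|y - phi z| < m * r / 16 ->
  exists2 w, `|w - x0| < r & phi w = y.
Proof.
move=> m0 mJ phiJ zr yr.
have r0 : 0 < r by have := normr_ge0 (z - x0); lra.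
have zr' : `|z - x0| < r by lra.
have Ju : J \in unitmx.
  rewrite -row_free_unit -kermx_eq0; apply/eqP/row_matrixP => i; rewrite row0.
  have : row i (kermx J) *m J = 0 by apply/sub_kermxP; exact: row_sub.
  move=> kJ; have := mJ (row i (kermx J)); rewrite kJ normr0 => h.
  apply/eqP; rewrite -normr_le0; by rewrite pmulr_rle0 in h.
have phi_ge v w : `|v - x0| < r -> `|w - x0| < r -> m / 2 * `|w - v| <= `|phi w - phi v|.
  move=> vr wr; have h1 := mJ (w - v); have h2 := phiJ v w vr wr.
  have h3 : `|(w - v) *m J| <= `|phi w - phi v| + `|phi w - phi v - (w - v) *m J|.
    rewrite -{1}[(w - v) *m J](subrK (phi w - phi v)) addrC.
    by rewrite (le_trans (ler_normD _ _))// lerD2l distrC.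
  lra.
have phi_le v w : `|v - x0| < r -> `|w - x0| < r ->
    `|phi w - phi v| <= (\sum_i \sum_j `|J i j| + m / 2) * `|w - v|.
  move=> vr wr; rewrite -(subrK ((w - v) *m J) (phi w - phi v)).
  rewrite (le_trans (ler_normD _ _))// addrC mulrDl lerD ?phiJ//.
  exact: norm_mulmx_le.
pose B := [set w | `|w - z| <= r / 4].
have Br w : B w -> `|w - x0| < r.
  rewrite /B/= => wz; rewrite -(subrKA z) (le_lt_trans (ler_normD _ _))//; lra.
have Bz : B z by rewrite /B/= subrr normr0; lra.
have cB : compact B by exact: closed_ball_rV_compact.
pose S := \sum_i \sum_j `|J i j| + m / 2.
have S0 : 0 < S.
  rewrite ltr_wpDl ?divr_gt0//; apply: sumr_ge0 => i _; exact: sumr_ge0.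
have cphi : {within B, continuous (fun w => `|phi w - y|)}.
  apply: continuous_in_subspaceT => v; rewrite inE => /Br vr.
  apply: (@lipschitz_continuous_at _ _ _ _ v S).
  have vr' : 0 < r - `|v - x0| by rewrite subr_gt0.
  apply: filterS (near_dist_lt v vr') => w wr.
  have wr' : `|w - x0| < r.
    by rewrite -(subrKA v) (le_lt_trans (ler_normD _ _))// -ltrBrDr.
  have := ler_dist_dist (phi w - y) (phi v - y) => h; apply: le_trans h _.
  by rewrite opprB addrA subrK phi_le.
have [w0 w0B w0min] := compact_EVT_min (ex_intro _ z Bz) cB cphi.
rewrite inE in w0B; have w0r := Br _ w0B.
exists w0 => //; apply/eqP; rewrite -subr_eq0; apply/negPn/negP => w0y.
have g0 : 0 < `|phi w0 - y| by rewrite normr_gt0.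
have w0z : `|phi w0 - y| <= `|phi z - y| by apply: w0min; rewrite inE.
(* phi expands by m / 2 and |phi w0 - phi z| <= 2 |y - phi z| by minimality, so |w0 - z| <= (4 / m)
   |y - phi z|: hence the bound m r / 16 in the hypothesis. *)
have w0int : `|w0 - z| < r / 4.
  have h := phi_ge z w0 zr' w0r.
  have h2 : `|phi w0 - phi z| <= `|phi w0 - y| + `|y - phi z|.
    by rewrite -(subrKA y) ler_normD.
  have h3 : m / 2 * `|w0 - z| < m / 2 * (r / 4).
    have h4 : `|phi z - y| = `|y - phi z| by rewrite distrC.
    by rewrite h4 in w0z; lra.
  by move: h3; rewrite ltr_pM2l// divr_gt0.
pose u := (y - phi w0) *m invmx J.
have uJ : u *m J = y - phi w0 by rewrite /u -mulmxA mulVmx// mulmx1.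
have um : m * `|u| <= `|phi w0 - y| by rewrite distrC -uJ.
have u0 : 0 < `|u| + 1 by rewrite ltr_wpDl.
(* The Newton step u is damped to stay in B. It gains t |phi w0 - y|, and the linearisation error
   takes back at most half of that. *)
pose t := Num.min 1 ((r / 4 - `|w0 - z|) / (`|u| + 1)).
have t0 : 0 < t by rewrite lt_min ltr01 divr_gt0// subr_gt0.
have t1 : t <= 1 by rewrite ge_min lexx.
have tu : t * `|u| <= r / 4 - `|w0 - z|.
  have : t <= (r / 4 - `|w0 - z|) / (`|u| + 1) by rewrite ge_min lexx orbT.
  rewrite ler_pdivlMr// mulrDr mulr1; lra.
pose w1 := w0 + t *: u.
have w1w0 : w1 - w0 = t *: u by rewrite /w1 addrAC subrr add0r.
have w1B : B w1.
  rewrite /B/= -(subrKA w0) w1w0 (le_trans (ler_normD _ _))// normrZ gtr0_norm//.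
  lra.
have := w0min w1; rewrite inE => /(_ w1B); apply/negP; rewrite -ltNge.
have := phiJ w0 w1 w0r (Br _ w1B); rewrite w1w0 -scalemxAl uJ normrZ gtr0_norm// => h.
have -> : phi w1 - y = (1 - t) *: (phi w0 - y) + (phi w1 - phi w0 - t *: (y - phi w0)).
  by apply/rowP => i; rewrite !mxE; ring.
rewrite (le_lt_trans (ler_normD _ _))// normrZ ger0_norm ?subr_ge0//.
have h2 : m / 2 * (t * `|u|) <= t / 2 * `|phi w0 - y|.
  have -> : m / 2 * (t * `|u|) = t / 2 * (m * `|u|) by field.
  by rewrite ler_wpM2l// divr_ge0// ltW.
have : 0 < t / 2 * `|phi w0 - y| by rewrite mulr_gt0// divr_gt0.
lra.
Qed.

Lemma ler_enorm_dist {R : realType} {m : nat} (u v : 'rV[R]_m) :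
  enorm u <= enorm v + enorm (u - v).
Proof. by have := ler_enormD v (u - v); rewrite addrC subrK. Qed.

Section Lifting.
Context {R : realType} {n : nat} {M : topologicalType}.
Variables (atlas : set (chart R n M)) (X N : M -> 'rV[R]_n.+1).
Hypotheses (Mm : smooth_manifold atlas) (Xi : immersion atlas X).
Hypothesis Nn : unit_normal atlas X N.

Let Xs : smooth_map atlas X := Xi.1.
Local Notation d := (dlt atlas X).

(** The bound is required in all frames at q, which spares a proof that |A| does not depend on the
    frame. *)
Definition normA_le (a : R) (q : M) : Prop := forall c E,
  atlas c -> cdom c q -> local_orthonormal_frame X c (cmap c q) E ->
  sqr_normA X N c (cmap c q) E <= a ^+ 2.

Lemma normal_derive_bound (a : R) q c v : 0 <= a -> normA_le a q ->
  atlas c -> cdom c q ->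
  enorm ('D_v (N \o cinv c) (cmap c q)) <=
    a * enorm ('D_v (X \o cinv c) (cmap c q)).
Proof.
move=> a0 Aq Ac cq; have cx := chart_cod cq.
have [E fE] := frame_exists Mm Xi Ac cx.
apply: le_trans (normal_derive_le Mm Xi Nn Ac cx fE v) _.
rewrite ler_wpM2r ?enorm_ge0// -(ler_sqr) ?nnegrE ?sqrtr_ge0//.
rewrite sqr_sqrtr; first exact: Aq.
by apply: sumr_ge0 => i _; apply: sumr_ge0 => j _; exact: sqr_ge0.
Qed.

Lemma normal_near_lipschitz (a : R) q : 0 <= a -> normA_le a q ->
  \forall y \near q, enorm (N y - N q) <= (a + 1) * enorm (X y - X q).
Proof.
move=> a0 Aq; have [c Ac cq] := manifold_cover Mm q.
have cx := chart_cod cq; set x := cmap c q.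
have oC : open (ccod c) := ccod_open Mm Ac.
have CX : Ck_on 1 (ccod c) (X \o cinv c) := chart_Ck Xi Ac 1.
have CN : Ck_on 1 (ccod c) (N \o cinv c) := normal_Ck Nn Ac 1.
have qE : cinv c x = q by rewrite /x (chart_mapK (manifold_charts Mm Ac)).
have [m m0 mP] := C1_lower_bound oC CX cx (fun v => Xi.2 c x v Ac cx).
(* Relative linearisation errors kap give |dN| <= (a + kap) |DX| and (1 - kap) |DX| <= |dX|; kap
   solves a + kap = (a + 1) (1 - kap), which is why the slope is a + 1. *)
pose kap := (a + 2)^-1.
have a2 : 0 < a + 2 by rewrite ltr_wpDl.
have kap0 : 0 < kap by rewrite invr_gt0.
pose e := kap * m / n.+1%:R.
have e0 : 0 < e by rewrite divr_gt0 ?ltr0Sn// mulr_gt0.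
apply: (chart_near Mm Ac cq); rewrite -/x.
have [r /= r0 /(_ (r / 2) (half_in_ball r0))h1] := C1_strict_derive oC CX cx e0.
have [s /= s0 /(_ (s / 2) (half_in_ball s0))h2] := C1_strict_derive oC CN cx e0.
have r2 : 0 < r / 2 by rewrite divr_gt0.
have s2 : 0 < s / 2 by rewrite divr_gt0.
apply: filterS2 _ (near_dist_lt x r2) (near_dist_lt x s2) => y yr ys.
have xr : `|x - x| < r / 2 by rewrite subrr normr0.
have xs : `|x - x| < s / 2 by rewrite subrr normr0.
have {}h1 := h1 r2 x y xr yr; have {}h2 := h2 s2 x y xs ys.
rewrite /= !qE -/x in h1 h2.
set DX := 'D_(y - x) (X \o cinv c) x in h1; set DN := 'D_(y - x) (N \o cinv c) x in h2.
have hm : m * `|y - x| <= enorm DX := le_trans (mP _) (norm_le_enorm _).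
have ne u : `|u| <= e * `|y - x| -> enorm (u : 'rV[R]_n.+1) <= kap * enorm DX.
  move=> ue; apply: le_trans (enorm_le_norm _) _.
  apply: (@le_trans _ _ (n.+1%:R * (e * `|y - x|))); first by rewrite ler_wpM2l.
  have -> : n.+1%:R * (e * `|y - x|) = kap * (m * `|y - x|).
    have : (n.+1%:R : R) != 0 by rewrite pnatr_eq0.
    by rewrite /e; move: n.+1%:R => K K0; field.
  by rewrite ler_wpM2l// ltW.
have k1 := ne _ h1; have k2 := ne _ h2.
have kN : enorm DN <= a * enorm DX by exact: normal_derive_bound.
set dX := X (cinv c y) - X q in k1 *; set dN := N (cinv c y) - N q in k2 *.
clearbody DX DN dX dN.
have t1 : enorm DX <= enorm dX + kap * enorm DX.
  by apply: le_trans (ler_enorm_dist DX dX) _; rewrite lerD2l enorm_sub.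
have t2 : enorm dN <= (a + kap) * enorm DX.
  by apply: le_trans (ler_enorm_dist dN DN) _; rewrite mulrDl lerD.
apply: le_trans t2 _.
have kapE : kap * (a + 2) = 1 by rewrite mulVf// gt_eqF.
have t3 : (1 - kap) * enorm DX <= enorm dX by lra.
apply: le_trans (ler_wpM2l (_ : 0 <= a + 1) t3); last by rewrite addr_ge0.
have -> : (a + 1) * ((1 - kap) * enorm DX) = (a + 1 - kap * (a + 2) + kap) * enorm DX.
  by ring.
by rewrite kapE addrK.
Qed.

Lemma normal_lipschitz (a : R) p q l : 0 <= a -> joined_by atlas X p q l ->
  (forall x l', l' <= l -> joined_by atlas X p x l' -> normA_le a x) ->
  enorm (N q - N p) <= (a + 1) * l.
Proof.
move=> a0 J AJ; apply: (joined_lipschitz Mm Xs _ _ J AJ); first by rewrite addr_ge0.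
move=> x /(normal_near_lipschitz a0); apply: filterS => y h e Je.
apply: le_trans h _; rewrite ler_wpM2l ?addr_ge0//; exact: (joined_enorm Mm Xs).
Qed.

End Lifting.

(** As w is orthogonal to nu', its component along nu is at most |w| / 2, so the projection keeps at
    least half of its length. The factor n comes from the sup norm. *)
Lemma tangent_projection {R : realType} {n : nat} (e : 'I_n -> 'rV[R]_n.+1)
    (nu nu' w : 'rV[R]_n.+1) :
  (forall i j, dotp (e i) (e j) = (i == j)%:R) -> dotp nu nu = 1 ->
  (forall i, dotp (e i) nu = 0) -> dotp w nu' = 0 -> enorm (nu' - nu) <= 1 / 2 ->
  enorm w <= 2 * n%:R * `|\row_i dotp w (e i)|.
Proof.
move=> e_on nu1 e_nu wnu' nn'; set r := \row_i _.
have h : enorm w ^+ 2 = enorm r ^+ 2 + dotp w nu ^+ 2.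
  rewrite sqr_enorm (parseval e_on nu1 e_nu) enorm_sum_sqr; congr (_ + _).
  by apply: eq_bigr => i _; rewrite mxE.
have h2 : `|dotp w nu| <= enorm w / 2.
  have -> : dotp w nu = dotp w (nu - nu') by rewrite dotpBr wnu' subr0.
  apply: le_trans (dotp_le _ _) _; rewrite ler_wpM2l ?enorm_ge0//.
  by rewrite enorm_sub (le_trans nn')// mul1r.
have h3 : dotp w nu ^+ 2 <= enorm w ^+ 2 / 4.
  have -> : enorm w ^+ 2 / 4 = (enorm w / 2) ^+ 2 by field.
  by rewrite -(real_normK (num_real (dotp w nu))) ler_sqr ?nnegrE// divr_ge0 ?enorm_ge0.
have h4 : enorm w <= 2 * enorm r.
  rewrite -(ler_sqr) ?nnegrE ?mulr_ge0 ?enorm_ge0// exprMn.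
  have := sqr_ge0 (enorm w).
  by move: (enorm w ^+ 2) (enorm r ^+ 2) (dotp w nu ^+ 2) h h3 => A B D; lra.
apply: le_trans h4 _; rewrite -mulrA ler_wpM2l//; exact: enorm_le_norm.
Qed.

Section Coordinates.
Context {R : realType} {n : nat} {M : topologicalType}.
Variables (atlas : set (chart R n M)) (X N : M -> 'rV[R]_n.+1).
Hypotheses (Mm : smooth_manifold atlas) (Xi : immersion atlas X).
Hypothesis Nn : unit_normal atlas X N.
Variables (p : M) (e : 'I_n -> 'rV[R]_n.+1).
Hypothesis e_on : forall i j, dotp (e i) (e j) = (i == j)%:R.
Hypothesis e_normal : forall i, dotp (e i) (N p) = 0.

Local Notation d := (dlt atlas X).

Definition tangent_coord (q : M) : 'rV[R]_n := \row_i dotp (X q - X p) (e i).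
Local Notation F := tangent_coord.

(** This is 2 (2 n + 1): 2 n from [tangent_projection], 1 from the slack in [chart_joined], and 2
    from comparing the differential of F with differences of F. *)
Definition lift_cst : R := 4 * n%:R + 2.
Local Notation C := lift_cst.

Lemma tangent_coord_lipschitz q q' : `|F q' - F q| <= enorm (X q' - X q).
Proof.
apply: norm_row_le (enorm_ge0 _) _ => i; rewrite !mxE -dotpBl opprB addrA subrK.
apply: le_trans (dotp_le _ _) _.
by rewrite /enorm e_on eqxx sqrtr1 mulr1.
Qed.

Lemma tangent_coord_Ck c k : atlas c -> Ck_on k (ccod c) (F \o cinv c).
Proof.
move=> Ac; have oC := ccod_open Mm Ac.
apply: (Ck_row oC) => i.
apply: (@Ck_ext _ _ _ oC _ (fun y => dotp (X (cinv c y) + - X p) (e i))).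
  by move=> y _; rewrite mxE.
apply: (Ck_dotp oC); last exact: (Ck_cst oC).
exact: (Ck_add oC (chart_Ck Xi Ac k) (Ck_cst oC _ k)).
Qed.

Lemma tangent_coord_derive c x v : atlas c -> ccod c x ->
  'D_v (F \o cinv c) x = \row_i dotp ('D_v (X \o cinv c) x) (e i).
Proof.
move=> Ac cx; apply/rowP => i.
have [_ /(_ v)[/(_ x cx) DF _]] := tangent_coord_Ck 1 Ac.
have [_ /(_ v)[/(_ x cx) DX _]] := chart_Ck Xi Ac 1.
rewrite -derive_coord// mxE.
have h := is_derive_dotp (is_deriveB (derivableP DX) (is_derive_cst (X p) x v))
  (is_derive_cst (e i) x v).
rewrite subr0 [dotp _ 0]dotpC dotp0l addr0 in h.
have [_ <-] := h.
by congr ('D_v _ x); apply/funext => y; rewrite mxE.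
Qed.

(** Expansion of F is stated through a curve: if F x' = F x, that curve has length 0, so X x' = X
    x. *)
Definition expands_at (r : R) (x : M) : Prop := forall x', d x x' r ->
  exists2 l, l <= C * `|F x' - F x| & joined_by atlas X x x' l.

Definition lifts_at (r : R) (x : M) : Prop := forall y, `|y - F x| < r ->
  exists2 x', F x' = y & exists2 l, l <= C * `|y - F x| & joined_by atlas X x x' l.

Lemma local_lift q : enorm (N q - N p) <= 1 / 2 -> exists2 r, 0 < r &
  (forall x x', d q x r -> d q x' r ->
    exists2 l, l <= C * `|F x' - F x| & joined_by atlas X x x' l) /\
  (forall x, d q x r -> lifts_at r x).
Proof.
move=> Nq; have [c Ac cq] := manifold_cover Mm q.
have ic := manifold_charts Mm Ac.
have cx0 := chart_cod cq; set x0 := cmap c q.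
have qE : cinv c x0 = q by rewrite /x0 (chart_mapK ic).
have oC : open (ccod c) := ccod_open Mm Ac.
have CF : Ck_on 1 (ccod c) (F \o cinv c) by exact: tangent_coord_Ck.
have [_ uN nN] := Nn.
have DXF v : enorm ('D_v (X \o cinv c) x0) <= 2 * n%:R * `|'D_v (F \o cinv c) x0|.
  rewrite tangent_coord_derive//.
  apply: (tangent_projection e_on (uN p) e_normal _ Nq).
  by have := nN c x0 v Ac cx0; rewrite qE.
have Finj v : 'D_v (F \o cinv c) x0 = 0 -> v = 0.
  move=> Dv0; apply: (Xi.2 c x0 v Ac cx0); apply: enorm_eq0; apply/eqP.
  rewrite eq_le enorm_ge0 andbT; apply: le_trans (DXF v) _.
  by rewrite Dv0 normr0 mulr0.
have [m m0 mP] := C1_lower_bound oC CF cx0 Finj.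
have m2 : 0 < m / 2 by rewrite divr_gt0.
near (0 : R)^'+ => r.
have r0 : 0 < r by [].
have strict : forall v w, `|v - x0| < r -> `|w - x0| < r ->
    `|F (cinv c w) - F (cinv c v) - 'D_(w - v) (F \o cinv c) x0| <= m / 2 * `|w - v|.
  by near: r; exact: (C1_strict_derive oC CF cx0 m2).
have seg : forall v w, `|v - x0| < r -> `|w - x0| < r ->
    [/\ ccod c v, ccod c w & exists2 l,
      l <= enorm ('D_(w - v) (X \o cinv c) x0) + m * `|w - v| &
      joined_by atlas X (cinv c v) (cinv c w) l].
  by near: r; exact: (chart_joined Mm Xi Ac cx0 m0).
have join v w : `|v - x0| < r -> `|w - x0| < r -> exists2 l,
    l <= C * `|F (cinv c w) - F (cinv c v)| & joined_by atlas X (cinv c v) (cinv c w) l.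
  move=> vr wr; have [_ _ [l lle J]] := seg v w vr wr; exists l => //.
  apply: le_trans lle _.
  have h1 := strict v w vr wr; have h2 := mP (w - v); have h3 := DXF (w - v).
  have h4 : `|'D_(w - v) (F \o cinv c) x0| <= 2 * `|F (cinv c w) - F (cinv c v)|.
    move: h1 h2; set D := 'D_ _ _ _; set G := F _ - F _ => h1 h2.
    have h5 : `|D| <= `|G| + `|G - D|.
      by have := ler_normB G (G - D); rewrite opprB addrC subrK.
    lra.
  apply: (@le_trans _ _ ((2 * n%:R + 1) * `|'D_(w - v) (F \o cinv c) x0|)).
    by rewrite mulrDl mul1r lerD.
  have -> : C = (2 * n%:R + 1) * 2 by rewrite /lift_cst; ring.
  by rewrite -mulrA ler_wpM2l// addr_ge0// mulr_ge0.
have r2 : 0 < r / 2 by rewrite divr_gt0.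
have nU : \forall x \near q, cdom c x /\ `|cmap c x - x0| < r / 2.
  have n1 := near_nbhs_open (chart_open_dom ic) cq.
  have n2 := chart_map_cont ic cq (near_dist_lt x0 r2).
  by apply: filterS2 _ n1 n2 => x ? ?; split.
have [s s0 sP] := dlt_nbhs Mm Xi nU.
have r16 : 0 < m * r / 16 by rewrite divr_gt0// mulr_gt0.
(* s keeps points in the half-size chart ball, and m r / 16 is the reach of [strict_surjective]. *)
exists (Num.min s (m * r / 16)); first by rewrite lt_min s0.
have ms : Num.min s (m * r / 16) <= s by rewrite ge_min lexx.
have mr : Num.min s (m * r / 16) <= m * r / 16 by rewrite ge_min lexx orbT.
split=> [x x' /(dlt_le ms)/sP[cx xr] /(dlt_le ms)/sP[cx' xr']|].
  have := join (cmap c x) (cmap c x'); rewrite !(chart_mapK ic)//; apply; lra.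
move=> x /(dlt_le ms)/sP[cx xr] y yr.
have [||||w wr wy] := @strict_surjective _ _ (F \o cinv c) (jacobian (F \o cinv c) x0)
    x0 (cmap c x) y r m m0.
- by move=> u; rewrite -(C1_derive_mulmx _ oC CF cx0).
- by move=> v w vr wr; rewrite -(C1_derive_mulmx _ oC CF cx0); exact: strict.
- by [].
- by rewrite /= (chart_mapK ic)//; exact: lt_le_trans mr.
have xr' : `|cmap c x - x0| < r by lra.
exists (cinv c w) => //; have := join _ _ xr' wr.
by rewrite (chart_mapK ic)// -[F (cinv c w)]/((F \o cinv c) w) wy.
Unshelve. all: by end_near. Qed.

(** Compactness turns the radius of [local_lift], which depends on the point, into one for all of
    K. *)
Lemma uniform_lift (K : set M) : compact K ->
  (forall x, K x -> enorm (N x - N p) <= 1 / 2) ->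
  exists2 r, 0 < r & forall x, K x -> expands_at r x /\ lifts_at r x.
Proof.
move=> cK NK.
have : \forall r \near (0 : R)^'+, K `<=` [set x | expands_at r x /\ lifts_at r x].
  apply: ((compact_near_coveringP _).1 cK _ _
    (fun r x => expands_at r x /\ lifts_at r x)) => q /NK/local_lift[s s0 [sI sS]].
  have s2 : 0 < s / 2 by rewrite divr_gt0.
  have n1 := near_dlt Mm Xi q s2.
  near=> x r; have dx : d q x (s / 2) by near: x.
  have rs : (r : R) <= s / 2 by near: r; exact: nbhs_right_le.
  have dx' : d q x s by apply: dlt_le dx; lra.
  split=> [x' dxx'|y yr].
    apply: sI => //; apply: dlt_le (dlt_trans dx dxx').
    by rewrite /=; lra.
  apply: sS => //; apply: lt_le_trans yr _; rewrite /=; lra.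
case=> s /= s0 /(_ (s / 2) (half_in_ball s0)).
have s2 : 0 < s / 2 by rewrite divr_gt0.
by move=> /(_ s2) h; exists (s / 2).
Unshelve. all: by end_near. Qed.

End Coordinates.

(** * A section of the projection to the tangent space *)

Section LocalSection.
Context {R : realType} {n : nat} {M : topologicalType}.
Variables (atlas : set (chart R n M)) (X : M -> 'rV[R]_n.+1).
Hypotheses (Mm : smooth_manifold atlas) (Xi : immersion atlas X).
Variables (p : M) (e : 'I_n -> 'rV[R]_n.+1) (rho r c1 : R).

Implicit Types y z : 'rV[R]_n.
Let Xs : smooth_map atlas X := Xi.1.
Local Notation d := (dlt atlas X).
Local Notation F := (tangent_coord X p e).
Local Notation C := (@lift_cst R n).
Local Notation K := (closed_geoball atlas X p rho).

Hypotheses (r0 : 0 < r) (c0 : 0 < c1) (c1rho : C * c1 <= rho).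
Hypothesis KP : forall x, K x -> expands_at atlas X p e r x /\ lifts_at atlas X p e r x.

Lemma lift_cst_gt0 : 0 < C.
Proof. by rewrite /lift_cst ltr_wpDl// mulr_ge0. Qed.

Lemma joined_closed_geoball x l : joined_by atlas X p x l -> l <= rho -> K x.
Proof. by move=> J lr e' re; exists l => //; exact: le_lt_trans re. Qed.

(* sigma y is reached from p by k+1 small lifts along the segment [0, y]; the
   same k serves all y. *)
Lemma section_exists : exists (sigma : 'rV[R]_n -> M) (eta : R),
  [/\ 0 < eta,
    forall y, `|y| < c1 -> F (sigma y) = y /\
      exists2 l, l <= C * `|y| & joined_by atlas X p (sigma y) l &
    forall y y', `|y| < c1 -> `|y'| < c1 -> `|y' - y| < eta ->
      exists2 l, l <= C * `|y' - y| & joined_by atlas X (sigma y) (sigma y') l].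
Proof.
have C0 := lift_cst_gt0.
have /choice[L LP] : forall xy : M * 'rV[R]_n, exists x',
    K xy.1 -> `|xy.2 - F xy.1| < r -> F x' = xy.2 /\
    exists2 l, l <= C * `|xy.2 - F xy.1| & joined_by atlas X xy.1 x' l.
  move=> [x y] /=; have [Kx|nKx] := pselect (K x); last by exists x.
  have [yr|nyr] := pselect (`|y - F x| < r); last by exists x.
  by have [x' Fx' J] := (KP Kx).2 y yr; exists x'.
(* A step below r can be lifted, and below r / (4 C) its lift is shorter than r / 4. *)
pose mu := Num.min r (r / (4 * C)).
have mu0 : 0 < mu by rewrite lt_min r0 divr_gt0// mulr_gt0.
have [k kmu] : exists k : nat, c1 / k.+1%:R < mu.
  have [k _ /(_ k (leqnn k)) h] := near_infty_natSinv_lt (PosNum (divr_gt0 mu0 c0)).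
  by exists k; move: h; rewrite /= ltr_pdivlMr// mulrC.
pose t (i : nat) : R := i%:R / k.+1%:R.
have k0 : 0 < (k.+1%:R : R) by rewrite ltr0Sn.
have tS i : t i.+1 = t i + k.+1%:R^-1 by rewrite /t -natr1 mulrDl mul1r.
have t_ge0 i : 0 <= t i by rewrite divr_ge0// ltW.
have t_le1 i : (i <= k.+1)%N -> t i <= 1.
  by move=> ik; rewrite ler_pdivrMr// mul1r ler_nat.
pose xs y i := iteri i (fun j x => L (x, t j.+1 *: y)) p.
have stepr y : `|y| < c1 -> `|y| / k.+1%:R < mu.
  by move=> yc; apply: le_lt_trans kmu; rewrite ler_pM2r ?invr_gt0// ltW.
have mur : mu <= r by rewrite ge_min lexx.
have muC : mu <= r / (4 * C) by rewrite ge_min lexx orbT.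
have diffE y i : t i.+1 *: y - t i *: y = k.+1%:R^-1 *: y.
  by rewrite tS scalerDl addrAC subrr add0r.
have normE y : `|k.+1%:R^-1 *: y| = `|y| / k.+1%:R :> R.
  by rewrite normrZ ger0_norm ?invr_ge0 ?ltW// mulrC.
have KA y i l : `|y| < c1 -> (i <= k.+1)%N -> l <= C * (t i * `|y|) ->
    joined_by atlas X p (xs y i) l -> K (xs y i).
  move=> yc ik ll J; apply: joined_closed_geoball J _; apply: le_trans ll _.
  apply: le_trans c1rho; rewrite ler_pM2l//; apply: le_trans (ltW yc).
  by rewrite ler_piMl ?t_le1.
have A y i : `|y| < c1 -> (i <= k.+1)%N -> F (xs y i) = t i *: y /\
    exists2 l, l <= C * (t i * `|y|) & joined_by atlas X p (xs y i) l.
  move=> yc; elim: i => [_|i IH ik].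
    rewrite /t mul0r scale0r mul0r mulr0; split; last first.
      by exists 0 => //; exact: joined_nil.
    by apply/rowP => j; rewrite !mxE subrr dotp0l.
  have [Fi [l ll J]] := IH (ltnW ik); have Ki := KA y i l yc (ltnW ik) ll J.
  have [||/= Fx [l' ll' J']] := LP (xs y i, t i.+1 *: y) => //=.
    by rewrite Fi diffE normE (lt_le_trans (stepr y yc)).
  split => //; exists (l + l'); last exact: joined_trans J J'.
  rewrite Fi diffE normE in ll'.
  by apply: le_trans (lerD ll ll') _; rewrite -mulrDr ler_pM2l// tS mulrDl lerD2l mulrC.
have KX y i : `|y| < c1 -> (i <= k.+1)%N -> K (xs y i).
  by move=> yc ik; have [_ [l ll J]] := A y i yc ik; exact: KA yc ik ll J.
have J1 y i : `|y| < c1 -> (i < k.+1)%N ->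
    exists2 l, l <= C * (`|y| / k.+1%:R) & joined_by atlas X (xs y i) (xs y i.+1) l.
  move=> yc ik; have [Fi _] := A y i yc (ltnW ik).
  have [||/= Fx [l' ll' J']] := LP (xs y i, t i.+1 *: y) => //=.
  - exact: KX (ltnW ik).
  - by rewrite Fi diffE normE (lt_le_trans (stepr y yc)).
  by exists l' => //; move: ll'; rewrite Fi diffE normE.
pose eta := r / (4 * C).
have eta0 : 0 < eta by rewrite divr_gt0// mulr_gt0.
(* The two chains are compared rung by rung: one step back, across, and one step forward has length
   below 3 r / 4, so [expands_at] replaces this detour by a curve with the sharp bound and errors do
   not accumulate. *)
have B y y' i : `|y| < c1 -> `|y'| < c1 -> `|y' - y| < eta -> (i <= k.+1)%N ->
    exists2 l, l <= C * (t i * `|y' - y|) & joined_by atlas X (xs y i) (xs y' i) l.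
  move=> yc yc' yy'; elim: i => [_|i IH ik].
    by rewrite /t !mul0r mulr0; exists 0 => //; exact: joined_nil.
  have [l ll J] := IH (ltnW ik).
  have [l1 ll1 Ja] := J1 y i yc ik; have [l2 ll2 Jb] := J1 y' i yc' ik.
  have Jc := joined_trans (joined_sym Mm Xs Ja) (joined_trans J Jb).
  have bd z : `|z| < c1 -> C * (`|z| / k.+1%:R) < r / 4.
    move=> zc; have := lt_le_trans (stepr z zc) muC; rewrite -(ltr_pM2l C0).
    by rewrite (_ : C * (r / (4 * C)) = r / 4)//; field; exact: lt0r_neq0.
  have bl : C * (t i * `|y' - y|) < r / 4.
    apply: (@le_lt_trans _ _ (C * `|y' - y|)).
      by rewrite ler_pM2l// ler_piMl// t_le1// ltnW.
    move: yy'; rewrite -(ltr_pM2l C0).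
    by rewrite (_ : C * eta = r / 4)// /eta; field; exact: lt0r_neq0.
  have dr : d (xs y i.+1) (xs y' i.+1) r.
    exists (l1 + (l + l2)) => //.
    have b1 := le_lt_trans ll1 (bd y yc); have b2 := le_lt_trans ll2 (bd y' yc').
    by have b3 := le_lt_trans ll bl; lra.
  have [l3 ll3 J3] := (KP (KX y i.+1 yc ik)).1 _ dr; exists l3 => //.
  move: ll3; rewrite (A y i.+1 yc ik).1 (A y' i.+1 yc' ik).1 -scalerBr normrZ.
  by rewrite (ger0_norm (t_ge0 _)).
have tk : t k.+1 = 1 by rewrite /t divff// gt_eqF.
exists (fun y => xs y k.+1), eta; split => // [y yc|y y' yc yc' yy'].
  by have := A y k.+1 yc (leqnn _); rewrite tk scale1r mul1r.
by have := B y y' k.+1 yc yc' yy' (leqnn _); rewrite tk mul1r.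
Qed.

End LocalSection.

(** * The maximum principle *)

(* With s H = 2 (H - lambda) H, the hypothesis on |A| bounds s H away from n. *)
Lemma curvature_gap {R : realType} (m lambda s t H a k eps : R) :
  1 <= m -> 0 <= a -> 0 <= eps -> 0 <= k -> `|t| <= 2 * k ->
  H - s / 2 = lambda -> H ^+ 2 <= m * a ^+ 2 ->
  (1 - 2 * eps) * m <= (s - 2 * eps * t) * H ->
  3 * m * ((1 - lambda ^+ 2) / 3 - a ^+ 2) <= 2 * eps * (m + 2 * k * (m * a)).
Proof.
move=> m1 a0 eps0 k0 t2k Hs HA Hmax.
have HmA : `|H| <= m * a.
  rewrite -(ler_sqr) ?nnegrE ?mulr_ge0//; last lra.
  rewrite real_normK ?num_real// exprMn (le_trans HA)// ler_wpM2r ?sqr_ge0//.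
  by rewrite expr2 ler_peMl//; lra.
have tH : `|t * H| <= 2 * k * (m * a) by rewrite normrM ler_pM.
have {}tH : - (2 * k * (m * a)) <= t * H by move: tH; rewrite ler_norml => /andP[].
have e1 : 2 * eps * (- (t * H)) <= 2 * eps * (2 * k * (m * a)).
  by rewrite ler_wpM2l ?mulr_ge0// lerNl.
have sE : s * H = 2 * (H - lambda) * H by rewrite -Hs; field.
(* This absorbs the cross term -2 lambda H; [q2] then makes both terms proportional to m. *)
have q1 : 0 <= (H + lambda) ^+ 2 by exact: sqr_ge0.
have q2 : lambda ^+ 2 <= m * lambda ^+ 2 by rewrite ler_peMl ?sqr_ge0.
have Hmax' : m - 2 * eps * m <= s * H - 2 * eps * (t * H) by lra.
rewrite sE in Hmax'; nra.
Qed.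

Lemma continuous_halfB {R : realType} {T : topologicalType} (f g : T -> R) (c : R)
    (x : T) : {for x, continuous f} -> {for x, continuous g} ->
  {for x, continuous (fun y => f y / 2 - c * g y)}.
Proof.
move=> cf cg; apply: cvgB; first by apply: cvgM; [exact: cf|exact: cvg_cst].
by apply: cvgM; [exact: cvg_cst|exact: cg].
Qed.

Section Step.
Context {R : realType} {n : nat} {M : topologicalType}.
Variables (atlas : set (chart R n M)) (X N : M -> 'rV[R]_n.+1) (k lambda a : R).
Hypotheses (Mm : smooth_manifold atlas) (Xh : lambda_hypersurface atlas X N lambda).
Hypotheses (X_ball : forall p, enorm (X p) <= k) (Mc : complete_metric atlas X).
Hypotheses (k0 : 0 < k) (n0 : (0 < n)%N) (a0 : 0 <= a).
Hypothesis a_small : a ^+ 2 < (1 - lambda ^+ 2) / 3.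

Let Xi : immersion atlas X. Proof. by have [] := Xh. Qed.
Let Nn : unit_normal atlas X N. Proof. by have [] := Xh. Qed.
Let Xs : smooth_map atlas X := Xi.1.
Local Notation d := (dlt atlas X).
Local Notation C := (@lift_cst R n).

Definition potential (P : 'rV[R]_n.+1) (eps : R) (w : 'rV[R]_n.+1) : R :=
  dotp w w / 2 - eps * dotp (w - P) (w - P).

Lemma potential_continuous P eps : continuous (potential P eps).
Proof.
have cid : Ck_on 0 setT (id : 'rV[R]_n.+1 -> 'rV[R]_n.+1).
  by split=> // w _; exact: cvg_id.
have cP := Ck_add openT cid (Ck_cst openT (- P) 0).
move=> w; have [h1 _] := Ck_dotp openT cid cid; have [h2 _] := Ck_dotp openT cP cP.
apply: (@continuous_halfB _ _ (fun w : 'rV[R]_n.+1 => dotp w w)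
  (fun w => dotp (w - P) (w - P)) eps w).
  exact: (h1 w I).
exact: (h2 w I).
Qed.

(** N has Lipschitz constant a + 1, so over a curve of length 2 rho it moves by at most 1 / 2, as
    [tangent_projection] demands. *)
Let rho : R := (4 * (a + 1))^-1.
Let gap : R := 3 * n%:R * ((1 - lambda ^+ 2) / 3 - a ^+ 2).
Let B : R := n%:R + 2 * k * (n%:R * a).
(** The penalty perturbs the curvature inequality by 2 eps B, which is half the gap. *)
Let eps : R := gap / (4 * B).
(** Lifts of vectors shorter than 2 c0 have length at most rho; the maximum is sought over the
    smaller closed ball of radius c0. *)
Let c0 : R := rho / (2 * C).
(** Half of the least penalty on the boundary |y| = c0. *)
Definition step_size : R := eps * c0 ^+ 2 / 2.

Let nR : 1 <= (n%:R : R). Proof. by rewrite ler1n. Qed.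
Let a1 : 0 < a + 1. Proof. by rewrite ltr_wpDl. Qed.
Let rho0 : 0 < rho. Proof. by rewrite invr_gt0 mulr_gt0. Qed.
Let rhoE : 4 * (a + 1) * rho = 1. Proof. by rewrite mulfV// gt_eqF// mulr_gt0. Qed.
Let rho1 : rho <= 1 / 4.
Proof. by have := mulr_ge0 a0 (ltW rho0); have := rhoE; lra. Qed.
Let B0 : 0 < B.
Proof. by rewrite ltr_wpDr ?(lt_le_trans ltr01)// !mulr_ge0// ltW. Qed.
Let gap0 : 0 < gap.
Proof. by rewrite !mulr_gt0 ?subr_gt0// (lt_le_trans ltr01). Qed.
Let eps0 : 0 < eps. Proof. by rewrite divr_gt0// mulr_gt0. Qed.
Let C0 : 0 < C. Proof. exact: lift_cst_gt0. Qed.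
Let c0_gt0 : 0 < c0. Proof. by rewrite divr_gt0// mulr_gt0. Qed.

Lemma step_size_gt0 : 0 < step_size.
Proof. by rewrite divr_gt0// mulr_gt0// exprn_gt0. Qed.

Lemma no_interior_max (p q : M) : normA_le atlas X N a q ->
  ~ (\forall x \near q, potential (X p) eps (X x) <= potential (X p) eps (X q)).
Proof.
move=> Aq qmax; have [c Ac cq] := manifold_cover Mm q.
have ic := manifold_charts Mm Ac; have cx := chart_cod cq; set x := cmap c q.
have qE : cinv c x = q by rewrite /x (chart_mapK ic).
have [E fE] := frame_exists Mm Xi Ac cx.
have [_ _ Hl] := Xh; have HE := Hl c q E Ac cq fE.
have [_ uN _] := Nn.
have nmax : \forall y \near x,
    potential (X p) eps (X (cinv c y)) <= potential (X p) eps (X (cinv c x)).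
  rewrite qE.
  have ci : {for x, continuous (cinv c)} := chart_inv_cont ic cx.
  have qm : nbhs (cinv c x)
      (fun z => potential (X p) eps (X z) <= potential (X p) eps (X q)) by rewrite qE.
  exact: (ci _ qm).
have := max_mean_curvature Mm Xi Nn Ac cx fE nmax.
rewrite /= -/x qE dotpBl dotpZl => Hmax.
have HA := le_trans (mean_curvature_sqr_le Mm Xi Nn Ac cx fE)
  (ler_wpM2l (ler0n R n) (Aq c E Ac cq fE)).
have tk : `|dotp (X q - X p) (N q)| <= 2 * k.
  apply: le_trans (dotp_le _ _) _; rewrite [enorm (N q)]/enorm uN sqrtr1 mulr1.
  apply: le_trans (ler_enormD _ _) _; rewrite enormN.
  by have := X_ball q; have := X_ball p; lra.
rewrite -/x dotpC in HE.
have := curvature_gap nR a0 (ltW eps0) (ltW k0) tk HE HA Hmax.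
rewrite -/gap -/B /eps.
have -> : 2 * (gap / (4 * B)) * B = gap / 2 by field; exact: lt0r_neq0.
by rewrite leNgt ltr_pdivrMr// mulr_natr mulr2n ltrDl gap0.
Qed.

Lemma step (p : M) : (forall q, d p q 1 -> normA_le atlas X N a q) ->
  exists2 q, d p q 1 & dotp (X p) (X p) / 2 + step_size <= dotp (X q) (X q) / 2.
Proof.
move=> Ap; apply: contrapT => np.
have {}np q : d p q 1 -> dotp (X q) (X q) / 2 < dotp (X p) (X p) / 2 + step_size.
  by move=> dq; rewrite ltNge; apply/negP => h; apply: np; exists q.
pose K := closed_geoball atlas X p rho.
have cK : compact K by exact: closed_geoball_compact.
have NK x : K x -> enorm (N x - N p) <= 1 / 2.
  move=> Kx; have [|l J ll] := Kx (2 * rho); first by rewrite ltr_pMl// ltr1n.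
  apply: le_trans (normal_lipschitz Mm Xi Nn a0 J _) _.
    by move=> y l' ll' J'; apply: Ap; exists l' => //; have := rho1; lra.
  apply: (@le_trans _ _ ((a + 1) * (2 * rho))); first by rewrite ler_wpM2l ?ltW.
  by have := rhoE; lra.
have [c Ac cp] := manifold_cover Mm p; have cx := chart_cod cp.
have [E fE] := frame_exists Mm Xi Ac cx.
pose e i := dtan X c (cmap c p) (E i (cmap c p)).
have e_on : forall i j, dotp (e i) (e j) = (i == j)%:R := frame_on fE.
have e_nu i : dotp (e i) (N p) = 0.
  have := frame_normal Nn Ac cx (E i (cmap c p)).
  by rewrite /= (chart_mapK (manifold_charts Mm Ac)).
have [r r0 KP] := uniform_lift Mm Xi Nn e_on e_nu cK NK.
pose c1 := 2 * c0; have c1_gt0 : 0 < c1 by rewrite mulr_gt0.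
have Cc1 : C * c1 = rho by rewrite /c1 /c0; field; exact: lt0r_neq0.
have c01 : c0 < c1 by rewrite ltr_pMl// ltr1n.
have Cc1' : C * c1 <= rho by rewrite Cc1.
have [sigma [eta [eta0 sP sL]]] := section_exists Mm Xi r0 c1_gt0 Cc1' KP.
pose F := tangent_coord X p e.
have Fp : F p = 0 by apply/rowP => i; rewrite !mxE subrr dotp0l.
have F_le x y : `|F y - F x| <= enorm (X y - X x) by exact: tangent_coord_lipschitz.
pose V x := potential (X p) eps (X x).
have Vp : V p = dotp (X p) (X p) / 2 by rewrite /V /potential subrr dotp0l mulr0 subr0.
have sK y : `|y| < c1 -> K (sigma y).
  move=> yc; have [_ [l ll J]] := sP y yc; apply: joined_closed_geoball J _.
  by apply: le_trans ll _; apply: le_trans Cc1'; rewrite ler_pM2l// ltW.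
have K1 x : K x -> d p x 1.
  by apply; apply: le_lt_trans rho1 _; rewrite ltr_pdivrMr// mul1r ltr1n.
(* Equality of the images under X is enough, because V depends on x through X x only. *)
have joined_eq x y l : joined_by atlas X x y l -> l <= 0 -> X y = X x.
  move=> J l0; apply/eqP; rewrite -subr_eq0; apply/eqP/enorm_eq0/eqP.
  by rewrite eq_le enorm_ge0 andbT; exact: le_trans (joined_enorm Mm Xs J) l0.
have s0E : X (sigma 0) = X p.
  have [|_ [l ll J]] := sP 0; first by rewrite normr0.
  by apply: joined_eq J _; rewrite normr0 mulr0 in ll.
have cV : {within [set y : 'rV[R]_n | `|y - 0| <= c0], continuous (V \o sigma)}.
  apply: continuous_in_subspaceT => y; rewrite inE/= subr0 => yc.
  have yc1 : `|y| < c1 by exact: le_lt_trans yc c01.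
  apply: (@continuous_comp _ _ _ (X \o sigma) (potential (X p) eps)).
    apply: (@lipschitz_continuous_at _ _ _ _ y C).
    have z0 : 0 < Num.min eta (c1 - `|y|) by rewrite lt_min eta0 subr_gt0.
    apply: filterS (near_dist_lt y z0) => z; rewrite lt_min => /andP[ze zc].
    have zc1 : `|z| < c1.
      by rewrite -(subrK y z) (le_lt_trans (ler_normD _ _))// -ltrBrDr.
    have [l ll J] := sL y z yc1 zc1 ze.
    apply: le_trans (norm_le_enorm _) _.
    exact: le_trans (joined_enorm Mm Xs J) ll.
  exact: potential_continuous.
have [|y0 y0A y0max] := compact_EVT_max _ (@closed_ball_rV_compact R n 0 c0) cV.
  by exists 0; rewrite /= subrr normr0 ltW.
rewrite inE/= subr0 in y0A; have y01 : `|y0| < c1 by exact: le_lt_trans y0A c01.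
have Vy0 : V p <= V (sigma y0).
  have := y0max 0; rewrite inE/= subrr normr0 => /(_ (ltW c0_gt0)).
  by rewrite /V s0E.
have [Fy0 [l0 l0l J0]] := sP y0 y01.
(* On the boundary the penalty is at least eps c0^2, twice what u may gain under [np], so V would
   fall below V p. *)
have y0c : `|y0| < c0.
  rewrite lt_def y0A andbT; apply/eqP => y0E.
  have u1 := np _ (K1 _ (sK _ y01)).
  have u2 : c0 ^+ 2 <= dotp (X (sigma y0) - X p) (X (sigma y0) - X p).
    rewrite -sqr_enorm ler_sqr ?nnegrE ?enorm_ge0//; last exact: ltW.
    by have := F_le p (sigma y0); rewrite Fp subr0 [F _]Fy0 -y0E.
  move: Vy0; rewrite Vp /V /potential; have := ler_wpM2l (ltW eps0) u2.
  have st : step_size = eps * c0 ^+ 2 / 2 by [].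
  have sz := step_size_gt0; lra.
apply: (@no_interior_max p (sigma y0)); first exact/Ap/K1/sK.
(* In turn: [sL] applies to y0 and F x; F x stays in the ball; and C s + s <= r, so that
   [expands_at] identifies X x with X (sigma (F x)). A maximum over the section is thus a local
   maximum on M. *)
pose s := Num.min (Num.min eta (c0 - `|y0|)) (r / (C + 1)).
have C1 : 0 < C + 1 by rewrite ltr_wpDr.
have s_gt0 : 0 < s by rewrite !lt_min eta0 subr_gt0 y0c divr_gt0.
apply: filterS (near_dlt Mm Xi (sigma y0) s_gt0) => x dx.
have Fx : `|F x - y0| < s.
  by rewrite -Fy0; exact: le_lt_trans (F_le _ _) (dlt_enorm Mm Xi dx).
have [/andP[Fx1 Fx2] Fx3] : (`|F x - y0| < eta) && (`|F x - y0| < c0 - `|y0|) /\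
    `|F x - y0| < r / (C + 1) by move: (Fx); rewrite !lt_min => /andP[].
have Fxc : `|F x| < c0.
  by rewrite -(subrK y0 (F x)) (le_lt_trans (ler_normD _ _))// -ltrBrDr.
have Fxc1 := lt_trans Fxc c01.
have [FsF _] := sP (F x) Fxc1.
have [l ll J] := sL y0 (F x) y01 Fxc1 Fx1.
have dr : d (sigma (F x)) x r.
  have [l' J' l's] := dx.
  exists (l + l'); first exact: joined_trans (joined_sym Mm Xs J) J'.
  have sr : s <= r / (C + 1) by rewrite ge_min lexx orbT.
  rewrite ler_pdivlMr// in sr.
  have : C * `|F x - y0| <= C * s by rewrite ler_pM2l// ltW.
  lra.
have [l2 ll2 J2] := (KP _ (sK _ Fxc1)).1 x dr.
have XE : X x = X (sigma (F x)).
  by apply: joined_eq J2 _; rewrite FsF subrr normr0 mulr0 in ll2.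
by rewrite XE; apply: y0max; rewrite inE/= subr0 ltW.
Qed.

End Step.

(** * Iteration against the boundedness of X *)

Section Conclusion.
Context {R : realType} {n : nat} {M : topologicalType}.
Variables (atlas : set (chart R n M)) (X N : M -> 'rV[R]_n.+1) (k lambda : R).
Hypotheses (Mm : smooth_manifold atlas) (Xh : lambda_hypersurface atlas X N lambda).
Hypotheses (X_ball : forall p, enorm (X p) <= k) (Mc : complete_metric atlas X).
Hypotheses (k0 : 0 < k) (Mconn : connected [set: M]) (Mnc : ~ compact [set: M]).

Let Xi : immersion atlas X. Proof. by have [] := Xh. Qed.
Local Notation d := (dlt atlas X).

(** In dimension 0 a chart domain is one point, which is open and closed; connectedness would make M
    that single compact point. *)
Lemma noncompact_dim_gt0 (p : M) : (0 < n)%N.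
Proof.
case: n atlas Mm => [atlas0 Mm0|//]; exfalso; apply: Mnc.
have [c Ac cp] := manifold_cover Mm0 p; have ic := manifold_charts Mm0 Ac.
have pE : cdom c = [set p].
  apply/seteqP; split=> [q cq|q ->//].
  rewrite -(chart_mapK ic cq) -(chart_mapK ic cp); congr (cinv c _).
  by apply/rowP => -[].
suff <- : [set p] = [set: M] by exact: compact_set1.
apply: Mconn; first by exists p.
  by exists [set p]; rewrite ?setTI// -pE; exact: chart_open_dom ic.
exists [set p]; rewrite ?setTI//.
apply: compact_closed; [exact: manifold_hausdorff Mm0|exact: compact_set1].
Qed.

Lemma small_normA_contradiction (p0 : M) (r a : R) : 0 <= a ->
  a ^+ 2 < (1 - lambda ^+ 2) / 3 ->
  (forall q, ~ d p0 q r -> normA_le atlas X N a q) -> False.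
Proof.
move=> a0 a_small Ar; have n0 := noncompact_dim_gt0 p0.
pose eta := @step_size R n k lambda a.
have eta0 : 0 < eta by exact: step_size_gt0.
pose u q := dotp (X q) (X q) / 2.
(* Each step moves by less than 1, so a start at distance r + j leaves room for j steps outside the
   ball of radius r. *)
have climb (j : nat) p : ~ d p0 p (r + j%:R) -> exists q, u p + j%:R * eta <= u q.
  elim: j p => [p _|j IH p np]; first by exists p; rewrite mul0r addr0.
  have far q : d p q 1 -> ~ d p0 q (r + j%:R).
    move=> /(dlt_sym Mm Xi) dq dq'; apply: np.
    by have := dlt_trans dq' dq; rewrite -addrA natr1.
  have [|q dq uq] := step Mm Xh X_ball Mc k0 n0 a0 a_small (p := p).
    move=> q /far nq; apply: Ar => dr; apply: nq; apply: dlt_le dr.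
    by rewrite lerDl.
  have [q' uq'] := IH q (far q dq); exists q'; apply: le_trans uq'.
  have {}uq : u p + eta <= u q by exact: uq.
  by rewrite -natr1 mulrDl mul1r; lra.
have [j jk] : exists j : nat, k ^+ 2 / 2 < j%:R * eta.
  exists (Num.truncn (k ^+ 2 / 2 / eta)).+1.
  by rewrite -ltr_pdivrMr//; exact: truncnS_gt.
have [p np] := far_points Mm Xi Mc p0 (r + j%:R) Mnc.
have [q uq] := climb j p np.
have u0 : 0 <= u p by rewrite divr_ge0// dotp_ge0.
have uk : u q <= k ^+ 2 / 2.
  rewrite ler_pM2r ?invr_gt0// -sqr_enorm ler_sqr ?nnegrE ?enorm_ge0 ?X_ball//.
  exact: ltW.
by have := le_lt_trans uk jk; rewrite ltNge => /negP; apply; lra.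
Qed.

Lemma sup_normA_outside_ge (p0 : M) (r : R) : `|lambda| <= 1 ->
  ((Num.sqrt ((1 - lambda ^+ 2) / 3))%:E <= sup_normA_outside atlas X N p0 r)%E.
Proof.
move=> lambda1; rewrite leNgt; apply/negP => supb.
have w0 : 0 <= (1 - lambda ^+ 2) / 3.
  rewrite divr_ge0// subr_ge0 -(real_normK (num_real lambda)).
  by rewrite expr_le1.
have frame q : exists c E, [/\ atlas c, cdom c q &
    local_orthonormal_frame X c (cmap c q) E].
  have [c Ac cq] := manifold_cover Mm q.
  by have [E fE] := frame_exists Mm Xi Ac (chart_cod cq); exists c, E.
have sup_ub q c E : ~ d p0 q r -> atlas c -> cdom c q ->
    local_orthonormal_frame X c (cmap c q) E ->
    ((Num.sqrt (sqr_normA X N c (cmap c q) E))%:E <= sup_normA_outside atlas X N p0 r)%E.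
  move=> nq Ac cq fE; apply: ereal_sup_ubound.
  exists (Num.sqrt (sqr_normA X N c (cmap c q) E)) => //.
  by exists q; [move/(dltP atlas X)|exists c, E].
(* A point outside the ball keeps the supremum from being -oo, the value on the empty set; [supb]
   excludes +oo, so it is a real number. *)
have [q0 nq0] := far_points Mm Xi Mc p0 r Mnc.
have [c0 [E0 [Ac0 cq0 fE0]]] := frame q0.
have sup0 := sup_ub q0 c0 E0 nq0 Ac0 cq0 fE0.
have [a supE] : exists a, sup_normA_outside atlas X N p0 r = a%:E.
  move: supb sup0; case: (sup_normA_outside _ _ _ _ _) => [a|//|//]; by exists a.
rewrite supE lte_fin in supb; rewrite supE lee_fin in sup0.
have a0 : 0 <= a by apply: le_trans sup0; exact: sqrtr_ge0.
apply: (@small_normA_contradiction p0 r a) => //.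
  by rewrite -(sqr_sqrtr w0) ltr_sqr ?nnegrE ?sqrtr_ge0.
move=> q nq c E Ac cq fE; have := sup_ub q c E nq Ac cq fE.
rewrite supE lee_fin => h.
have S0 : 0 <= sqr_normA X N c (cmap c q) E.
  by apply: sumr_ge0 => i _; apply: sumr_ge0 => j _; exact: sqr_ge0.
by rewrite -(sqr_sqrtr S0) ler_sqr ?nnegrE ?sqrtr_ge0.
Qed.

End Conclusion.

Theorem theorem8p1 (R : realType) (n : nat) (M : topologicalType)
    (atlas : set (chart R n M)) (X N : M -> 'rV[R]_n.+1)
    (k lambda : R) (p0 : M)
    (k_gt0 : 0 < k) (lambda_le1 : `|lambda| <= 1)
    (M_manifold : smooth_manifold atlas)
    (X_hyp : lambda_hypersurface atlas X N lambda)
    (X_ball : forall p, enorm (X p) <= k)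
    (M_complete : complete_metric atlas X)
    (M_connected : connected [set: M])
    (M_noncompact : ~ compact [set: M]) :
  cvg (sup_normA_outside atlas X N p0 r @[r --> +oo%R]) /\
  ((Num.sqrt ((1 - lambda ^+ 2) / 3))%:E <=
     lim (sup_normA_outside atlas X N p0 r @[r --> +oo%R]))%E.
Proof.
(* Larger balls leave fewer points, so the limit exists and is the infimum over r; a bound for each
   r then suffices. *)
have sup_le : nonincreasing_fun (sup_normA_outside atlas X N p0).
  move=> r s rs; apply: ereal_sup_le => _ [a [q nq Aq] <-].
  exists a => //; exists q => // dq; apply: nq; apply: lt_le_trans dq _.
  by rewrite lee_fin.
have supC := nonincreasing_cvge sup_le; split; first exact: cvgP supC.
rewrite (cvg_lim _ supC)//; apply: le_ereal_inf_tmp => _ [r _ <-].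
exact: (sup_normA_outside_ge M_manifold X_hyp X_ball M_complete k_gt0).
Qed.
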